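(* Let $k_1,k_2\in\mathbb{N}$ with $k_1+k_2\geq 1$ be fixed. For all colored graphs $G,H$ and all $(k_1,k_2)$-configurations $(\alpha,\beta)$ over $G$ and $H$, one can decide whether $G,\alpha\equiv_{\mathsf{C}^{(k_1,k_2)}}H,\beta$ using space $O\bigl(k_1(k_2+1)n^{k_1}\log n+k_2^2\log n\bigr)$ and polynomial time, where $n=\max(|V(G)|,|V(H)|)$.
   Context: Colored graphs are finite simple graphs with a vertex coloring. First-order logic with counting $\mathsf{C}$ has atomic formulas $x=y$, $E(x,y)$, $U_c(x)$, Boolean connectives, and quantifiers $\forall,\exists,\exists^{\geq n}$. A variable $x$ is requantified in $\varphi$ if it is both free and bound in $\varphi$, or $\varphi$ has a subformula $Qx\,\psi$ where $\psi$ has a subformula $Q'x\,\chi$ ($Q,Q'$ quantifiers). With $[x_{k_1}]=\{x_1,\dots,x_{k_1}\}$ and $[y_{k_2}]=\{y_1,\dots,y_{k_2}\}$, $\mathsf{C}^{(k_1,k_2)}$ is the set of $\mathsf{C}$-formulas with variables in $[x_{k_1}]\cup[y_{k_2}]$ in which no $y_j$ is requantified. A $(k_1,k_2)$-configuration over $G,H$ is a pair of partial functions $\alpha\colon[x_{k_1}]\cup[y_{k_2}]\rightharpoonup V(G)$, $\beta\colon[x_{k_1}]\cup[y_{k_2}]\rightharpoonup V(H)$ with equal domains. $G,\alpha\equiv_{\mathsf{C}^{(k_1,k_2)}}H,\beta$ means: for every $\varphi\in\mathsf{C}^{(k_1,k_2)}$ with $\operatorname{free}(\varphi)\cap[x_{k_1}]\subseteq\operatorname{dom}(\alpha)$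 and $\operatorname{free}(\varphi)\cap[y_{k_2}]=\operatorname{dom}(\alpha)\cap[y_{k_2}]$, $G,\alpha\models\varphi$ iff $H,\beta\models\varphi$. Complexity is for deterministic Turing machines; the $O$ notation hides constant factors depending only on $k_1,k_2$. *)

(* Defs.v *)
From HB Require Import structures.
From mathcomp Require Import all_boot.

Set Implicit Arguments.
Unset Strict Implicit.
Unset Printing Implicit Defensive.

Record cgraph := CGraph {
  vertex :> finType;
  edge : rel vertex;
  color : vertex -> nat;
  edge_sym : symmetric edge;
  edge_irr : irreflexive edge }.

Definition nb_vertices (G : cgraph) : nat := #|vertex G|.

Inductive quantifier := Forall | Exists | AtLeast of nat.

Inductive form (V : Type) :=
| Equal of V & V
| Edge of V & V
| Color of nat & V
| Not of form V
| And of form V & form V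
| Or of form V & form V
| Imp of form V & form V
| Quant of quantifier & V & form V.

Section Syntax.
Variable V : eqType.
Implicit Types (phi psi chi : form V) (x : V).

Fixpoint free phi : pred V :=
  match phi with
  | Equal y z | Edge y z => pred2 y z
  | Color _ y => pred1 y
  | Not psi => free psi
  | And psi chi | Or psi chi | Imp psi chi => predU (free psi) (free chi)
  | Quant _ y psi => predD (free psi) (pred1 y)
  end.

Inductive subform phi : form V -> Prop :=
| subform_refl : subform phi phi
| subform_not psi : subform phi psi -> subform phi (Not psi)
| subform_andl psi chi : subform phi psi -> subform phi (And psi chi)
| subform_andr psi chi : subform phi chi -> subform phi (And psi chi)
| subform_orl psi chi : subform phi psi -> subform phi (Or psi chi)
| subform_orr psi chi : subform phi chi -> subform phi (Or psi chi)
| subform_impl psi chi : subform phi psi -> subform phi (Imp psi chi)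
| subform_impr psi chi : subform phi chi -> subform phi (Imp psi chi)
| subform_quant q x psi : subform phi psi -> subform phi (Quant q x psi).

Definition bound x phi : Prop :=
  exists q psi, subform (Quant q x psi) phi.

Definition requantified x phi : Prop :=
  (free phi x /\ bound x phi) \/
  (exists q psi, subform (Quant q x psi) phi /\
     exists q' chi, subform (Quant q' x chi) psi).

End Syntax.

Section Semantics.
Variables (V : eqType) (G : cgraph).

Definition assignment := V -> option G.

Definition update (a : assignment) (x : V) (u : G) : assignment :=
  fun y => if y == x then Some u else a y.

(** Atoms with an undefined variable are given the junk value [false]; the
    equivalence below only evaluates formulas whose free variables are all
    defined. *)
Fixpoint sat (a : assignment) (phi : form V) : bool :=
  match phi with
  | Equal x y => if (a x, a y) is (Some u, Some v) then u == v else false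
  | Edge x y => if (a x, a y) is (Some u, Some v) then edge u v else false
  | Color c x => if a x is Some u then color u == c else false
  | Not psi => ~~ sat a psi
  | And psi chi => sat a psi && sat a chi
  | Or psi chi => sat a psi || sat a chi
  | Imp psi chi => sat a psi ==> sat a chi
  | Quant Forall x psi => [forall u, sat (update a x u) psi]
  | Quant Exists x psi => [exists u, sat (update a x u) psi]
  | Quant (AtLeast n) x psi => n <= #|[set u | sat (update a x u) psi]|
  end.

End Semantics.

(** [inl i] is the requantifiable variable x_(i+1), and [inr j] is y_(j+1). *)
Definition var (k1 k2 : nat) : finType := ('I_k1 + 'I_k2)%type.

Definition in_C (k1 k2 : nat) (phi : form (var k1 k2)) : Prop :=
  forall j : 'I_k2, ~ requantified (inr j : var k1 k2) phi.

Definition configuration (k1 k2 : nat) (G H : cgraph)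
    (alpha : assignment (var k1 k2) G) (beta : assignment (var k1 k2) H) :=
  forall x, isSome (alpha x) = isSome (beta x).

Definition C_equiv (k1 k2 : nat) (G H : cgraph)
    (alpha : assignment (var k1 k2) G) (beta : assignment (var k1 k2) H) :=
  forall phi : form (var k1 k2), in_C phi ->
    (forall i : 'I_k1, free phi (inl i) -> isSome (alpha (inl i))) ->
    (forall j : 'I_k2, free phi (inr j) = isSome (alpha (inr j))) ->
    (sat alpha phi <-> sat beta phi).

(** Offline machines: a two-way read-only input tape between end markers, and
    finitely many one-way infinite read/write work tapes. *)

Inductive direction := MLeft | MStay | MRight.

Inductive input_sym (Sigma : Type) := LeftEnd | RightEnd | Sym of Sigma.
Arguments LeftEnd {Sigma}.
Arguments RightEnd {Sigma}.

Record DTM (Sigma : finType) := MkDTM {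
  state : finType;
  tapes : nat;
  tape_sym : finType;
  blank : tape_sym;
  start : state;
  accept : state;
  reject : state;
  accept_neq_reject : accept != reject;
  delta : state -> input_sym Sigma -> {ffun 'I_tapes -> tape_sym} ->
          state * direction * {ffun 'I_tapes -> tape_sym * direction} }.

Section Run.
Variables (Sigma : finType) (M : DTM Sigma) (w : seq Sigma).

Record config := Config {
  cstate : state M;
  input_head : nat;
  work_head : 'I_(tapes M) -> nat;
  cell : 'I_(tapes M) -> nat -> tape_sym M }.

(** Position 0 is the left end marker, positions 1 .. size w carry the word. *)
Definition read_input (p : nat) : input_sym Sigma :=
  if p is i.+1 then
    if onth w i is Some a then Sym a else RightEnd
  else LeftEnd.

Definition shift (m : direction) (p : nat) : nat :=
  match m with MLeft => p.-1 | MStay => p | MRight => p.+1 end.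

Definition halted (c : config) : bool :=
  (cstate c == accept M) || (cstate c == reject M).

(** The input head cannot leave the input and its end markers, so that its
    position is not an unbounded storage. *)
Definition step (c : config) : config :=
  if halted c then c else
  let: (q, m, act) :=
    delta (cstate c) (read_input (input_head c))
          [ffun i => cell c i (work_head c i)] in
  Config q
    (minn (shift m (input_head c)) (size w).+1)
    (fun i => shift (act i).2 (work_head c i))
    (fun i p => if p == work_head c i then (act i).1 else cell c i p).

Definition init : config :=
  Config (start M) 0 (fun _ => 0) (fun _ _ => blank M).

Definition run (t : nat) : config := iter t step init.

(** Number of visited work-tape cells: on each tape these are the cells from 0
    to the largest head position. *)
Definition space_used (t : nat) : nat :=
  \sum_(i < tapes M) (\max_(s < t.+1) work_head (run s) i).+1.

End Run.

(** Words over bits and a separator [None]. *)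
Definition letter : finType := option bool.

Definition enc_nat (n : nat) : seq letter := rcons (nseq n (Some true)) None.

Definition colors (G : cgraph) : seq nat := [seq color u | u <- enum (vertex G)].

(** Colors are arbitrary, but at most |V(G)| + |V(H)| of them occur in G and H;
    in the input they are represented by an arbitrary injective naming below
    that number, common to both graphs. *)
Definition color_naming (G H : cgraph) (nm : nat -> nat) : Prop :=
  {in colors G ++ colors H &, injective nm} /\
  {in colors G ++ colors H, forall c, nm c < nb_vertices G + nb_vertices H}.

Lemma color_naming_exists (G H : cgraph) : exists nm, color_naming G H nm.
Proof.
set cs := colors G ++ colors H.
exists (fun c => index c cs); split.
  move=> c d hc hd e.
  by rewrite -(nth_index 0 hc) -(nth_index 0 hd) e.
move=> c hc; rewrite /nb_vertices !cardE -!(size_map (@color _)) -size_cat.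
by rewrite index_mem.
Qed.

(** Order in unary, adjacency matrix row by row, list of color names. *)
Definition enc_graph (nm : nat -> nat) (G : cgraph) : seq letter :=
  enc_nat (nb_vertices G)
  ++ flatten [seq [seq Some (edge u v) | v <- enum (vertex G)]
             | u <- enum (vertex G)]
  ++ flatten [seq enc_nat (nm c) | c <- colors G].

(** A vertex is represented by its rank plus one, an undefined value by 0. *)
Definition enc_vertex (G : cgraph) (o : option G) : seq letter :=
  if o is Some u then enc_nat (enum_rank u).+1 else enc_nat 0.

Definition enc_assignment (k1 k2 : nat) (G : cgraph)
    (a : assignment (var k1 k2) G) : seq letter :=
  flatten [seq enc_vertex (a (inl i)) | i <- enum 'I_k1]
  ++ flatten [seq enc_vertex (a (inr j)) | j <- enum 'I_k2].

Definition enc_instance (k1 k2 : nat) (nm : nat -> nat) (G H : cgraph)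
    (alpha : assignment (var k1 k2) G) (beta : assignment (var k1 k2) H) :
    seq letter :=
  enc_graph nm G ++ enc_graph nm H
  ++ enc_assignment alpha ++ enc_assignment beta.

(** [trunc_log 2 n] is the integer part of the binary logarithm. *)
Definition space_bound (k1 k2 n : nat) : nat :=
  k1 * (k2 + 1) * n ^ k1 * trunc_log 2 n + k2 ^ 2 * trunc_log 2 n.

(* Main.v *)
Require Import Defs.
From Stdlib Require Import Classical.
From mathcomp Require Import all_boot zify.

Set Implicit Arguments.
Unset Strict Implicit.
Unset Printing Implicit Defensive.

(** Partition refinement on the disjoint union of the two graphs. Fix the values
    of the y's on two structures. The assignments of the x's, with an extra value
    for "undefined", are numbered in base N + 1, and a table sends each number to
    the least number of its class. A round separates two assignments when they
    differ in atomic type, in the number of x_i-extensions that fall into some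
    class, or in the number of y_j-extensions, for y_j undefined, that are
    equivalent to some reference extension. The last test is a recursive call, so
    the depth is the number of undefined y's and k2 + 1 tables of 2 (N + 1)^k1
    numbers suffice. The stable partition is the logical equivalence: a class of
    positions is defined by a counting formula because there are only finitely
    many positions, and conversely equal counts transfer quantifiers.

    The algorithm is a term of an arithmetic language with bounded sums and
    iterated tables, compiled to loops over binary counters and then to a machine.
    The degree of a term bounds all its intermediate values by a power of the
    input length, so that counters take logarithmic space and loops polynomial
    time. *)

(** * Compiling structured programs to offline machines *)

(** A table over all variables would need about n^(k1 + k2) entries. Since no y is requantified, a
    value given to y_j persists in its whole scope and fits in one counter, so only the x's are
    tabulated and the y's become recursion depth. The price is that an extension by y_j has no entry
    in the current table. Its class has no name there and is referred to by a representative, an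
    index together with a value of y_j, and membership is recomputed at every query. This multiplies
    the time by a polynomial at each of the constantly many levels. Both structures share one table
    because class names from separate tables could not be compared.

    On the logical side, indistinguishability quantifies over infinitely many formulas, so the
    separating formulas come from excluded middle. On the machine side, the factor n^k1 must not be
    derived from the generic bound on values, whose exponent is much larger: values enter the space
    bound only through their binary length, while the table length is estimated separately. *)

Notation sym := (option (option (option bool))).
Definition sblank : sym := None.
Definition ssep : sym := Some None.
Definition sbit (b : bool) : sym := Some (Some (Some b)).

(** [Tp i f] is one machine step that reads and writes tape [i] only, [In f] one
    step that reads the input only; the boolean they produce is an exit status,
    tested by [Ite] and [Wh]. *)
Inductive mcmd :=
| Tp of nat & (sym -> bool * (sym * direction))
| In of (input_sym letter -> bool * direction)
| Ite of mcmd & mcmd & mcmd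
| Wh of mcmd & mcmd.

(** Tapes are indexed by all natural numbers, so that programs compose without a common tape count;
    the machine keeps those below [ntapes]. *)
Record data := Data { ih : nat; wh : nat -> nat; cl : nat -> nat -> sym }.

Definition act (d : data) (i : nat) (a : sym) (m : direction) : data :=
  Data (ih d) (fun j => if j == i then shift m (wh d j) else wh d j)
    (fun j p => if (j == i) && (p == wh d j) then a else cl d j p).

Section Exec.
Variables (w : seq letter) (Bd : nat -> nat).

Definition imove (d : data) (m : direction) : data :=
  Data (minn (shift m (ih d)) (size w).+1) (wh d) (cl d).

(** [mexec c d t b d']: [c] takes exactly [t] steps from [d] to [d'], exits with
    status [b], and no head [i] ever passes [Bd i]. *)
Inductive mexec : mcmd -> data -> nat -> bool -> data -> Prop :=
| XTp i f d b a m : f (cl d i (wh d i)) = (b, (a, m)) ->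
    shift m (wh d i) <= Bd i -> mexec (Tp i f) d 1 b (act d i a m)
| XIn f d b m : f (read_input w (ih d)) = (b, m) ->
    mexec (In f) d 1 b (imove d m)
| XIte c c1 c2 d t b d1 t' b' d2 : mexec c d t b d1 ->
    mexec (if b then c1 else c2) d1 t' b' d2 ->
    mexec (Ite c c1 c2) d (t + t') b' d2
| XWhF c c' d t d1 : mexec c d t false d1 -> mexec (Wh c c') d t false d1
| XWhT c c' d t d1 t1 b d2 t2 b' d3 : mexec c d t true d1 ->
    mexec c' d1 t1 b d2 -> mexec (Wh c c') d2 t2 b' d3 ->
    mexec (Wh c c') d (t + (t1 + t2)) b' d3.

(** There are no exit states. An exit status takes the place of a successor state and is redirected
    at once to the next entry point, so control flow takes no steps of its own and times add up
    exactly as in [mexec]. *)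
Fixpoint mstate (c : mcmd) : finType :=
  match c with
  | Tp _ _ | In _ => unit : finType
  | Ite c c1 c2 => (mstate c + (mstate c1 + mstate c2))%type
  | Wh c c' => (mstate c + mstate c')%type
  end.

Fixpoint entry (c : mcmd) : mstate c :=
  match c return mstate c with
  | Tp _ _ | In _ => tt
  | Ite c _ _ => inl (entry c)
  | Wh c _ => inl (entry c)
  end.

Definition maction : Type := direction * option (nat * (sym * direction)).

Definition liftx (A B : Type) (g : A -> B) (h : bool -> B)
    (r : (A + bool) * maction) : B * maction :=
  (match r.1 with inl q => g q | inr b => h b end, r.2).

Fixpoint trans (c : mcmd) : mstate c -> input_sym letter -> (nat -> sym) ->
    (mstate c + bool) * maction :=
  match c return mstate c -> input_sym letter -> (nat -> sym) ->
    (mstate c + bool) * maction with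
  | Tp i f => fun _ _ rd =>
      let: (b, (a, m)) := f (rd i) in (inr b, (MStay, Some (i, (a, m))))
  | In f => fun _ x _ => let: (b, m) := f x in (inr b, (m, None))
  | Ite c c1 c2 => fun q x rd =>
      match q with
      | inl q => liftx (fun q => inl (inl q))
          (fun b => inl (inr (if b then inl (entry c1) else inr (entry c2))))
          (trans q x rd)
      | inr (inl q) => liftx (fun q => inl (inr (inl q))) inr (trans q x rd)
      | inr (inr q) => liftx (fun q => inl (inr (inr q))) inr (trans q x rd)
      end
  | Wh c c' => fun q x rd =>
      match q with
      | inl q => liftx (fun q => inl (inl q))
          (fun b => if b then inl (inr (entry c')) else inr false)
          (trans q x rd)
      | inr q => liftx (fun q => inl (inr q)) (fun _ => inl (inl (entry c)))
          (trans q x rd)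
      end
  end.

Definition perform (d : data) (m : maction) : data :=
  let d' := imove d m.1 in
  if m.2 is Some (i, (a, m')) then act d' i a m' else d'.

(** The head bounds are recorded at both ends of every step, because space is a maximum over all
    times of the run and not only over its end. *)
Inductive go (c : mcmd) : nat -> mstate c -> data -> mstate c + bool -> data -> Prop :=
| go1 q d x m : trans q (read_input w (ih d)) (fun i => cl d i (wh d i)) = (x, m) ->
    (forall i, wh d i <= Bd i) -> (forall i, wh (perform d m) i <= Bd i) ->
    ih d <= (size w).+1 -> go 1 q d x (perform d m)
| goS t t' q d q' d' x d'' :
    go t q d (inl q') d' -> go t' q' d' x d'' -> go (t + t') q d x d''.

(** Moves of the input head are clamped at the right marker, so staying in place is the identity
    only for a head that is within the input; the invariant carries this along. *)
Definition fine_data d := (forall i, wh d i <= Bd i) /\ ih d <= (size w).+1.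

Lemma perform_fine d m : fine_data d ->
  (if m.2 is Some (i, (a, m')) then shift m' (wh d i) <= Bd i else true) ->
  fine_data (perform d m).
Proof.
case: m => m [[i [a m']]|] /= [h1 h2] h; rewrite /perform /=; split => //=.
- by move=> j; case: eqP => [->|].
- by rewrite geq_minr.
- by rewrite geq_minr.
Qed.

Lemma imove_stay d : ih d <= (size w).+1 -> imove d MStay = d.
Proof. by case: d => h a b /= le; rewrite /imove /=; congr Data; apply/minn_idPl. Qed.

Lemma act_fine d i a m : fine_data d -> shift m (wh d i) <= Bd i ->
  perform d (MStay, Some (i, (a, m))) = act d i a m.
Proof. by case=> _ h2 _; rewrite /perform /= imove_stay. Qed.

Lemma mexec_fine c d t b d' : mexec c d t b d' -> fine_data d -> fine_data d'.
Proof.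
elim=> {c d t b d'} //.
- move=> i f d b a m _ le fd; rewrite -act_fine //; exact: perform_fine.
- by move=> f d b m _ fd; exact: (@perform_fine d (m, None)).
- by move=> *; auto.
- by move=> *; auto.
Qed.

(** A component works on its own summand of the states until it exits, where [h] takes over; its run
    is therefore a run of the whole program after relabelling. *)
Lemma go_lift (c c' : mcmd) (g : mstate c -> mstate c') (h : bool -> mstate c' + bool)
    t q d x d' :
  (forall q x rd, trans (g q) x rd = liftx (fun q => inl (g q)) h (trans q x rd)) ->
  go t q d x d' -> go t (g q) d (match x with inl q => inl (g q) | inr b => h b end) d'.
Proof.
move=> H; elim=> {t q d x d'} [q d x m e f1 f2 f3|t t' q d q' d' x d'' _ h1 _ h2].
- by apply: go1 => //; rewrite H e.
- by apply: goS h1 h2.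
Qed.

Lemma mexec_go c d t b d' : mexec c d t b d' -> fine_data d ->
  go t (entry c) d (inr b) d'.
Proof.
elim=> {c d t b d'}.
- move=> i f d b a m e le fd; rewrite -act_fine //.
  have fd' := @perform_fine d (MStay, Some (i, (a, m))) fd le.
  by case: (fd) => ? ?; case: fd' => ? ?; apply: go1 => //=; rewrite e.
- move=> f d b m e fd.
  have fd' := @perform_fine d (m, None) fd isT.
  rewrite -[imove d m]/(perform d (m, None)).
  by case: (fd) => ? ?; case: fd' => ? ?; apply: go1 => //=; rewrite e.
- move=> c c1 c2 d t b d1 t' b' d2 e1 h1 e2 h2 fd.
  have fd1 := mexec_fine e1 fd.
  have := @go_lift c (Ite c c1 c2) inl
    (fun b => inl (inr (if b then inl (entry c1) else inr (entry c2)))) _ _ _ _ _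
    (fun _ _ _ => erefl) (h1 fd).
  move/goS; apply=> /=.
  case: b {e1 h1 e2} h2 => h2.
  + exact: (@go_lift c1 (Ite c c1 c2) (fun q => inr (inl q)) inr _ _ _ _ _
      (fun _ _ _ => erefl) (h2 fd1)).
  + exact: (@go_lift c2 (Ite c c1 c2) (fun q => inr (inr q)) inr _ _ _ _ _
      (fun _ _ _ => erefl) (h2 fd1)).
- move=> c c' d t d1 e1 h1 fd.
  exact: (@go_lift c (Wh c c') inl
    (fun b => if b then inl (inr (entry c')) else inr false) _ _ _ _ _
    (fun _ _ _ => erefl) (h1 fd)).
- move=> c c' d t d1 t1 b d2 t2 b' d3 e1 h1 e2 h2 e3 h3 fd.
  have fd1 := mexec_fine e1 fd; have fd2 := mexec_fine e2 fd1.
  apply: goS (@go_lift c (Wh c c') inl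
    (fun b => if b then inl (inr (entry c')) else inr false) _ _ _ _ _
    (fun _ _ _ => erefl) (h1 fd)) _ => /=.
  apply: goS (@go_lift c' (Wh c c') inr (fun _ => inl (inl (entry c))) _ _ _ _ _
    (fun _ _ _ => erefl) (h2 fd1)) _ => /=.
  exact: h3.
Qed.

End Exec.

Fixpoint ntapes (c : mcmd) : nat :=
  match c with
  | Tp i _ => i.+1
  | In _ => 0
  | Ite c c1 c2 => maxn (ntapes c) (maxn (ntapes c1) (ntapes c2))
  | Wh c c' => maxn (ntapes c) (ntapes c')
  end.

(** * The machine of a program *)

Section Machine.
Variable c : mcmd.
Let n := ntapes c.

(** By [trans_read] the default is never consulted: a program reads only tapes below its
    [ntapes]. *)
Definition mread (r : {ffun 'I_n -> sym}) (i : nat) : sym :=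
  if insub i is Some o then r o else sblank.

Definition mdelta (q : mstate c + bool) (x : input_sym letter)
    (r : {ffun 'I_n -> sym}) :
    (mstate c + bool) * direction * {ffun 'I_n -> sym * direction} :=
  let: (q', (m, o)) := if q is inl q0 then trans q0 x (mread r)
                       else (q, (MStay, None)) in
  (q', m, [ffun j : 'I_n =>
     if o is Some (i, am) then if val j == i then am else (r j, MStay)
     else (r j, MStay)]).

Definition machine : DTM letter :=
  @MkDTM letter (mstate c + bool)%type n (sym : finType) sblank
    (inl (entry c)) (inr true) (inr false) isT mdelta.

Variables (w : seq letter) (Bd : nat -> nat).

Definition matches (k : config machine) (x : mstate c + bool) (d : data) : Prop :=
  [/\ cstate k = x, input_head k = ih d,
      forall i, work_head k i = wh d i & forall i p, cell k i p = cl d i p].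

Lemma trans_read c' (q : mstate c') x rd rd' :
  (forall i, i < ntapes c' -> rd i = rd' i) -> trans q x rd = trans q x rd'.
Proof.
elim: c' q => [i f|f|c0 h0 c1 h1 c2 h2|c0 h0 c1 h1] /= q H.
- by rewrite H.
- by [].
- case: q => [q|[q|q]]; (rewrite h0 || rewrite h1 || rewrite h2) => // i hi;
  by apply: H; rewrite !leq_max hi ?orbT.
- case: q => q; (rewrite h0 || rewrite h1) => // i hi;
  by apply: H; rewrite !leq_max hi ?orbT.
Qed.

Lemma go_run t q d x d' k : go w Bd t q d x d' -> matches k (inl q) d ->
  matches (iter t (step w) k) x d' /\
  (forall s, s <= t -> forall i : 'I_n, work_head (iter s (step w) k) i <= Bd i).
Proof.
move=> g; elim: g k => {t q d x d'} [q d x m e f1 f2 f3|t t' q d q' d' x d'' _ h1 _ h2] k hk.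
- have H : matches (step w k) x (perform w d m).
    case: hk => e1 e2 e3 e4; rewrite /step /halted e1 /=.
    case: m e f2 => m o e f2.
    have -> : mdelta (inl q) (read_input w (input_head k))
       [ffun i => cell k i (work_head k i)] =
       (x, m, [ffun j : 'I_n => if o is Some (i, am) then
          if val j == i then am else (cl d j (wh d j), MStay)
          else (cl d j (wh d j), MStay)]).
      rewrite /mdelta e2 (@trans_read _ _ _ _ (fun i => cl d i (wh d i))).
        rewrite e; congr (_, _, _); apply/ffunP=> j; rewrite !ffunE e4 e3 //.
      move=> i hi; rewrite /mread insubT ffunE e4 e3 //.
    rewrite /perform /=; split => //=.
    + by rewrite e2; case: (o) => [[i [a m']]|].
    + move=> i; rewrite ffunE e3; case: (o) => [[j [a m']]|] //=.
      by case: ifP.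
    + move=> i p; rewrite ffunE e3; case: (o) => [[j [a m']]|] //=.
        rewrite e4; case: (val i =P j) => [->|_] /=; first by [].
        by case: eqP => // ->.
      by rewrite e4; case: eqP => // ->.
  split=> // s; rewrite leq_eqVlt ltnS leqn0 => /orP[]/eqP-> i /=.
  + by case: H => _ _ -> _.
  + by case: hk => _ _ -> _.
- have [m1 b1] := h1 _ hk; have [m2 b2] := h2 _ m1.
  rewrite addnC iterD; split=> // s hs i.
  case: (leqP s t) => [/b1|lt]; first exact.
  have -> : s = (s - t) + t by lia.
  by rewrite iterD; apply: b2; lia.
Qed.

Definition data0 : data := Data 0 (fun _ => 0) (fun _ _ => sblank).

Lemma machine_run t b d : mexec w Bd c data0 t b d ->
  [/\ halted (run machine w t), cstate (run machine w t) = accept machine <-> b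
    & space_used machine w t <= \sum_(i < n) (Bd i).+1].
Proof.
move=> ex; have fd : fine_data w Bd data0 by split.
have [[e1 _ _ _] hb] := go_run (mexec_go ex fd)
  (And4 erefl erefl (fun _ => erefl) (fun _ _ => erefl) :
   matches (init machine) (inl (entry c)) data0).
split.
- by rewrite /halted /run e1; case: b {ex e1}.
- by rewrite /run e1; case: b {ex e1}; split.
- apply: leq_sum => i _; rewrite ltnS; apply/bigmax_leqP => s _.
  by apply: hb; rewrite -ltnS ltn_ord.
Qed.

End Machine.

(** * Binary registers and number lists on tapes *)

(** Both branches are the same, so the status of the first command is ignored; the copy of [c2]
    enlarges the state set but takes no time. *)
Definition Seq c1 c2 := Ite c1 c2 c2.
Definition Mv i m := Tp i (fun a => (true, (a, m))).
Definition Wr i a m := Tp i (fun _ => (true, (a, m))).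
Definition Ret i b := Tp i (fun a => (b, (a, MStay))).
Definition Walk i f := Wh (Tp i f) (Ret i true).
Definition goleft (g : sym -> sym) (a : sym) :=
  if a == sblank then (false, (a, MStay)) else (true, (g a, MLeft)).
Definition goright (x y : sym) (a : sym) :=
  if a == x then (true, (y, MRight)) else (false, (a, MStay)).
Definition is_bit (a : sym) := (a == sbit true) || (a == sbit false).

Definition Copy i o :=
  Wh (Tp i (fun a => (is_bit a, (a, MStay))))
     (Ite (Tp i (fun a => (a == sbit true, (a, MRight))))
        (Wr o (sbit true) MRight) (Wr o (sbit false) MRight)).

(** Bits are stored least significant first. The carry turns the initial ones into zeros and the
    symbol behind them into a one; if that symbol was the final blank, a new blank is written after
    it. *)
Definition inc_tape i :=
  Seq (Mv i MRight) (Seq (Walk i (goright (sbit true) (sbit false)))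
  (Seq (Ite (Tp i (fun a => if a == sblank then (true, (sbit true, MRight))
                            else (false, (sbit true, MStay))))
         (Wr i sblank MLeft) (Ret i true))
  (Walk i (goleft id)))).

(** Initial zeros become ones only if a one follows them. The walk to the right therefore leaves
    them unchanged, and the borrow is carried out on the way back. *)
Definition testdec_tape i :=
  Seq (Mv i MRight) (Seq (Walk i (goright (sbit false) (sbit false)))
  (Ite (Tp i (fun a => if a == sbit true then (true, (sbit false, MLeft))
                       else (false, (a, MLeft))))
     (Seq (Walk i (goleft (fun _ => sbit true))) (Ret i true))
     (Seq (Walk i (goleft id)) (Ret i false)))).

(** A register ends at its first blank, so blanking cell 1 suffices; stale symbols further right are
    harmless. *)
Definition wipe_tape i := Seq (Mv i MRight) (Wr i sblank MLeft).

Definition load_tape i o :=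
  Seq (wipe_tape o) (Seq (Mv o MRight) (Seq (Mv i MRight)
  (Ite (Tp i (fun a => if a == sblank then (true, (a, MLeft))
                       else (false, (a, MStay))))
    (Wr o sblank MLeft)
    (Seq (Copy i o) (Seq (Wr o sblank MLeft) (Walk o (goleft id))))))).

Definition emit_tape i o :=
  Seq (Mv o MRight) (Seq (Mv i MRight) (Seq (Copy o i)
  (Seq (Wr i ssep MRight) (Seq (Wr i sblank MLeft)
  (Seq (Mv o MLeft) (Walk o (goleft id))))))).

Definition rewind_tape i := Walk i (goleft id).
Definition reset_tape i := Seq (rewind_tape i) (wipe_tape i).

(** Cell 0 of every tape stays blank: it stops the walks to the left. *)
Definition known (d : data) (i h : nat) (l : seq sym) :=
  [/\ wh d i = h, cl d i 0 = sblank
    & forall p, p < size l -> cl d i p.+1 = nth sblank l p].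

Definition frame (P : pred nat) (d d' : data) :=
  ih d' = ih d /\
  forall j, ~~ P j -> wh d' j = wh d j /\ (forall p, cl d' j p = cl d j p).

Lemma frame_trans P Q d d' d'' : frame P d d' -> frame Q d' d'' ->
  frame (predU P Q) d d''.
Proof.
move=> [e1 h1] [e2 h2]; split; first by rewrite e2.
move=> j /=; rewrite negb_or => /andP[/h1[a1 b1] /h2[a2 b2]].
by split=> [|p]; rewrite ?a2 ?b2.
Qed.

Lemma frame_sub (P Q : pred nat) d d' : frame P d d' -> subpred P Q -> frame Q d d'.
Proof. by move=> [e h] s; split=> // j hj; apply: h; apply: contra hj => /s. Qed.

Lemma frame1_trans (i : nat) d d' d'' :
  frame (pred1 i) d d' -> frame (pred1 i) d' d'' -> frame (pred1 i) d d''.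
Proof. by move=> h1 h2; apply: frame_sub (frame_trans h1 h2) _ => j /orP[]. Qed.

Lemma frame_known (P : pred nat) d d' i h l : frame P d d' -> ~~ P i -> known d i h l ->
  known d' i h l.
Proof.
by move=> [_ H] /H[e1 e2] [a b c]; split=> [||p hp]; rewrite ?e1 ?e2 // c.
Qed.

Lemma known_prefix d i h l l' : known d i h (l ++ l') -> known d i h l.
Proof.
move=> [a b c]; split=> // p hp; rewrite c ?size_cat ?ltn_addr //.
by rewrite nth_cat hp.
Qed.

Section Tapes.
Variables (w : seq letter) (Bd : nat -> nat).
Local Notation mexec := (mexec w Bd).

Definition mt (c : mcmd) (d : data) (n : nat) (Q : bool -> data -> Prop) :=
  exists t b d', [/\ mexec c d t b d', t <= n & Q b d'].

Lemma mt_weaken c d n n' (Q Q' : bool -> data -> Prop) : mt c d n Q -> n <= n' ->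
  (forall b d', Q b d' -> Q' b d') -> mt c d n' Q'.
Proof.
by move=> [t [b [d' [e h q]]]] le H; exists t, b, d'; split; [|exact: leq_trans le|exact: H].
Qed.

Lemma mt_ite c c1 c2 d n n' Q :
  mt c d n (fun b d1 => mt (if b then c1 else c2) d1 n' Q) -> mt (Ite c c1 c2) d (n + n') Q.
Proof.
move=> [t [b [d1 [e h [t' [b' [d2 [e' h' q]]]]]]]]; exists (t + t'), b', d2.
by split=> //; [exact: XIte e e'|exact: leq_add].
Qed.

Lemma mt_seq c1 c2 d n n' Q :
  mt c1 d n (fun _ d1 => mt c2 d1 n' Q) -> mt (Seq c1 c2) d (n + n') Q.
Proof. by move=> h; apply: mt_ite; apply: mt_weaken h _ _ => // -[]. Qed.

Lemma mt_inner i f d b a a' m l1 l2 : known d i (size l1).+1 (l1 ++ a :: l2) ->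
  f a = (b, (a', m)) -> shift m (size l1).+1 <= Bd i ->
  mt (Tp i f) d 1 (fun b' d' => [/\ b' = b, frame (pred1 i) d d'
     & known d' i (shift m (size l1).+1) (l1 ++ a' :: l2)]).
Proof.
move=> [k1 k2 k3] e le; exists 1, b, (act d i a' m); split=> //.
  apply: XTp; rewrite k1 // k3 ?size_cat ?addnS ?ltnS ?leq_addr //.
  by rewrite nth_cat ltnn subnn.
split=> //; first by split=> //= j /negbTE hj; rewrite hj.
split=> /= [||p hp]; rewrite ?eqxx ?k1 //.
rewrite /= eqSS nth_cat; case: eqP => [->|np]; first by rewrite ltnn subnn.
rewrite k3; last by move: hp; rewrite !size_cat.
rewrite nth_cat; case: ltnP => // h.
by have -> : p - size l1 = (p - size l1).-1.+1 by lia.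
Qed.

Lemma mt_origin i f d b m l : known d i 0 l ->
  f sblank = (b, (sblank, m)) -> shift m 0 <= Bd i ->
  mt (Tp i f) d 1 (fun b' d' => [/\ b' = b, frame (pred1 i) d d'
     & known d' i (shift m 0) l]).
Proof.
move=> [k1 k2 k3] e le; exists 1, b, (act d i sblank m); split=> //.
  by apply: XTp; rewrite k1 // k2.
split=> //; first by split=> //= j /negbTE hj; rewrite hj.
by split=> /= [||p hp]; rewrite ?eqxx ?k1 //= k3.
Qed.

Lemma mt_extend i a m d l : known d i (size l).+1 l -> shift m (size l).+1 <= Bd i ->
  mt (Wr i a m) d 1 (fun _ d' => frame (pred1 i) d d' /\
     known d' i (shift m (size l).+1) (rcons l a)).
Proof.
move=> [k1 k2 k3] le; exists 1, true, (act d i a m); split=> //.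
  by apply: XTp; rewrite /= ?k1.
split=> //; first by split=> //= j /negbTE hj; rewrite hj.
split=> /= [||p]; rewrite ?eqxx ?k1 // size_rcons ltnS /= eqSS nth_rcons => hp.
case: eqP => [->|np]; first by rewrite ltnn.
have lt : p < size l by lia.
by rewrite lt k3.
Qed.

Lemma mt_ret i b d h l : known d i h l -> h <= Bd i ->
  mt (Ret i b) d 1 (fun b' d' => [/\ b' = b, frame (pred1 i) d d' & known d' i h l]).
Proof.
move=> [k1 k2 k3] le; exists 1, b, (act d i (cl d i (wh d i)) MStay); split=> //.
  by apply: XTp; rewrite /= ?k1.
split=> //; first by split=> //= j /negbTE hj; rewrite hj.
split=> /= [||p hp]; rewrite ?eqxx //=.
- by case: eqP => // e; rewrite -e.
- by case: eqP => [<-|_]; rewrite k3.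
Qed.

Lemma mt_mv i m d h l : known d i h l -> shift m h <= Bd i ->
  mt (Mv i m) d 1 (fun _ d' => frame (pred1 i) d d' /\ known d' i (shift m h) l).
Proof.
move=> [k1 k2 k3] le; exists 1, true, (act d i (cl d i (wh d i)) m); split=> //.
  by apply: XTp; rewrite /= ?k1.
split=> //; first by split=> //= j /negbTE hj; rewrite hj.
split=> /= [||p hp]; rewrite ?eqxx ?k1 //=.
- by case: eqP => // e; rewrite -e.
- by case: eqP => [<-|_]; rewrite k3.
Qed.

Lemma mt_whF c c' d n Q Q' : mt c d n Q ->
  (forall b d', Q b d' -> b = false /\ Q' false d') -> mt (Wh c c') d n Q'.
Proof.
move=> [t [b [d' [e h q]]]] H; case: (H _ _ q) => eb q'; subst b.
by exists t, false, d'; split=> //; exact: XWhF.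
Qed.

Lemma mt_whT c c' d n n1 n2 Q : mt c d n (fun b d1 => b = true /\
    mt c' d1 n1 (fun _ d2 => mt (Wh c c') d2 n2 Q)) -> mt (Wh c c') d (n + (n1 + n2)) Q.
Proof.
move=> [t [b [d1 [e h [eb [t1 [b1 [d2 [e1 h1 [t2 [b2 [d3 [e2 h2 q]]]]]]]]]]]]].
subst b; exists (t + (t1 + t2)), b2, d3; split=> //; first exact: XWhT e e1 e2.
by rewrite !leq_add.
Qed.

Lemma mt_goright i (x y : sym) k (l1 : seq sym) (a : sym) (l2 : seq sym) d : a != x ->
  known d i (size l1).+1 (l1 ++ nseq k x ++ a :: l2) -> (size l1 + k).+1 <= Bd i ->
  mt (Walk i (goright x y)) d (k.*2.+1) (fun _ d' => frame (pred1 i) d d' /\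
    known d' i (size l1 + k).+1 (l1 ++ nseq k y ++ a :: l2)).
Proof.
move=> ax; elim: k l1 d => [|k IH] l1 d kn le.
  rewrite addn0 in le *.
  apply: mt_whF (mt_inner (b := false) (a' := a) (m := MStay) kn _ le) _ => //=.
    by rewrite /goright (negbTE ax).
  by move=> b d' [-> f kn']; split.
apply: mt_weaken (mt_whT (n1 := 1) (n2 := k.*2.+1) (n := 1) (Q := _) _) _ (fun _ _ h => h).
  apply: mt_weaken (mt_inner (b := true) (a' := y) (m := MRight) kn _ _) _ _ => //=.
  - by rewrite /goright eqxx.
  - by lia.
  move=> b d' [-> f kn']; split=> //.
  apply: mt_weaken (mt_ret true kn' _) _ _ => //; first by lia.
  move=> _ d2 [_ f2 kn2].
  apply: mt_weaken (IH (rcons l1 y) d2 _ _) _ _ => //.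
  - by rewrite size_rcons cat_rcons.
  - by rewrite size_rcons; lia.
  move=> _ d3 [f3]; rewrite size_rcons cat_rcons addSnnS => kn3; split=> //.
  exact: frame1_trans (frame1_trans f f2) f3.
by lia.
Qed.

Lemma mt_goleft i g (seg l2 : seq sym) d : sblank \notin seg ->
  known d i (size seg) (seg ++ l2) -> size seg <= Bd i ->
  mt (Walk i (goleft g)) d ((size seg).*2.+1) (fun _ d' => frame (pred1 i) d d' /\
    known d' i 0 (map g seg ++ l2)).
Proof.
elim/last_ind: seg l2 d => [|seg a IH] l2 d nb kn le.
  apply: mt_whF (mt_origin (b := false) (m := MStay) kn _ _) _ => //.
  by move=> b d' [-> f kn']; split.
rewrite size_rcons in kn le *; rewrite cat_rcons in kn.
move: nb; rewrite mem_rcons inE negb_or eq_sym => /andP[ab nb].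
apply: mt_weaken (mt_whT (n1 := 1) (n2 := (size seg).*2.+1) (n := 1) (Q := _) _) _
  (fun _ _ h => h).
  apply: mt_weaken (mt_inner (b := true) (a' := g a) (m := MLeft) kn _ _) _ _ => //=.
  - by rewrite /goleft (negbTE ab).
  - by lia.
  move=> b d' [-> f kn']; split=> //.
  apply: mt_weaken (mt_ret true kn' _) _ _ => //; first by lia.
  move=> _ d2 [_ f2 kn2].
  apply: mt_weaken (IH (g a :: l2) d2 nb kn2 _) _ _ => //; first by lia.
  move=> _ d3 [f3 kn3]; rewrite map_rcons cat_rcons; split=> //.
  exact: frame1_trans (frame1_trans f f2) f3.
by lia.
Qed.

Lemma blank_bits bs : sblank \notin map sbit bs.
Proof. by elim: bs. Qed.

Lemma frame2_trans (i o : nat) d d' d'' :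
  frame (pred2 i o) d d' -> frame (pred2 i o) d' d'' -> frame (pred2 i o) d d''.
Proof. by move=> h1 h2; apply: frame_sub (frame_trans h1 h2) _ => j /orP[]. Qed.

Lemma frame12l (i o : nat) d d' : frame (pred1 i) d d' -> frame (pred2 i o) d d'.
Proof. by move=> h; apply: frame_sub h _ => j /= ->. Qed.

Lemma frame12r (i o : nat) d d' : frame (pred1 o) d d' -> frame (pred2 i o) d d'.
Proof. by move=> h; apply: frame_sub h _ => j /= ->; rewrite orbT. Qed.

Lemma mt_copy i o bs (l1 : seq sym) (a : sym) (l2 acc : seq sym) d : i != o -> ~~ is_bit a ->
  known d i (size l1).+1 (l1 ++ map sbit bs ++ a :: l2) ->
  known d o (size acc).+1 acc ->
  (size l1 + size bs).+1 <= Bd i -> (size acc + size bs).+1 <= Bd o ->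
  mt (Copy i o) d (3 * size bs).+1 (fun _ d' => [/\ frame (pred2 i o) d d',
    known d' i (size l1 + size bs).+1 (l1 ++ map sbit bs ++ a :: l2)
    & known d' o (size acc + size bs).+1 (acc ++ map sbit bs)]).
Proof.
move=> io na; have oi : o != i by rewrite eq_sym.
elim: bs l1 acc d => [|b bs IH] l1 acc d kn ko lei leo.
  rewrite /= !addn0 in lei leo *.
  apply: mt_whF (mt_inner (b := false) (a' := a) (m := MStay) kn _ lei) _ => //=.
    by rewrite (negbTE na).
  move=> b d' [-> f kn']; split=> //; rewrite cats0; split=> //; first exact: frame12l.
  exact: frame_known f _ ko.
rewrite /= in kn lei leo *.
apply: mt_weaken (mt_whT (n1 := 1 + 1) (n2 := (3 * size bs).+1) (n := 1) (Q := _) _) _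
  (fun _ _ h => h).
  apply: mt_weaken (mt_inner (b := true) (a' := sbit b) (m := MStay) kn _ _) _ _ => //=.
  - by rewrite /is_bit; case: (b).
  - by lia.
  move=> _ d' [-> f kn']; split=> //; apply: mt_ite.
  apply: mt_weaken (mt_inner (b := b) (a' := sbit b) (m := MRight) kn' _ _) _ _ => //=.
  - by case: (b).
  - by lia.
  move=> _ d2 [-> f2 kn2].
  have ko2 := frame_known f2 (oi : ~~ pred1 i o) (frame_known f (oi : ~~ pred1 i o) ko).
  have -> : (if b then Wr o (sbit true) MRight else Wr o (sbit false) MRight) =
     Wr o (sbit b) MRight by case: (b).
  apply: mt_weaken (mt_extend (sbit b) (m := MRight) ko2 _) _ _ => //=; first by lia.
  move=> _ d3 [f3 ko3].
  have kn3 := frame_known f3 (io : ~~ pred1 o i) kn2.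
  apply: mt_weaken (IH (rcons l1 (sbit b)) (rcons acc (sbit b)) d3 _ _ _ _) _ _ => //.
  - by rewrite size_rcons cat_rcons.
  - by rewrite size_rcons.
  - by rewrite size_rcons; lia.
  - by rewrite size_rcons; lia.
  move=> _ d4; rewrite !size_rcons !cat_rcons !addSnnS => -[f4 k4 k5]; split=> //.
  apply: frame2_trans f4; apply: frame2_trans (frame12r _ f3).
  by apply: frame12l; apply: frame1_trans f f2.
by lia.
Qed.

(** * Increment and tested decrement of binary counters *)

Fixpoint bval (bs : seq bool) : nat :=
  if bs is b :: bs' then b + (bval bs').*2 else 0.

(** Together with [bval_zeros] this is the arithmetic of a carry: the successor of the value with k
    initial ones is 2^k times the successor of the rest. *)
Lemma bval_ones k bs : bval (nseq k true ++ bs) = 2 ^ k * (bval bs).+1 - 1.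
Proof. by elim: k => [|k IH] /=; rewrite ?expnS ?IH; lia. Qed.

Lemma bval_zeros k bs : bval (nseq k false ++ bs) = 2 ^ k * bval bs.
Proof. by elim: k => [|k IH] /=; rewrite ?expnS ?IH; lia. Qed.

Lemma split_bits (b : bool) bs : exists k, (bs = nseq k b) \/
  (exists bs', bs = nseq k b ++ (~~ b) :: bs').
Proof.
elim: bs => [|c bs [k IH]]; first by exists 0; left.
case: (eqVneq c b) => [->|nb]; last first.
  by exists 0; right; exists bs => /=; congr cons; case: b c nb {IH} => -[].
by exists k.+1; case: IH => [->|[bs' ->]]; [left|right; exists bs'].
Qed.

Definition reg_tape (d : data) i bs := known d i 0 (map sbit bs ++ [:: sblank]).

(** The string grows only if it consists of k ones. The new value is then 2^k, which needs exactly k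
    + 1 bits. Hence leading zeros left by earlier decrements never push the length beyond that of
    the largest value stored so far. *)
Lemma mt_inc i bs d : reg_tape d i bs -> (size bs).+2 <= Bd i ->
  mt (inc_tape i) d (4 * size bs + 10) (fun _ d' => frame (pred1 i) d d' /\
    exists bs', [/\ bval bs' = (bval bs).+1, reg_tape d' i bs' &
      size bs' <= maxn (size bs) (trunc_log 2 (bval bs).+1).+1]).
Proof.
move=> kn le; apply: (@mt_weaken _ _ (1 + ((size bs).*2.+1 + (2 + (size bs).+1.*2.+1))) _ _ _ _ _ (fun _ _ h => h)); last by lia.
apply: mt_seq; apply: mt_weaken (mt_origin (b := true) (m := MRight) kn _ _) _ _ => //.
  by rewrite /=; lia.
move=> _ d1 [_ f1 k1]; rewrite /= in k1; apply: mt_seq.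
case: (split_bits true bs) => k [e|[bs' e]]; rewrite e in kn k1 le *.
- rewrite map_nseq size_nseq in k1 le *.
  apply: mt_weaken (mt_goright (l1 := [::]) (sbit false) (a := sblank) (x := sbit true)
    (k := k) (l2 := [::]) _ k1 _) _ _ => //=; first by lia.
  rewrite add0n => _ d2 [f2 k2]; apply: mt_seq; rewrite -[2]/(1 + 1); apply: mt_ite.
  have k2' : known d2 i (size (nseq k (sbit false))).+1 (nseq k (sbit false) ++ sblank :: [::]).
    by rewrite size_nseq.
  apply: mt_weaken (mt_inner (b := true) (a' := sbit true) (m := MRight) k2' _ _) _ _ => //=.
    by rewrite size_nseq; lia.
  move=> _ d3 [-> f3 k3].
  have k3' : known d3 i (size (nseq k (sbit false) ++ [:: sbit true])).+1
    (nseq k (sbit false) ++ [:: sbit true]) by rewrite size_cat /= addn1.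
  apply: mt_weaken (mt_extend sblank (m := MLeft) k3' _) _ _ => //=.
    by rewrite size_cat size_nseq /=; lia.
  move=> _ d4 [f4]; rewrite -cats1 => k4.
  have nb : sblank \notin nseq k (sbit false) ++ [:: sbit true].
    by rewrite mem_cat mem_nseq !inE /= andbF.
  apply: mt_weaken (mt_goleft id nb k4 _) _ _; rewrite ?size_cat ?size_nseq /=; try lia.
  move=> _ d5 [f5 k5]; split.
    exact: frame1_trans (frame1_trans (frame1_trans (frame1_trans f1 f2) f3) f4) f5.
  exists (nseq k false ++ [:: true]); split.
  + rewrite -[in RHS](cats0 (nseq k true)) bval_ones bval_zeros /=.
    by have := expn_gt0 2 k; lia.
  + by move: k5; rewrite /reg_tape map_id map_cat map_nseq.
  + rewrite size_cat size_nseq /= leq_max; apply/orP; right.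
    rewrite -[in bval _](cats0 (nseq k true)) bval_ones /=.
    have -> : (2 ^ k * 1 - 1).+1 = 2 ^ k by have := expn_gt0 2 k; lia.
    by rewrite trunc_expnK // addn1.
- rewrite map_cat map_nseq -catA /= in k1.
  rewrite size_cat size_nseq /= in le *.
  apply: mt_weaken (mt_goright (l1 := [::]) (sbit false) (a := sbit false) (x := sbit true)
    (k := k) _ k1 _) _ _ => //=; try lia.
  rewrite add0n => _ d2 [f2 k2]; apply: mt_seq; rewrite -[2]/(1 + 1); apply: mt_ite.
  have k2' : known d2 i (size (nseq k (sbit false))).+1
    (nseq k (sbit false) ++ sbit false :: (map sbit bs' ++ [:: sblank])) by rewrite size_nseq.
  apply: mt_weaken (mt_inner (b := false) (a' := sbit true) (m := MStay) k2' _ _) _ _ => //=.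
    by rewrite size_nseq; lia.
  move=> _ d3 [-> f3 k3].
  apply: mt_weaken (mt_ret true k3 _) _ _ => //; first by rewrite size_nseq; lia.
  move=> _ d4 [_ f4 k4].
  have k4' : known d4 i (size (nseq k (sbit false) ++ [:: sbit true]))
    ((nseq k (sbit false) ++ [:: sbit true]) ++ (map sbit bs' ++ [:: sblank])).
    by rewrite -catA size_cat /= addn1.
  have nb : sblank \notin nseq k (sbit false) ++ [:: sbit true].
    by rewrite mem_cat mem_nseq !inE /= andbF.
  apply: mt_weaken (mt_goleft id nb k4' _) _ _; rewrite ?size_cat ?size_nseq /=; try lia.
  move=> _ d5 [f5 k5]; split.
    exact: frame1_trans (frame1_trans (frame1_trans (frame1_trans f1 f2) f3) f4) f5.
  exists (nseq k false ++ true :: bs'); split.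
  + rewrite bval_ones bval_zeros /=.
    by have := expn_gt0 2 k; nia.
  + by move: k5; rewrite /reg_tape map_id map_cat map_nseq -!catA.
  + by rewrite !size_cat !size_nseq /= leq_max leqnn.
Qed.

Lemma mt_testdec i bs d : reg_tape d i bs -> (size bs).+2 <= Bd i ->
  mt (testdec_tape i) d (4 * size bs + 10) (fun b d' => [/\ b = (bval bs != 0),
    frame (pred1 i) d d' &
    exists bs', [/\ bval bs' = (bval bs).-1, reg_tape d' i bs' & size bs' = size bs]]).
Proof.
move=> kn le; apply: (@mt_weaken _ _ (1 + ((size bs).*2.+1 + (1 + ((size bs).*2.+1 + 1)))) _ _ _ _ _ (fun _ _ h => h)); last by lia.
apply: mt_seq; apply: mt_weaken (mt_origin (b := true) (m := MRight) kn _ _) _ _ => //.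
  by rewrite /=; lia.
move=> _ d1 [_ f1 k1]; rewrite /= in k1; apply: mt_seq.
case: (split_bits false bs) => k [e|[bs' e]]; rewrite e in kn k1 le *.
- rewrite map_nseq size_nseq in k1 le *.
  apply: mt_weaken (mt_goright (l1 := [::]) (sbit false) (a := sblank) (x := sbit false)
    (k := k) (l2 := [::]) _ k1 _) _ _ => //=; first by lia.
  rewrite add0n => _ d2 [f2 k2]; apply: mt_ite.
  have k2' : known d2 i (size (nseq k (sbit false))).+1 (nseq k (sbit false) ++ sblank :: [::]).
    by rewrite size_nseq.
  apply: mt_weaken (mt_inner (b := false) (a' := sblank) (m := MLeft) k2' _ _) _ _ => //=.
    by rewrite size_nseq; lia.
  move=> _ d3 [-> f3 k3].
  have nb : sblank \notin nseq k (sbit false) by rewrite mem_nseq andbF.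
  apply: mt_seq; apply: mt_weaken (mt_goleft id nb k3 _) _ _; rewrite ?size_nseq; try lia.
  rewrite map_id => _ d4 [f4 k4].
  apply: mt_weaken (mt_ret false k4 _) _ _ => // _ d5 [-> f5 k5]; split.
  + by rewrite -(cats0 (nseq _ _)) bval_zeros muln0.
  + exact: frame1_trans (frame1_trans (frame1_trans (frame1_trans f1 f2) f3) f4) f5.
  exists (nseq k false); split; rewrite ?size_nseq //.
  + by rewrite -(cats0 (nseq _ _)) bval_zeros muln0.
  + by rewrite /reg_tape map_nseq.
- rewrite map_cat map_nseq -catA /= in k1.
  rewrite size_cat size_nseq /= in le *.
  apply: mt_weaken (mt_goright (l1 := [::]) (sbit false) (a := sbit true) (x := sbit false)
    (k := k) _ k1 _) _ _ => //=; try lia.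
  rewrite add0n => _ d2 [f2 k2]; apply: mt_ite.
  have k2' : known d2 i (size (nseq k (sbit false))).+1
    (nseq k (sbit false) ++ sbit true :: (map sbit bs' ++ [:: sblank])) by rewrite size_nseq.
  apply: mt_weaken (mt_inner (b := true) (a' := sbit false) (m := MLeft) k2' _ _) _ _ => //=.
    by rewrite size_nseq; lia.
  move=> _ d3 [-> f3 k3].
  have nb : sblank \notin nseq k (sbit false) by rewrite mem_nseq andbF.
  apply: mt_seq; apply: mt_weaken (mt_goleft (fun _ => sbit true) nb k3 _) _ _;
    rewrite ?size_nseq; try lia.
  rewrite map_nseq => _ d4 [f4 k4].
  apply: mt_weaken (mt_ret true k4 _) _ _ => // _ d5 [-> f5 k5]; split.
  + by rewrite bval_zeros /=; have := expn_gt0 2 k; nia.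
  + exact: frame1_trans (frame1_trans (frame1_trans (frame1_trans f1 f2) f3) f4) f5.
  exists (nseq k true ++ false :: bs'); split; rewrite ?size_cat ?size_nseq //.
  + rewrite bval_ones bval_zeros /=; have := expn_gt0 2 k; nia.
  + by rewrite /reg_tape map_cat map_nseq -catA.
Qed.

Lemma mt_wipe i d l : known d i 0 l -> 0 < size l -> 1 <= Bd i ->
  mt (wipe_tape i) d 2 (fun _ d' => frame (pred1 i) d d' /\ reg_tape d' i [::]).
Proof.
move=> kn sl le; rewrite -[2]/(1 + 1); apply: mt_seq.
apply: mt_weaken (mt_origin (b := true) (m := MRight) kn _ _) _ _ => //.
move=> _ d1 [_ f1 k1]; case: l kn sl k1 => // a l _ _ k1.
apply: mt_weaken (mt_inner (l1 := [::]) (b := true) (a' := sblank) (m := MLeft) k1 _ _) _ _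
  => //=.
move=> _ d2 [_ f2 k2]; split; first exact: frame1_trans f1 f2.
exact: (@known_prefix _ _ _ [:: sblank] l).
Qed.

(** * Lists of numbers on one tape *)

Definition enc (bss : seq (seq bool)) : seq sym :=
  flatten [seq rcons (map sbit bs) ssep | bs <- bss].

Lemma blank_enc bss : sblank \notin enc bss.
Proof.
elim: bss => //= bs bss IH; rewrite mem_cat negb_or IH andbT mem_rcons inE negb_or.
by rewrite blank_bits.
Qed.

(** At rest the head is on the last cell of the entries already read, so that the
    initial head position 0 needs no special treatment. *)
Definition list_tape (d : data) i p bss :=
  known d i (size (enc (take p bss))) (enc bss ++ [:: sblank]).

Lemma enc_cat s1 s2 : enc (s1 ++ s2) = enc s1 ++ enc s2.
Proof. by rewrite /enc map_cat flatten_cat. Qed.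

Lemma enc_rcons s bs : enc (rcons s bs) = enc s ++ map sbit bs ++ [:: ssep].
Proof. by rewrite -cats1 enc_cat /enc /= cats0 cats1. Qed.

Lemma enc_take p s : enc s = enc (take p s) ++ enc (drop p s).
Proof. by rewrite -enc_cat cat_take_drop. Qed.

Lemma mt_rewind i d p bss : list_tape d i p bss -> size (enc bss) <= Bd i ->
  mt (rewind_tape i) d ((size (enc bss)).*2.+1)
   (fun _ d' => frame (pred1 i) d d' /\ list_tape d' i 0 bss).
Proof.
rewrite /list_tape (enc_take p bss) -catA size_cat => kn le.
apply: mt_weaken (mt_goleft id (blank_enc _) kn _) _ _; try lia.
by rewrite map_id take0.
Qed.

Lemma mt_reset i d p bss : list_tape d i p bss -> (size (enc bss)).+1 <= Bd i ->
  mt (reset_tape i) d ((size (enc bss)).*2.+3)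
   (fun _ d' => frame (pred1 i) d d' /\ list_tape d' i 0 [::]).
Proof.
move=> kn le; apply: (@mt_weaken _ _ ((size (enc bss)).*2.+1 + 2) _ _ _ _ _ (fun _ _ h => h));
  last by lia.
apply: mt_seq; apply: mt_weaken (mt_rewind kn _) _ _ => //; first by lia.
move=> _ d1 [f1 k1]; rewrite /list_tape take0 in k1.
apply: mt_weaken (mt_wipe k1 _ _) _ _; rewrite ?size_cat ?addn1 //; first by lia.
move=> _ d2 [f2 k2]; split=> //; exact: frame1_trans f1 f2.
Qed.

(** Past the last entry the register receives 0 and the head does not advance, in agreement with the
    default value of [nth]. *)
Lemma mt_load i o d p bss bs : i != o -> list_tape d i p bss -> reg_tape d o bs ->
  p <= size bss -> (size (enc bss)).+2 <= Bd i ->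
  (size (nth [::] bss p)).+2 <= Bd o ->
  mt (load_tape i o) d (5 * size (nth [::] bss p) + 10)
   (fun _ d' => [/\ frame (pred2 i o) d d', reg_tape d' o (nth [::] bss p)
      & list_tape d' i (if p < size bss then p.+1 else p) bss]).
Proof.
move=> io ki ko pb lei leo; have oi : o != i by rewrite eq_sym.
set r := nth [::] bss p in leo *.
apply: (@mt_weaken _ _ (2 + (1 + (1 + (1 + ((3 * size r).+1 + (1 + (size r).*2.+1)))))) _ _ _ _ _ (fun _ _ h => h)); last by lia.
apply: mt_seq; apply: mt_weaken (mt_wipe ko _ _) _ _; rewrite ?size_cat ?addn1 //.
  by lia.
move=> _ d1 [f1 ko1]; have ki1 := frame_known f1 (io : ~~ pred1 o i) ki.
apply: mt_seq; apply: mt_weaken (mt_origin (b := true) (m := MRight) ko1 _ _) _ _ => //.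
  by rewrite /=; lia.
move=> _ d2 [_ f2 ko2]; have ki2 := frame_known f2 (io : ~~ pred1 o i) ki1.
(* The old bits of the register are forgotten; copying starts from an empty prefix. *)
have {}ko2 : known d2 o 1 [::] := @known_prefix _ _ _ [::] [:: sblank] ko2.
have F2 := frame12r i (frame1_trans f1 f2).
apply: mt_seq.
have le3 : shift MRight (size (enc (take p bss))) <= Bd i.
  by have := congr1 size (enc_take p bss); rewrite /= size_cat; lia.
apply: mt_weaken (mt_mv ki2 le3) _ _ => // _ d3 [f3 ki3].
have ko3 := frame_known f3 (oi : ~~ pred1 i o) ko2.
have F3 := frame2_trans F2 (frame12l _ f3).
apply: mt_ite; case: (ltnP p (size bss)) => pl; last first.
  have er : r = [::] by rewrite /r nth_default.
  have ep : take p bss = bss by rewrite take_oversize.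
  rewrite ep in ki3.
  apply: mt_weaken (mt_inner (b := true) (a' := sblank) (m := MLeft) ki3 _ _) _ _ => //=.
    by lia.
  move=> _ d4 [-> f4 ki4]; have ko4 := frame_known f4 (oi : ~~ pred1 i o) ko3.
  apply: mt_weaken (mt_extend sblank (m := MLeft) (l := [::]) ko4 _) _ _ => //=; try lia.
  move=> _ d5 [f5 ko5]; split.
  - exact: frame2_trans F3 (frame2_trans (frame12l _ f4) (frame12r _ f5)).
  - by rewrite er.
  - by rewrite /list_tape ep; exact: frame_known f5 (io : ~~ pred1 o i) ki4.
have eb : enc bss ++ [:: sblank] = enc (take p bss) ++ (map sbit r ++ ssep ::
    (enc (drop p.+1 bss) ++ [:: sblank])).
  rewrite {1}(enc_take p) (drop_nth [::]) // -/r -cat1s enc_cat -!catA; congr (_ ++ _).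
  by rewrite cat_rcons.
(* An empty bit string is a legal entry. Its first symbol is then the separator, so the test for the
   end of the list sees a nonblank symbol in either case. *)
have [a [l [ea na]]] : exists a l, enc bss ++ [:: sblank] = enc (take p bss) ++ a :: l /\
    a != sblank.
  rewrite eb; case: (r) => [|c r'] /=; first by exists ssep, (enc (drop p.+1 bss) ++ [:: sblank]).
  by exists (sbit c), (map sbit r' ++ ssep :: enc (drop p.+1 bss) ++ [:: sblank]).
have sz : size (enc (take p bss)) + size r + 1 <= size (enc bss).
  by move/(congr1 size): eb; rewrite !size_cat /= size_map size_cat /=; lia.
move: ki3; rewrite ea => ki3.
apply: mt_weaken (mt_inner (b := false) (a' := a) (m := MStay) ki3 _ _) _ _ => //=.
- by rewrite (negbTE na).
move=> _ d4 [-> f4]; rewrite -ea eb => ki4.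
have ko4 := frame_known f4 (oi : ~~ pred1 i o) ko3.
apply: mt_seq; apply: mt_weaken (mt_copy (acc := [::]) io _ ki4 ko4 _ _) _ _ => //; try lia.
  by rewrite /=; lia.
rewrite /= add0n => _ d5 [f5 ki5 ko5]; apply: mt_seq.
have ko5' : known d5 o (size (map sbit r)).+1 (map sbit r) by rewrite size_map.
apply: mt_weaken (mt_extend sblank (m := MLeft) ko5' _) _ _ => //=.
  by rewrite size_map; lia.
rewrite -cats1 => _ d6 [f6 ko6]; have ki6 := frame_known f6 (io : ~~ pred1 o i) ki5.
apply: mt_weaken (mt_goleft id (blank_bits _) ko6 _) _ _ => //; rewrite ?size_map //.
  by lia.
rewrite map_id => _ d7 [f7 ko7]; have ki7 := frame_known f7 (io : ~~ pred1 o i) ki6.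
split=> //.
- apply: frame2_trans F3 (frame2_trans (frame12l _ f4) (frame2_trans f5 _)).
  exact: frame12r (frame1_trans f6 f7).
- rewrite /list_tape eb (take_nth [::]) // enc_rcons !size_cat -/r size_map /=.
  by rewrite addn1 addnS.
Qed.

Lemma mt_emit i o d bss bs : i != o -> list_tape d i (size bss) bss -> reg_tape d o bs ->
  (size (enc bss) + size bs).+3 <= Bd i -> (size bs).+2 <= Bd o ->
  mt (emit_tape i o) d (5 * size bs + 10)
   (fun _ d' => [/\ frame (pred2 i o) d d', reg_tape d' o bs
      & list_tape d' i (size bss).+1 (rcons bss bs)]).
Proof.
move=> io ki ko lei leo; have oi : o != i by rewrite eq_sym.
apply: (@mt_weaken _ _ (1 + (1 + ((3 * size bs).+1 + (1 + (1 + (1 + (size bs).*2.+1)))))) _ _ _ _ _ (fun _ _ h => h)); last by lia.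
apply: mt_seq; apply: mt_weaken (mt_origin (b := true) (m := MRight) ko _ _) _ _ => //.
  by rewrite /=; lia.
move=> _ d1 [_ f1 ko1]; have ki1 := frame_known f1 (io : ~~ pred1 o i) ki.
rewrite take_size in ki1; apply: mt_seq.
apply: mt_weaken (mt_mv (m := MRight) (known_prefix ki1) _) _ _ => //=; first by lia.
move=> _ d2 [f2 ki2].
have ko2 := frame_known f2 (oi : ~~ pred1 i o) ko1.
apply: mt_seq.
apply: mt_weaken (mt_copy (i := o) (o := i) (l1 := [::]) (acc := enc bss) oi _ ko2 ki2 _ _) _ _
  => //; try (rewrite /=; lia).
rewrite /= add0n => _ d3 [f3 ko3 ki3]; apply: mt_seq.
have ki3' : known d3 i (size (enc bss ++ map sbit bs)).+1 (enc bss ++ map sbit bs).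
  by rewrite size_cat size_map.
apply: mt_weaken (mt_extend ssep (m := MRight) ki3' _) _ _ => //=.
  by rewrite size_cat size_map; lia.
move=> _ d4 [f4 ki4]; have ko4 := frame_known f4 (oi : ~~ pred1 i o) ko3.
apply: mt_seq; move: ki4; rewrite -[(size _).+2]/((size _).+1.+1) -(size_rcons _ ssep) => ki4.
apply: mt_weaken (mt_extend sblank (m := MLeft) ki4 _) _ _ => //=.
  by rewrite size_rcons size_cat size_map; lia.
move=> _ d5 [f5 ki5]; have ko5 := frame_known f5 (oi : ~~ pred1 i o) ko4.
apply: mt_seq; have ko5' : known d5 o (size (map sbit bs)).+1 (map sbit bs ++ sblank :: [::]).
  by rewrite size_map.
apply: mt_weaken (mt_inner (b := true) (a' := sblank) (m := MLeft) ko5' _ _) _ _ => //=.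
  by rewrite size_map; lia.
move=> _ d6 [_ f6 ko6]; have ki6 := frame_known f6 (io : ~~ pred1 o i) ki5.
apply: mt_weaken (mt_goleft id (blank_bits _) ko6 _) _ _ => //; rewrite ?size_map //.
  by lia.
rewrite map_id => _ d7 [f7 ko7]; have ki7 := frame_known f7 (io : ~~ pred1 o i) ki6.
split=> //.
- apply: frame2_trans (frame2_trans (frame12r _ f1) (frame12l _ f2)) _.
  apply: frame2_trans (frame_sub f3 _) _; first by move=> j /=; rewrite orbC.
  apply: frame2_trans (frame12l _ (frame1_trans f4 f5)) (frame12r _ (frame1_trans f6 f7)).
- rewrite /list_tape take_oversize ?size_rcons // enc_rcons.
  by move: ki7; rewrite -!cats1 -!catA !size_cat /= addn1.
Qed.

End Tapes.

(** * Abstract states and weakest preconditions *)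

Record st := St { rg : nat -> nat; ls : nat -> seq nat; ps : nat -> nat; ip : nat }.

Definition setr s r v := St (fun x => if x == r then v else rg s x) (ls s) (ps s) (ip s).
Definition setl s q es p := St (rg s) (fun x => if x == q then es else ls s x)
  (fun x => if x == q then p else ps s x) (ip s).
Definition seti s p := St (rg s) (ls s) (ps s) p.

Definition Inc r := inc_tape r.*2.
Definition TestDec r := testdec_tape r.*2.
Definition Wipe r := wipe_tape r.*2.
Definition LoadNext q r := load_tape q.*2.+1 r.*2.
Definition Emit q r := emit_tape q.*2.+1 r.*2.
Definition Rewind q := rewind_tape q.*2.+1.
Definition Reset q := reset_tape q.*2.+1.
Definition Loop r c := Wh (TestDec r) c.
Definition IRight := In (fun _ => (true, MRight)).
Definition IStay := In (fun _ => (true, MStay)).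
Definition IHome :=
  Wh (In (fun x => if x is LeftEnd then (false, MStay) else (true, MLeft))) IStay.
Definition ITest a :=
  In (fun x => (if x is Sym b then b == a else false, MStay)).
Definition ILen r :=
  Wh (In (fun x => if x is RightEnd then (false, MStay) else (true, MRight))) (Inc r).

(** Register [r] lives on tape [2 r] and list [q] on tape [2 q + 1]; time is counted
    in units of [U] steps, the cost of one primitive operation. *)
Section Abstract.
Variables (w : seq letter) (V Mx : nat).

Definition Lb := (trunc_log 2 V).+1.
(** A register has at most [Lb] bits, a list at most [Mx] entries of [Lb] bits and a separator. The
    slack is for the closing blank and for a head that moves past it. *)
Definition Bd (i : nat) := if odd i then Mx * Lb.+1 + 3 else Lb.+2.
Definition U := 10 * (Mx * Lb.+1 + Lb + size w + 10).
Local Notation mt := (mt w Bd).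

(** Numbers determine their bits only up to leading zeros, hence the existential bit strings. *)
Definition rep (s : st) (d : data) :=
  [/\ ih d = ip s, ip s <= (size w).+1,
      forall r, exists bs, [/\ bval bs = rg s r, size bs <= Lb & reg_tape d r.*2 bs]
    & forall q, exists bss, [/\ map bval bss = ls s q,
        all (fun bs => size bs <= Lb) bss, size bss <= Mx, ps s q <= size bss
        & list_tape d q.*2.+1 (ps s q) bss]].

Definition wp (c : mcmd) (n : nat) (Q : bool -> st -> Prop) (s : st) :=
  forall d, rep s d -> mt c d (n * U) (fun b d' => exists s', rep s' d' /\ Q b s').

Lemma wp_weaken c n n' (Q Q' : bool -> st -> Prop) s : wp c n Q s -> n <= n' ->
  (forall b s', Q b s' -> Q' b s') -> wp c n' Q' s.
Proof.
move=> h le H d /h m; apply: mt_weaken m _ _; first by rewrite leq_mul2r le orbT.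
by move=> b d' [s' [r /H q]]; exists s'.
Qed.

Lemma wp_ite c c1 c2 n n' Q s :
  wp c n (fun b => wp (if b then c1 else c2) n' Q) s -> wp (Ite c c1 c2) (n + n') Q s.
Proof.
move=> h d /h m; rewrite mulnDl; apply: mt_ite; apply: mt_weaken m _ _ => // b d' [s' [r q]].
exact: q.
Qed.

Lemma wp_seq c1 c2 n n' Q s :
  wp c1 n (fun _ => wp c2 n' Q) s -> wp (Seq c1 c2) (n + n') Q s.
Proof. by move=> h; apply: wp_ite; apply: wp_weaken h _ _ => // -[]. Qed.

Lemma wp_whT c c' n n1 n2 Q s :
  wp c n (fun b s1 => b = true /\ wp c' n1 (fun _ => wp (Wh c c') n2 Q) s1) s ->
  wp (Wh c c') (n + (n1 + n2)) Q s.
Proof.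
move=> h d /h m; rewrite !mulnDl; apply: mt_whT; apply: mt_weaken m _ _ => //.
move=> b d1 [s1 [r [-> q]]]; split=> //; apply: mt_weaken (q _ r) _ _ => //.
by move=> _ d2 [s2 [r2 q2]]; exact: q2.
Qed.

Lemma wp_whF c c' n Q s :
  wp c n (fun b s1 => b = false /\ Q false s1) s -> wp (Wh c c') n Q s.
Proof.
move=> h d /h m; apply: mt_whF m _ => b d' [s' [r [-> q]]]; split=> //.
by exists s'.
Qed.

Lemma rep_reg s d d' r bs : rep s d -> frame (pred1 r.*2) d d' ->
  reg_tape d' r.*2 bs -> size bs <= Lb -> rep (setr s r (bval bs)) d'.
Proof.
move=> [e1 e2 hr hl] [fi fr] kn sz; split=> //=; first by rewrite fi.
- move=> r'; case: eqP => [->|ne]; first by exists bs.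
  have [bs' [a b c]] := hr r'; exists bs'; split=> //.
  apply: (@frame_known (pred1 r.*2) d) => //=.
  by apply/eqP => /double_inj.
- move=> q; have [bss [a b c e f]] := hl q; exists bss; split=> //.
  apply: (@frame_known (pred1 r.*2) d) => //=.
  by apply/eqP; lia.
Qed.

Lemma rep_list s d d' q bss p : rep s d -> frame (pred1 q.*2.+1) d d' ->
  list_tape d' q.*2.+1 p bss -> all (fun bs => size bs <= Lb) bss ->
  size bss <= Mx -> p <= size bss -> rep (setl s q (map bval bss) p) d'.
Proof.
move=> [e1 e2 hr hl] [fi fr] kn sz sb lp; split=> //=; first by rewrite fi.
- move=> r'; have [bs' [a b c]] := hr r'; exists bs'; split=> //.
  apply: (@frame_known (pred1 q.*2.+1) d) => //=.
  by apply/eqP; lia.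
- move=> q'; case: eqP => [->|ne]; first by exists bss.
  have [bss' [a b c e f]] := hl q'; exists bss'; split=> //.
  apply: (@frame_known (pred1 q.*2.+1) d) => //=.
  by apply/eqP; lia.
Qed.

Lemma rep_reg_list s d d' r bs q bss p : rep s d ->
  frame (pred2 q.*2.+1 r.*2) d d' ->
  reg_tape d' r.*2 bs -> size bs <= Lb ->
  list_tape d' q.*2.+1 p bss -> all (fun bs => size bs <= Lb) bss ->
  size bss <= Mx -> p <= size bss ->
  rep (setr (setl s q (map bval bss) p) r (bval bs)) d'.
Proof.
move=> [e1 e2 hr hl] [fi fr] kr sr kn sz sb lp; split=> //=; first by rewrite fi.
- move=> r'; case: eqP => [->|ne]; first by exists bs.
  have [bs' [a b c]] := hr r'; exists bs'; split=> //.
  apply: (@frame_known (pred2 q.*2.+1 r.*2) d) => //=.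
  by apply/norP; split; apply/eqP; lia.
- move=> q'; case: eqP => [->|ne]; first by exists bss.
  have [bss' [a b c e f]] := hl q'; exists bss'; split=> //.
  apply: (@frame_known (pred2 q.*2.+1 r.*2) d) => //=.
  by apply/norP; split; apply/eqP; lia.
Qed.

Lemma Bd_even r : Bd r.*2 = Lb.+2. Proof. by rewrite /Bd odd_double. Qed.
Lemma Bd_odd q : Bd q.*2.+1 = Mx * Lb.+1 + 3. Proof. by rewrite /Bd /= odd_double. Qed.

Lemma size_enc bss : all (fun bs => size bs <= Lb) bss ->
  size (enc bss) <= size bss * Lb.+1.
Proof.
elim: bss => //= bs bss IH /andP[h /IH]; rewrite /enc /= size_cat size_rcons size_map.
by rewrite -/(enc bss); lia.
Qed.

Lemma size_enc_max bss : all (fun bs => size bs <= Lb) bss -> size bss <= Mx ->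
  size (enc bss) <= Mx * Lb.+1.
Proof. by move=> /size_enc h1 h2; apply: leq_trans h1 _; rewrite leq_mul2r h2 orbT. Qed.

Lemma wp_inc r Q s : rg s r < V -> (forall b, Q b (setr s r (rg s r).+1)) ->
  wp (Inc r) 1 Q s.
Proof.
move=> lt q d rs; case: (rs) => _ _ /(_ r)[bs [e sz kn]] _.
apply: mt_weaken (mt_inc w kn _) _ _; first by rewrite Bd_even; lia.
  by rewrite mul1n /U; lia.
move=> b d' [f [bs' [e' kn' sz']]]; exists (setr s r (rg s r).+1); split=> //.
rewrite -e -e'; apply: rep_reg rs f kn' _.
apply: leq_trans sz' _; rewrite geq_max sz /=.
by rewrite /Lb ltnS leq_trunc_log // e.
Qed.

Lemma wp_testdec0 r (Q : bool -> st -> Prop) s : rg s r = 0 -> Q false s ->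
  wp (TestDec r) 1 Q s.
Proof.
move=> lt q d rs; case: (rs) => _ _ /(_ r)[bs [e sz kn]] _.
apply: mt_weaken (mt_testdec w kn _) _ _; first by rewrite Bd_even; lia.
  by rewrite mul1n /U; lia.
move=> b d' [-> f [bs' [e' kn' sz']]]; rewrite e lt /=; exists s; split=> //.
have [f1 f2 f3 f4] : rep (setr s r (bval bs')) d' by apply: rep_reg rs f kn' _; rewrite sz'.
split=> // r'; have [bs2 [x y z]] := f3 r'; exists bs2; split=> //; rewrite x /=.
by case: eqP => // ->; rewrite e' e lt.
Qed.

Lemma wp_testdecS r (Q : bool -> st -> Prop) s j : rg s r = j.+1 ->
  Q true (setr s r j) -> wp (TestDec r) 1 Q s.
Proof.
move=> lt q d rs; case: (rs) => _ _ /(_ r)[bs [e sz kn]] _.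
apply: mt_weaken (mt_testdec w kn _) _ _; first by rewrite Bd_even; lia.
  by rewrite mul1n /U; lia.
move=> b d' [-> f [bs' [e' kn' sz']]]; rewrite e lt /=; exists (setr s r j); split=> //.
rewrite -[j]/j.+1.-1 -lt -e -e'; apply: rep_reg rs f kn' _; rewrite sz' //.
Qed.

Lemma wp_dec r (Q : bool -> st -> Prop) s :
  (forall b, Q b (setr s r (rg s r).-1)) -> wp (TestDec r) 1 Q s.
Proof.
move=> q d rs; case: (rs) => _ _ /(_ r)[bs [e sz kn]] _.
apply: mt_weaken (mt_testdec w kn _) _ _; first by rewrite Bd_even; lia.
  by rewrite mul1n /U; lia.
move=> b d' [_ f [bs' [e' kn' sz']]]; exists (setr s r (rg s r).-1); split=> //.
by rewrite -e -e'; apply: rep_reg rs f kn' _; rewrite sz'.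
Qed.

Lemma wp_wipe r (Q : bool -> st -> Prop) s :
  (forall b, Q b (setr s r 0)) -> wp (Wipe r) 1 Q s.
Proof.
move=> q d rs; case: (rs) => _ _ /(_ r)[bs [e sz kn]] _.
apply: mt_weaken (mt_wipe w kn _ _) _ _; rewrite ?size_cat ?addn1 ?Bd_even //.
  by rewrite mul1n /U; lia.
move=> b d' [f kn']; exists (setr s r 0); split=> //.
exact: (rep_reg (bs := [::]) rs f kn').
Qed.

Lemma wp_rewind q (Q : bool -> st -> Prop) s :
  (forall b, Q b (setl s q (ls s q) 0)) -> wp (Rewind q) 1 Q s.
Proof.
move=> h d rs; case: (rs) => _ _ _ /(_ q)[bss [e sz sb lp kn]].
have := size_enc_max sz sb => le.
apply: mt_weaken (mt_rewind w kn _) _ _; first by rewrite Bd_odd; lia.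
  by rewrite mul1n /U; lia.
move=> b d' [f kn']; exists (setl s q (ls s q) 0); split=> //.
by rewrite -e; apply: rep_list rs f kn' _ _ _.
Qed.

Lemma wp_reset q (Q : bool -> st -> Prop) s :
  (forall b, Q b (setl s q [::] 0)) -> wp (Reset q) 1 Q s.
Proof.
move=> h d rs; case: (rs) => _ _ _ /(_ q)[bss [e sz sb lp kn]].
have := size_enc_max sz sb => le.
apply: mt_weaken (mt_reset w kn _) _ _; first by rewrite Bd_odd; lia.
  by rewrite mul1n /U; lia.
move=> b d' [f kn']; exists (setl s q [::] 0); split=> //.
exact: (rep_list (bss := [::]) rs f kn').
Qed.

Lemma wp_load q r (Q : bool -> st -> Prop) s :
  (forall b, Q b (setr (setl s q (ls s q)
     (if ps s q < size (ls s q) then (ps s q).+1 else ps s q)) r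
     (nth 0 (ls s q) (ps s q)))) -> wp (LoadNext q r) 1 Q s.
Proof.
move=> h d rs; case: (rs) => _ _ /(_ r)[bs [er sr kr]] /(_ q)[bss [e sz sb lp kn]].
have := size_enc_max sz sb => le.
have sn : size (nth [::] bss (ps s q)) <= Lb.
  case: (ltnP (ps s q) (size bss)) => hp; last by rewrite nth_default.
  by move/allP: sz; apply; rewrite mem_nth.
apply: mt_weaken (mt_load w _ kn kr lp _ _) _ _; rewrite ?Bd_odd ?Bd_even ?mul1n /U; try lia.
move=> b d' [f kr' kn'].
set s' := (setr _ _ _) in h; exists s'; split; last exact: h.
have en : nth 0 (ls s q) (ps s q) = bval (nth [::] bss (ps s q)).
  rewrite -e; case: (ltnP (ps s q) (size bss)) => hp; first by rewrite (nth_map [::]).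
  by rewrite !nth_default ?size_map.
have ez : size (ls s q) = size bss by rewrite -e size_map.
rewrite /s' ez en -e; apply: rep_reg_list rs f kr' _ kn' _ _ _ => //.
by case: ifP.
Qed.

Lemma wp_emit q r (Q : bool -> st -> Prop) s : ps s q = size (ls s q) ->
  size (ls s q) < Mx ->
  (forall b, Q b (setl s q (rcons (ls s q) (rg s r)) (ps s q).+1)) ->
  wp (Emit q r) 1 Q s.
Proof.
move=> ep lm h d rs; case: (rs) => _ _ /(_ r)[bs [er sr kr]] /(_ q)[bss [e sz sb lp kn]].
have ez : size (ls s q) = size bss by rewrite -e size_map.
rewrite ep ez in kn; rewrite ez in lm.
have le : size (enc bss) + Lb.+1 <= Mx * Lb.+1.
  have := size_enc sz; nia.
apply: mt_weaken (mt_emit w _ kn kr _ _) _ _; rewrite ?Bd_odd ?Bd_even ?mul1n /U; try lia.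
move=> b d' [f kr' kn'].
exists (setl s q (rcons (ls s q) (rg s r)) (ps s q).+1); split; last exact: h.
have [f1 f2 f3 f4] : rep (setr (setl s q (map bval (rcons bss bs)) (size bss).+1) r (bval bs)) d'.
  apply: (rep_reg_list rs f kr' sr kn'); rewrite ?size_rcons //.
  by rewrite all_rcons sr.
split=> //.
- move=> r'; have [bs2 [x y z]] := f3 r'; exists bs2; split=> //; rewrite x /=.
  by case: eqP => // ->.
- move=> q'; have [bss2 [x y z x2 y2]] := f4 q'; exists bss2; move: x x2 y2 => /=.
  by rewrite map_rcons e er ep ez.
Qed.

Lemma rep_imove s d m : rep s d ->
  rep (seti s (minn (shift m (ip s)) (size w).+1)) (imove w d m).
Proof.
move=> [e1 e2 hr hl]; split=> //=; first by rewrite e1.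
by rewrite geq_minr.
Qed.

Lemma U_gt0 : 0 < U. Proof. by rewrite /U; lia. Qed.

Lemma wp_in f (Q : bool -> st -> Prop) s b m : f (read_input w (ip s)) = (b, m) ->
  Q b (seti s (minn (shift m (ip s)) (size w).+1)) -> wp (In f) 1 Q s.
Proof.
move=> e q d rs; exists 1, b, (imove w d m); split.
- by apply: XIn; case: rs => ->.
- by rewrite mul1n U_gt0.
- by exists (seti s (minn (shift m (ip s)) (size w).+1)); split=> //; exact: rep_imove.
Qed.

Lemma mt_home j d : ih d = j -> j <= (size w).+1 -> mt IHome d (j.*2.+1) (fun _ d' =>
  ih d' = 0 /\ wh d' = wh d /\ cl d' = cl d).
Proof.
elim: j d => [|j IH] d e le.
  exists 1, false, (imove w d MStay); split=> //.
    by apply: XWhF; apply: XIn; rewrite e.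
  by rewrite /= e.
have e2 : ih (imove w (imove w d MLeft) MStay) = j.
  by rewrite /= e /= !(minn_idPl _) //; apply: ltnW.
have lj : j <= (size w).+1 by lia.
have [t [b [d' [x y z]]]] := IH _ e2 lj.
exists (1 + (1 + t)), b, d'; split; [|by rewrite doubleS; lia|exact: z].
apply: XWhT x; last by apply: XIn.
apply: XIn; rewrite e /=; case: onth => //.
Qed.

Lemma wp_home (Q : bool -> st -> Prop) s : (forall b, Q b (seti s 0)) -> wp IHome 1 Q s.
Proof.
move=> q d [e1 e2 hr hl]; apply: mt_weaken (mt_home e1 e2) _ _.
  by rewrite mul1n /U; lia.
move=> b d' [a1 [a2 a3]]; exists (seti s 0); split=> //; split=> //= x.
- have [bs [y1 y2 y3]] := hr x; exists bs; split=> //.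
  by move: y3; rewrite /reg_tape /known a2 a3.
- have [bs [y1 y2 y3 y4 y5]] := hl x; exists bs; split=> //.
  by move: y5; rewrite /list_tape /known a2 a3.
Qed.

(** The test has already lowered the counter when the body starts, and the invariant, indexed by the
    number of remaining rounds, forces the body to leave it at that value. *)
Lemma wp_loop (I : nat -> st -> Prop) r c n m s :
  (forall j s, I j s -> rg s r = j) ->
  (forall j s, j < m -> I j.+1 s -> wp c n (fun _ s' => I j s') (setr s r j)) ->
  I m s -> wp (Loop r c) (m * n.+1).+1 (fun _ s' => I 0 s') s.
Proof.
move=> Ir; elim: m s => [|m IH] s H Im.
  apply: wp_whF; rewrite mul0n; apply: wp_testdec0; first exact: Ir.
  by split.
apply: (@wp_weaken _ (1 + (n + (m * n.+1).+1)) _ _ _ _ _ _ (fun _ _ h => h)); last by lia.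
apply: wp_whT; apply: wp_testdecS (Ir _ _ Im) _.
split=> //; apply: wp_weaken (H m s _ Im) _ _ => // _ s' Is'.
by apply: IH => // j s2 lt; apply: H; lia.
Qed.

Definition same_rest s s' :=
  [/\ forall q, ls s' q = ls s q, forall q, ps s' q = ps s q & ip s' = ip s].

Lemma wp_addto r k (Q : bool -> st -> Prop) s : r != k -> rg s k + rg s r <= V ->
  (forall b s', same_rest s s' -> (forall x, rg s' x =
     if x == k then rg s k + rg s r else if x == r then 0 else rg s x) -> Q b s') ->
  wp (Loop r (Inc k)) (V * 2).+1 Q s.
Proof.
move=> rk le q.
apply: wp_weaken (wp_loop (m := rg s r) (n := 1) (I := fun j s' => same_rest s s' /\
  (forall x, rg s' x = if x == k then rg s k + (rg s r - j) else if x == r then j else rg s x)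
  /\ j <= rg s r) _ _ _) _ _.
- by move=> j s' [_ [-> _]]; rewrite (negbTE rk) eqxx.
- move=> j s' lj [[h1 h2 h3] [h4 h5]]; apply: wp_inc => /=.
    by rewrite eq_sym (negbTE rk) h4 eqxx; lia.
  move=> _; split; first by split.
  split; last by lia.
  move=> x; rewrite /= !h4 eqxx.
  case: (eqVneq x k) => [_|xk]; rewrite ?(eq_sym k r) ?(negbTE rk); first by lia.
  by case: eqP.
- split; first by split.
  split=> // x; rewrite subnn addn0; case: eqP => [->|_] //.
  by case: eqP => [->|].
- by lia.
- by move=> b s' [h1 [h2 _]]; apply: q => // x; rewrite h2 subn0.
Qed.

Lemma wp_subto r k (Q : bool -> st -> Prop) s : r != k -> rg s r <= V ->
  (forall b s', same_rest s s' -> (forall x, rg s' x =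
     if x == k then rg s k - rg s r else if x == r then 0 else rg s x) -> Q b s') ->
  wp (Loop r (TestDec k)) (V * 2).+1 Q s.
Proof.
move=> rk le q.
apply: wp_weaken (wp_loop (m := rg s r) (n := 1) (I := fun j s' => same_rest s s' /\
  (forall x, rg s' x = if x == k then rg s k - (rg s r - j) else if x == r then j else rg s x)
  /\ j <= rg s r) _ _ _) _ _.
- by move=> j s' [_ [-> _]]; rewrite (negbTE rk) eqxx.
- move=> j s' lj [[h1 h2 h3] [h4 h5]]; apply: wp_dec => /= _; split; first by split.
  split; last by lia.
  move=> x; rewrite /= !h4 eqxx.
  case: (eqVneq x k) => [_|xk]; rewrite ?(eq_sym k r) ?(negbTE rk); first by lia.
  by case: eqP.
- split; first by split.
  split=> // x; rewrite subnn subn0; case: eqP => [->|_] //.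
  by case: eqP => [->|].
- by lia.
- by move=> b s' [h1 [h2 _]]; apply: q => // x; rewrite h2 subn0.
Qed.

(** Loops consume the counter that they read, so [r] is moved into two copies, one of which is then
    moved back. *)
Definition Dup r k :=
  Seq (Wipe k) (Seq (Wipe k.+1) (Seq (Loop r (Seq (Inc k) (Inc k.+1))) (Loop k.+1 (Inc r)))).

Lemma wp_dup r k (Q : bool -> st -> Prop) s : r < k -> rg s r <= V ->
  (forall b s', same_rest s s' -> (forall x, rg s' x =
     if x == k then rg s r else if x == k.+1 then 0 else rg s x) -> Q b s') ->
  wp (Dup r k) (5 * V + 4) Q s.
Proof.
move=> rk le q.
have e0 : (r == k) = false by apply/eqP; lia.
have e1 : (r == k.+1) = false by apply/eqP; lia.
have e2 : (k == k.+1) = false by apply/eqP; lia.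
have E := (e0, e1, e2, eq_sym k r, eq_sym k.+1 r, eq_sym k.+1 k, eqxx).
apply: (@wp_weaken _ (1 + (1 + ((V * 3).+1 + (V * 2).+1))) _ _ _ _ _ _ (fun _ _ h => h));
  last by lia.
apply: wp_seq; apply: wp_wipe => _; apply: wp_seq; apply: wp_wipe => _; apply: wp_seq.
apply: wp_weaken (wp_loop (m := rg s r) (n := 1 + 1) (I := fun j s' => same_rest s s' /\
  (forall x, rg s' x = if x == k then rg s r - j else if x == k.+1 then rg s r - j
     else if x == r then j else rg s x)
  /\ j <= rg s r) _ _ _) _ _.
- by move=> j s' [_ [-> _]]; rewrite !E.
- move=> j s' lj [[h1 h2 h3] [h4 h5]]; apply: wp_seq; apply: wp_inc => /=.
    by rewrite !h4 !E; lia.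
  move=> _; apply: wp_inc => /=.
    by rewrite !h4 !E; lia.
  move=> _; split; first by split.
  split; last by lia.
  move=> x; rewrite /= !h4 !E.
  case: (eqVneq x k.+1) => [->|xk]; first by rewrite !E; lia.
  case: (eqVneq x k) => [_|xk']; first by lia.
  by case: eqP.
- split; first by split.
  split=> // x; rewrite subnn /=; case: eqP => [->|_]; first by case: eqP.
  by case: eqP => // _; case: eqP => [->|].
- by lia.
move=> _ s1 [[h1 h2 h3] [h4 _]]; apply: wp_addto.
- by rewrite !E.
- by rewrite !h4 !E; lia.
move=> b s2 [g1 g2 g3] g4; apply: q.
  by split=> [x|x|]; rewrite ?g1 ?g2 ?g3 ?h1 ?h2 ?h3.
move=> x; rewrite g4 !h4 !E subn0.
case: (eqVneq x r) => [->|xr]; first by rewrite !E.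
case: (eqVneq x k.+1) => [->|xk]; first by rewrite !E.
by [].
Qed.

(** The head travels from the left marker to the right one, hence one move more than there are
    letters. *)
Lemma wp_ilen r (Q : bool -> st -> Prop) s : (size w).+1 <= V ->
  rg s r = 0 -> ip s = 0 ->
  (forall b s', rg s' r = (size w).+1 -> (forall x, x != r -> rg s' x = rg s x) ->
   (forall x, ls s' x = ls s x) -> (forall x, ps s' x = ps s x) -> Q b s') ->
  wp (ILen r) (V * 2).+1 Q s.
Proof.
move=> le e0 i0 q.
have H : forall j s', j <= (size w).+1 -> ip s' = (size w).+1 - j ->
   rg s' r = (size w).+1 - j -> (forall x, x != r -> rg s' x = rg s x) ->
   (forall x, ls s' x = ls s x) -> (forall x, ps s' x = ps s x) ->
   wp (ILen r) (j * 2).+1 Q s'.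
  elim=> [|j IH] s' lj is' rs' ro lo po.
    apply: wp_whF; rewrite mul0n; apply: (@wp_in _ _ _ false MStay).
      by rewrite is' subn0 /= onth_default.
    by split=> //; apply: q => //=; rewrite rs' subn0.
  apply: (@wp_weaken _ (1 + (1 + (j * 2).+1)) _ _ _ _ _ _ (fun _ _ h => h)); last by lia.
  apply: wp_whT; apply: (@wp_in _ _ _ true MRight).
    rewrite is'; have -> : (size w).+1 - j.+1 = size w - j by lia.
    case e: (size w - j) => [|p] //=.
    have : p < size w by lia.
    by rewrite -onthTE; case: onth.
  split=> //; apply: wp_inc => /=; first by rewrite rs'; lia.
  move=> _; apply: IH => //=.
  - exact: ltnW.
  - by rewrite is' -subSn // subSS; apply/minn_idPl/leq_subr.
  - by rewrite eqxx rs' -subSn // subSS.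
  - by move=> x nx; rewrite (negbTE nx) ro.
by apply: wp_weaken (H (size w).+1 s _ _ _ _ _ _) _ _ => //; rewrite ?subnn //; lia.
Qed.

End Abstract.

(** * A bounded arithmetic expression language *)

(** Variables are de Bruijn levels. Level 0 holds the size of all tables, which is
    also the number of rounds of [Iter]. *)
Inductive expr :=
| Var of nat
| Cst of nat
| Add of expr & expr
| Sub of expr & expr
| Sum of expr & expr
| Inp of letter & expr
| Len
| Get of nat & expr
| Iter of expr & expr.

Section Eval.
Variable w : seq letter.

Fixpoint ev (env : seq nat) (tabs : seq (seq nat)) (e : expr) : nat :=
  match e with
  | Var l => nth 0 env l
  | Cst c => c
  | Add a b => ev env tabs a + ev env tabs b
  | Sub a b => ev env tabs a - ev env tabs b
  | Sum a b => \sum_(0 <= i < ev env tabs a) ev (rcons env i) tabs b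
  | Inp x a => onth w (ev env tabs a) == Some x
  | Len => (size w).+1
  | Get t a => nth 0 (nth [::] tabs t) (ev env tabs a)
  | Iter a b =>
      let M := nth 0 env 0 in
      let T := iter M (fun T => mkseq (fun i =>
        minn (ev (rcons env i) (rcons tabs T) a) M) M) (nseq M 0) in
      ev env (rcons tabs T) b
  end.

End Eval.

(** If variables, tables and the input length are bounded by powers of [X], then
    all intermediate values are at most [X ^ dg]. Table entries are truncated in
    [Iter] because their degree would otherwise depend on itself. *)
Fixpoint dg (ds : seq nat) (e : expr) : nat :=
  match e with
  | Var l => nth 0 ds l
  | Cst c => c
  | Add a b => (dg ds a + dg ds b).+1
  | Sub a b => dg ds a + dg ds b
  | Sum a b => dg ds a + dg (rcons ds (dg ds a)) b
  | Inp _ a => dg ds a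
  | Len => 1
  | Get _ a => (dg ds a).+1
  | Iter a b => (dg (rcons ds 1) a + dg ds b).+1
  end.

(** * Compilation of expressions *)

Definition comp_var (rho : seq nat) k l :=
  if l < size rho then Dup (nth 0 rho l) k else Wipe k.

(** The result goes to register [k], registers from [k] on are free, and [rho] locates the variables
    below [k]. Table j is list 2 j; list 2 j + 1 collects the next table while the current one is
    still being read. The truncation min(v, M) is computed as v - (v - M), for which the entry is
    evaluated twice. *)
Fixpoint comp (rho : seq nat) (t k : nat) (e : expr) : mcmd :=
  match e with
  | Var l => comp_var rho k l
  | Cst c => Seq (Wipe k) (iter c (Seq (Inc k)) (Wipe k.+1))
  | Add a b => Seq (comp rho t k a) (Seq (comp rho t k.+1 b) (Loop k.+1 (Inc k)))
  | Sub a b => Seq (comp rho t k a) (Seq (comp rho t k.+1 b) (Loop k.+1 (TestDec k)))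
  | Sum a b => Seq (comp rho t k.+1 a) (Seq (Wipe k) (Seq (Wipe k.+2)
      (Loop k.+1 (Seq (comp (rcons rho k.+2) t k.+3 b)
                 (Seq (Loop k.+3 (Inc k)) (Inc k.+2))))))
  | Inp x a => Seq (comp rho t k.+1 a) (Seq IRight (Seq (Loop k.+1 IRight)
      (Seq (Wipe k) (Seq (Ite (ITest x) (Inc k) (Wipe k)) IHome))))
  | Len => Seq (Wipe k) (Seq (ILen k) IHome)
  | Get q a => if q < t then Seq (comp rho t k.+1 a) (Seq (Rewind q.*2)
      (Seq (Loop k.+1 (LoadNext q.*2 k)) (LoadNext q.*2 k))) else Wipe k
  | Iter a b =>
      let cur := t.*2 in let new := t.*2.+1 in
      Seq (Wipe k) (Seq (comp_var rho k.+1 0) (Seq (Reset cur)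
      (Seq (Loop k.+1 (Emit cur k)) (Seq (comp_var rho k 0)
      (Seq (Loop k
        (Seq (Reset new) (Seq (comp_var rho k.+1 0) (Seq (Wipe k.+2)
        (Seq (Loop k.+1
          (Seq (comp (rcons rho k.+2) t.+1 k.+3 a)
          (Seq (comp (rcons rho k.+2) t.+1 k.+4 a)
          (Seq (comp_var rho k.+4.+1 0)
          (Seq (Loop k.+4.+1 (TestDec k.+4)) (Seq (Loop k.+4 (TestDec k.+3))
          (Seq (Emit new k.+3) (Inc k.+2))))))))
        (Seq (Rewind new) (Seq (Reset cur) (Seq (comp_var rho k.+1 0)
           (Loop k.+1 (Seq (LoadNext new k.+2) (Emit cur k.+2)))))))))))
      (comp rho t.+1 k b))))))
  end.

Fixpoint cost (V : nat) (e : expr) : nat :=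
  match e with
  | Var _ => 5 * V + 4
  | Cst c => 1 + (c + 1)
  | Add a b | Sub a b => cost V a + (cost V b + (V * 2).+1)
  | Sum a b => cost V a + (1 + (1 + (V * (cost V b + ((V * 2).+1 + 1)).+1).+1))
  | Inp _ a => cost V a + (1 + ((V * 2).+1 + (1 + ((1 + 1) + 1))))
  | Len => 1 + ((V * 2).+1 + 1)
  | Get _ a => cost V a + (1 + ((V * 2).+1 + 1))
  | Iter a b => 1 + ((5 * V + 4) + (1 + ((V * 2).+1 + ((5 * V + 4) +
     ((V * (1 + ((5 * V + 4) + (1 +
        ((V * (cost V a + (cost V a + ((5 * V + 4) + ((V * 2).+1 + ((V * 2).+1 +
               (1 + 1)))))).+1).+1 +
        (1 + (1 + ((5 * V + 4) + (V * (1 + 1).+1).+1)))))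
      )).+1).+1 + cost V b)))))
  end.

Section Compile.
Variables (w : seq letter) (X V Mx : nat).
Hypotheses (X2 : 2 <= X) (Xw : (size w).+1 <= X).
Local Notation wp := (wp w V Mx).
Local Notation ev := (ev w).

Lemma X_gt0 : 0 < X. Proof. exact: leq_trans X2. Qed.
Lemma X_exp a b : a <= b -> X ^ a <= X ^ b.
Proof. by move=> h; rewrite leq_pexp2l // X_gt0. Qed.

(** Level 0 is bounded by [X] itself because it truncates the table entries, which have to stay
    below [X]. *)
Definition bounded (ds env : seq nat) (tabs : seq (seq nat)) :=
  [/\ size ds = size env, forall l, nth 0 env l <= X ^ nth 0 ds l,
      nth 0 env 0 <= X & forall t i, nth 0 (nth [::] tabs t) i <= X].

Lemma bounded_env ds env tabs i d : bounded ds env tabs -> i <= X ^ d ->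
  0 < size env -> bounded (rcons ds d) (rcons env i) tabs.
Proof.
move=> [h1 h2 h3 h4] le e0; split=> //.
- by rewrite !size_rcons h1.
- move=> l; rewrite !nth_rcons h1; case: ltnP => // _; case: eqP => // _.
- by rewrite nth_rcons e0.
Qed.

Lemma bounded_tab ds env tabs T : bounded ds env tabs ->
  (forall i, nth 0 T i <= X) -> bounded ds env (rcons tabs T).
Proof.
move=> [h1 h2 h3 h4] le; split=> // t i; rewrite nth_rcons; case: ltnP => // _.
by case: eqP => // _; rewrite nth_nil.
Qed.

Lemma sum_bound F a b c : (forall i, i < a -> F i <= b) -> a * b <= c ->
  \sum_(0 <= i < a) F i <= c.
Proof.
move=> h; apply: leq_trans.
have -> : a * b = \sum_(0 <= i < a) b by rewrite sum_nat_const_nat subn0.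
by rewrite !big_nat; apply: leq_sum => i /andP[_ /h].
Qed.

Definition tabstep env tabs a T := mkseq (fun i =>
  minn (ev (rcons env i) (rcons tabs T) a) (nth 0 env 0)) (nth 0 env 0).

Lemma tabstep_bound env tabs a r i : nth 0 env 0 <= X ->
  nth 0 (iter r (tabstep env tabs a) (nseq (nth 0 env 0) 0)) i <= X.
Proof.
move=> le; case: r => [|r] /=; first by rewrite nth_nseq; case: ifP.
case: (ltnP i (nth 0 env 0)) => hi; last by rewrite nth_default // size_mkseq.
by rewrite nth_mkseq // (leq_trans (geq_minr _ _)).
Qed.

Lemma size_tabstep env tabs a r :
  size (iter r (tabstep env tabs a) (nseq (nth 0 env 0) 0)) = nth 0 env 0.
Proof. by case: r => [|r] /=; rewrite ?size_nseq ?size_mkseq. Qed.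

Lemma ev_bound e ds env tabs : 0 < size env -> bounded ds env tabs ->
  ev env tabs e <= X ^ dg ds e.
Proof.
elim: e ds env tabs => [l|c|a IHa b IHb|a IHa b IHb|a IHa b IHb|x a IHa||t a IHa|a IHa b IHb]
  ds env tabs e0 bd /=.
- by case: bd.
- by apply: leq_trans (ltnW (ltn_expl c X2)) _.
- have ha := IHa _ _ _ e0 bd; have hb := IHb _ _ _ e0 bd; rewrite expnS expnD.
  have pa : 0 < X ^ dg ds a by rewrite expn_gt0 X_gt0.
  have pb : 0 < X ^ dg ds b by rewrite expn_gt0 X_gt0.
  apply: leq_trans (leq_add ha hb) _; move: pa pb; clear -X2.
  (* Both powers are positive, so their sum is at most twice their product; the factor 2 is paid by
     one more [X]. *)
  by move: (X ^ _) (X ^ _) => p q hp hq; apply: (@leq_trans (2 * (p * q))); nia.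
- apply: leq_trans (leq_subr _ _) _; apply: leq_trans (IHa _ _ _ e0 bd) _.
  by apply: X_exp; rewrite leq_addr.
- have ha := IHa _ _ _ e0 bd; apply: (@sum_bound _ _ (X ^ dg (rcons ds (dg ds a)) b)).
    move=> i hi; apply: IHb; first by rewrite size_rcons.
    by apply: bounded_env => //; apply: leq_trans ha; apply: ltnW.
  by rewrite expnD leq_mul2r ha orbT.
- by apply: leq_trans (leq_b1 _) _; rewrite expn_gt0 X_gt0.
- by rewrite expn1.
- case: bd => _ _ _ h; apply: leq_trans (h _ _) _.
  by rewrite -{1}(expn1 X) X_exp.
- apply: leq_trans (IHb ds _ _ e0 _) _; last by apply: X_exp; lia.
  apply: bounded_tab => // i; apply: (@tabstep_bound env tabs a); by case: bd.
Qed.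

Record ctx rho t k ds env tabs s : Prop := Ctx {
  ctx_size : size rho = size env;
  ctx_env0 : 0 < size env;
  ctx_tabs : size tabs = t;
  ctx_rho : forall l, l < size env -> nth 0 rho l < k;
  ctx_env : forall l, l < size env -> rg s (nth 0 rho l) = nth 0 env l;
  ctx_tab : forall j, j < t -> ls s j.*2 = nth [::] tabs j;
  ctx_ip : ip s = 0;
  ctx_bd : bounded ds env tabs;
  ctx_X : X <= V;
  ctx_M : nth 0 env 0 <= Mx }.

(** [Get] rewinds the even lists, so their positions change. An odd list is being appended to while
    the subexpressions run, so its position has to survive. *)
Record keeps t k (s s' : st) : Prop := Keeps {
  keeps_rg : forall r, r < k -> rg s' r = rg s r;
  keeps_ls : forall q, q < t.*2 -> ls s' q = ls s q;
  keeps_ps : forall q, q < t.*2 -> odd q -> ps s' q = ps s q;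
  keeps_ip : ip s' = 0 }.

Lemma keeps_trans t k s s' s'' : keeps t k s s' -> keeps t k s' s'' -> keeps t k s s''.
Proof.
move=> [a1 a2 a3 a4] [b1 b2 b3 b4]; split=> // [r h|q h|q h o]; by rewrite ?b1 ?b2 ?b3 ?a1 ?a2 ?a3.
Qed.

Lemma keeps_sub t t' k k' s s' : keeps t k s s' -> t' <= t -> k' <= k -> keeps t' k' s s'.
Proof.
move=> [a1 a2 a3 a4] ht hk; have ht2 : t'.*2 <= t.*2 by rewrite leq_double.
split=> // [r h|q h|q h o]; rewrite ?a1 ?a2 ?a3 //; [exact: leq_trans hk|exact: leq_trans ht2|exact: leq_trans ht2].
Qed.

Lemma ctx_keeps rho t k k' ds env tabs s s' : ctx rho t k ds env tabs s ->
  keeps t k s s' -> k <= k' -> ctx rho t k' ds env tabs s'.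
Proof.
move=> [c1 c2 c3 c4 c5 c6 c7 c8 c9 c10] [a1 a2 a3 a4] le; split=> //.
- by move=> l h; apply: leq_trans (c4 _ h) le.
- by move=> l h; rewrite a1 ?c5 // c4.
- by move=> j h; rewrite a2 ?c6 // ltn_double.
Qed.

Lemma keeps_refl t k s : ip s = 0 -> keeps t k s s.
Proof. by []. Qed.

Lemma keeps_same t k s s' : ip s = 0 -> same_rest s s' ->
  (forall r, r < k -> rg s' r = rg s r) -> keeps t k s s'.
Proof. by move=> e [h1 h2 h3] h; split=> //; rewrite h3. Qed.

Arguments keeps_same {t k s s'}.

Definition post t k v (s : st) (b : bool) (s' : st) := rg s' k = v /\ keeps t k s s'.

Lemma ctx_valid rho t k ds env tabs s l : ctx rho t k ds env tabs s ->
  X ^ nth 0 ds l <= V -> nth 0 env l <= V.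
Proof. by move=> c h; case: (ctx_bd c) => _ h2 _ _; apply: leq_trans (h2 _) h. Qed.

Lemma comp_var_ok rho t k ds env tabs s k' l (Q : bool -> st -> Prop) :
  ctx rho t k ds env tabs s -> k <= k' -> nth 0 env l <= V ->
  (forall b s', same_rest s s' -> rg s' k' = nth 0 env l ->
     (forall r, r < k' -> rg s' r = rg s r) -> Q b s') ->
  wp (comp_var rho k' l) (5 * V + 4) Q s.
Proof.
move=> c le hl q; rewrite /comp_var (ctx_size c); case: ltnP => h.
  apply: wp_dup.
  - exact: leq_trans (ctx_rho c h) le.
  - by rewrite (ctx_env c h).
  move=> b s' sr h'; apply: q => //; first by rewrite h' eqxx (ctx_env c h).
  move=> r hr; rewrite h'; case: eqP => [e|_]; first by lia.
  by case: eqP => [e|//]; lia.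
apply: (@wp_weaken _ _ _ _ 1 _ _ _ _ _ _ (fun _ _ h => h)); last by lia.
apply: wp_wipe => b; apply: q => //; first by rewrite /= eqxx nth_default.
by move=> r hr /=; case: eqP => // e; lia.
Qed.

Lemma keeps_setr t k s r v : ip s = 0 -> k <= r -> keeps t k s (setr s r v).
Proof. by move=> e h; split=> //= x hx; case: eqP => // ex; lia. Qed.

Lemma keeps_setl t k s q es p : ip s = 0 -> t.*2 <= q -> keeps t k s (setl s q es p).
Proof. by move=> e h; split=> //= x hx *; case: eqP => // ex; lia. Qed.

Lemma ctx_push rho t k ds env tabs s r i d : ctx rho t k ds env tabs s -> k <= r ->
  rg s r = i -> i <= X ^ d -> ctx (rcons rho r) t r.+1 (rcons ds d) (rcons env i) tabs s.
Proof.
move=> [c1 c2 c3 c4 c5 c6 c7 c8 c9 c10] le ei li; split=> //.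
- by rewrite !size_rcons c1.
- by rewrite size_rcons.
- move=> l; rewrite size_rcons ltnS nth_rcons c1 leq_eqVlt => /orP[/eqP->|h].
    by rewrite ltnn eqxx.
  by rewrite h; have := c4 _ h; lia.
- move=> l; rewrite size_rcons ltnS !nth_rcons c1 leq_eqVlt => /orP[/eqP->|h].
    by rewrite ltnn eqxx.
  by rewrite h c5.
- exact: bounded_env.
- by rewrite nth_rcons c2.
Qed.

Lemma ctx_pusht rho t k ds env tabs s T : ctx rho t k ds env tabs s ->
  ls s t.*2 = T -> (forall i, nth 0 T i <= X) ->
  ctx rho t.+1 k ds env (rcons tabs T) s.
Proof.
move=> [c1 c2 c3 c4 c5 c6 c7 c8 c9 c10] el lT; split=> //.
- by rewrite size_rcons c3.
- move=> j; rewrite ltnS nth_rcons c3 leq_eqVlt => /orP[/eqP->|h].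
    by rewrite ltnn eqxx.
  by rewrite h c6.
- exact: bounded_tab.
Qed.

Lemma wp_incs k c s : rg s k + c <= V -> ip s = 0 ->
  wp (iter c (Seq (Inc k)) (Wipe k.+1)) (c + 1)
     (fun _ s' => rg s' k = rg s k + c /\ forall t, keeps t k s s') s.
Proof.
elim: c s => [|c IH] s le i0.
  apply: wp_wipe => _ /=; split; last by move=> t; apply: keeps_setr.
  by case: eqP => [e|_]; lia.
apply: (@wp_weaken _ _ _ _ (1 + (c + 1)) _ _ _ _ _ _ (fun _ _ h => h)); last by lia.
rewrite iterS; apply: wp_seq; apply: wp_inc; first by lia.
move=> _; apply: wp_weaken (IH _ _ _) _ _ => //=; first by rewrite eqxx; lia.
move=> _ s' [e h]; split; first by rewrite e eqxx; lia.
by move=> t; apply: keeps_trans (h t); apply: keeps_setr.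
Qed.

Lemma keeps_setp t k s q p : ip s = 0 -> ~~ odd q -> keeps t k s (setl s q (ls s q) p).
Proof.
move=> e h; split=> //= x hx; first by case: eqP => [->|].
by move=> ox; case: eqP => // ex; move: h; rewrite -ex ox.
Qed.

Lemma ev_le e ds env tabs : 0 < size env -> bounded ds env tabs -> X ^ dg ds e <= V ->
  ev env tabs e <= V.
Proof. by move=> h1 h2; apply: leq_trans; apply: ev_bound. Qed.

(** The degree of an expression dominates the degrees of its subexpressions, so this single
    condition on [V] is inherited and bounds all intermediate values. *)
Definition compiles e := forall rho t k ds env tabs s, ctx rho t k ds env tabs s ->
  X ^ dg ds e <= V -> wp (comp rho t k e) (cost V e) (post t k (ev env tabs e) s) s.

Lemma exp_le_trans a b : X ^ b <= V -> a <= b -> X ^ a <= V.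
Proof. by move=> h1 h2; apply: leq_trans (X_exp h2) h1. Qed.

Lemma compiles_var l : compiles (Var l).
Proof.
move=> rho t k ds env tabs s c le; apply: (comp_var_ok c) => //; first exact: ctx_valid c le.
move=> b s' sr e h; split=> //; apply: keeps_same sr h; exact: ctx_ip c.
Qed.

Lemma compiles_cst x : compiles (Cst x).
Proof.
move=> rho t k ds env tabs s c /= le; apply: wp_seq; apply: wp_wipe => _.
have i0 := ctx_ip c.
apply: wp_weaken (wp_incs (c := x) _ _) _ _ => //=.
  by rewrite eqxx add0n; apply: leq_trans le; apply: ltnW; apply: ltn_expl.
move=> b0 s' [e h]; split; first by rewrite e eqxx.
by apply: keeps_trans (h t); apply: keeps_setr.
Qed.

Lemma compiles_add a b : compiles a -> compiles b -> compiles (Add a b).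
Proof.
move=> IHa IHb rho t k ds env tabs s c le.
have vle : ev env tabs (Add a b) <= V := ev_le (ctx_env0 c) (ctx_bd c) le.
rewrite /= in le vle *; have i0 := ctx_ip c.
apply: wp_seq; apply: wp_weaken (IHa _ _ _ _ _ _ _ c _) _ _ => //.
  by apply: exp_le_trans le _; lia.
move=> _ s1 [e1 k1]; have c1 := ctx_keeps c k1 (leqnSn k).
apply: wp_seq; apply: wp_weaken (IHb _ _ _ _ _ _ _ c1 _) _ _ => //.
  by apply: exp_le_trans le _; lia.
move=> _ s2 [e2 k2]; have e3 : rg s2 k = ev env tabs a by rewrite (keeps_rg k2).
apply: wp_addto; [by apply/eqP; lia|by rewrite e2 e3|].
move=> b0 s3 sr h; split; first by rewrite h eqxx e2 e3.
apply: keeps_trans k1 (keeps_trans (keeps_sub k2 _ _) (keeps_same _ sr _)) => //.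
  exact: keeps_ip k2.
by move=> r hr; rewrite h; case: eqP => [|_]; [lia|case: eqP => [|//]; lia].
Qed.

Lemma compiles_sub a b : compiles a -> compiles b -> compiles (Sub a b).
Proof.
move=> IHa IHb rho t k ds env tabs s c le.
rewrite /= in le *; have i0 := ctx_ip c.
have leb : X ^ dg ds b <= V by apply: exp_le_trans le _; lia.
have vle : ev env tabs b <= V := ev_le (ctx_env0 c) (ctx_bd c) leb.
apply: wp_seq; apply: wp_weaken (IHa _ _ _ _ _ _ _ c _) _ _ => //.
  by apply: exp_le_trans le _; lia.
move=> _ s1 [e1 k1]; have c1 := ctx_keeps c k1 (leqnSn k).
apply: wp_seq; apply: wp_weaken (IHb _ _ _ _ _ _ _ c1 _) _ _ => //.
move=> _ s2 [e2 k2]; have e3 : rg s2 k = ev env tabs a by rewrite (keeps_rg k2).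
apply: wp_subto; [by apply/eqP; lia|by rewrite e2|].
move=> b0 s3 sr h; split; first by rewrite h eqxx e2 e3.
apply: keeps_trans k1 (keeps_trans (keeps_sub k2 _ _) (keeps_same _ sr _)) => //.
  exact: keeps_ip k2.
by move=> r hr; rewrite h; case: eqP => [|_]; [lia|case: eqP => [|//]; lia].
Qed.

Lemma compiles_sum a b : compiles a -> compiles b -> compiles (Sum a b).
Proof.
move=> IHa IHb rho t k ds env tabs s c le.
have vle : ev env tabs (Sum a b) <= V := ev_le (ctx_env0 c) (ctx_bd c) le.
rewrite /= in le vle *; have i0 := ctx_ip c.
have lea : X ^ dg ds a <= V by apply: exp_le_trans le _; lia.
have leb : X ^ dg (rcons ds (dg ds a)) b <= V by apply: exp_le_trans le _; lia.
have na : ev env tabs a <= X ^ dg ds a := ev_bound a (ctx_env0 c) (ctx_bd c).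
have nV : ev env tabs a <= V := leq_trans na lea.
move: (ev env tabs a) na nV (IHa rho t k.+1 ds env tabs s
  (ctx_keeps c (keeps_refl t k i0) (leqnSn k)) lea) vle => n na nV IH vle.
set F := fun i => ev (rcons env i) tabs b.
(* Partial sums never exceed the final value, so the accumulator stays within [V]. *)
have mono m : m <= n -> \sum_(0 <= i < m) F i <= V.
  move=> hm; apply: leq_trans vle; rewrite (@big_cat_nat _ _ _ m 0 n) //=.
  exact: leq_addr.
apply: wp_seq; apply: wp_weaken IH _ _ => // _ s1 [e1 k1].
apply: wp_seq; apply: wp_wipe => _; apply: wp_seq; apply: wp_wipe => _.
apply: wp_weaken (wp_loop (m := n) (n := cost V b + ((V * 2).+1 + 1))
  (I := fun j s' => [/\ rg s' k.+1 = j, rg s' k = \sum_(0 <= i < n - j) F i,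
     rg s' k.+2 = n - j, j <= n & keeps t k s s']) _ _ _) _ _.
- by move=> j s' [].
- move=> j s2 lj [r1 r2 r3 _ k2].
  set s3 := setr s2 k.+1 j.
  have k3 : keeps t k s s3.
    by apply: (keeps_trans k2 (keeps_setr _ _ _ _)) => //; exact: keeps_ip k2.
  have c3 := ctx_keeps c k3 (leqnn k).
  have r3' : rg s3 k.+2 = n - j.+1 by rewrite /s3 /= ifN ?r3 //; apply/eqP; lia.
  have c4 := ctx_push (d := dg ds a) c3 (leqW (leqnSn k)) r3' (leq_trans (leq_subr _ _) na).
  apply: wp_seq; apply: wp_weaken (IHb _ _ _ _ _ _ _ c4 leb) _ _ => // _ s4 [e4 k4].
  have q1 : rg s4 k = \sum_(0 <= i < n - j.+1) F i.
    by rewrite (keeps_rg k4) ?/s3 /= ?ifN ?r2 //; try apply/eqP; lia.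
  have sumS : \sum_(0 <= i < n - j) F i = \sum_(0 <= i < n - j.+1) F i + F (n - j.+1).
    have -> : n - j = (n - j.+1).+1 by lia.
    by rewrite big_nat_recr.
  apply: wp_seq; apply: wp_addto; first by apply/eqP; lia.
    by rewrite e4 q1 -/(F _) -sumS mono // leq_subr.
  move=> _ s5 sr h5; apply: wp_inc.
    rewrite h5 ifN ?ifN ?(keeps_rg k4) // ?r3'; try apply/eqP; lia.
  have h5' r : r < k.+3 -> r != k -> rg s5 r = rg s3 r.
    move=> hr hk; rewrite h5 (negbTE hk) ifN ?(keeps_rg k4) //; apply/eqP; lia.
  have k5 : keeps t k s s5.
    apply: keeps_trans k3 (keeps_trans (keeps_sub k4 _ _) (keeps_same _ sr _)) => //.
    - by lia.
    - exact: keeps_ip k4.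
    - by move=> r hr; rewrite h5 ifN ?ifN //; apply/eqP; lia.
  move=> _; split=> /=.
  + rewrite ifN; last by apply/eqP; lia.
    rewrite h5' //; last by apply/eqP; lia.
    by rewrite /s3 /= eqxx.
  + rewrite ifN; last by apply/eqP; lia.
    by rewrite h5 eqxx e4 q1 -/(F _) sumS.
  + rewrite eqxx h5' //; last by apply/eqP; lia.
    by rewrite r3'; lia.
  + by lia.
  + by apply: (keeps_trans k5 (keeps_setr _ _ _ _)); [exact: keeps_ip k5|lia].
- rewrite subnn big_geq //; split=> //=.
  + by rewrite !ifN ?e1 //; apply/eqP; lia.
  + by rewrite ifN ?eqxx //; apply/eqP; lia.
  + by rewrite eqxx.
  + have i1 := keeps_ip k1.
    apply: keeps_trans (keeps_sub k1 _ _) (keeps_trans (keeps_setr _ _ _ _) (keeps_setr _ _ _ _))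
      => //; lia.
- by rewrite ltnS leq_mul2r nV orbT.
- by move=> b0 s' [_ r2 _ _ k']; split=> //; rewrite r2 subn0.
Qed.

Lemma compiles_inp x a : compiles a -> compiles (Inp x a).
Proof.
move=> IHa rho t k ds env tabs s c le; rewrite /= in le *; have i0 := ctx_ip c.
have vle : ev env tabs a <= V := ev_le (ctx_env0 c) (ctx_bd c) le.
have V1 : 0 < V by apply: leq_trans (X_gt0) (ctx_X c).
move: (ev env tabs a) vle (IHa rho t k.+1 ds env tabs s
  (ctx_keeps c (keeps_refl t k i0) (leqnSn k)) le) => n nV IH.
apply: wp_seq; apply: wp_weaken IH _ _ => // _ s1 [e1 k1].
apply: wp_seq; apply: (@wp_in _ _ _ _ _ _ true MRight) => //=.
rewrite (keeps_ip k1); apply: wp_seq.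
(* The head is clamped at the right marker, where no letter is read, just as [onth] finds none
   beyond the end of the word. *)
apply: wp_weaken (wp_loop (m := n) (n := 1)
  (I := fun j s' => [/\ rg s' k.+1 = j, ip s' = (minn (n - j) (size w)).+1, j <= n
     & keeps t k s (seti s' 0)]) _ _ _) _ _.
- by move=> j s' [].
- move=> j s2 lj [r1 r2 r3 k2].
  apply: (@wp_in _ _ _ _ _ _ true MRight) => //=; split=> /=.
  + by rewrite eqxx.
  + rewrite r2 minnSS; congr S; move: (size w) => L; lia.
  + by lia.
  + apply: keeps_trans k2 _; split=> //= r hr; rewrite ifN //; apply/eqP; lia.
- split=> //=; first by rewrite subnn min0n; move: (size w) => L; lia.
  by apply: keeps_trans (keeps_sub k1 _ _) _.
- by rewrite ltnS leq_mul2r nV orbT.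
move=> _ s2 [r1 r2 _ k2]; rewrite subn0 in r2.
apply: wp_seq; apply: wp_wipe => _; apply: wp_seq; apply: wp_ite.
set bb := onth w n == Some x.
apply: (@wp_in _ _ _ _ _ _ bb MStay).
  rewrite /= r2 /= /bb; congr (_, _); case: (ltnP n (size w)) => hn.
    by case: (onth w n).
  by rewrite !onth_default.
set s3 := seti _ _.
have k3 : keeps t k s (seti s3 0).
  apply: keeps_trans k2 _; split=> //= r hr; rewrite ifN //; apply/eqP; lia.
have k30 : rg s3 k = 0 by rewrite /s3 /= eqxx.
case: (bb).
- apply: wp_inc; first by rewrite k30.
  move=> _; apply: wp_home => b0; split; first by rewrite /= !eqxx.
  apply: keeps_trans k3 _; split=> //= r hr; rewrite ifN //; apply/eqP; lia.
- apply: wp_wipe => _; apply: wp_home => b0; split; first by rewrite /= eqxx.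
  apply: keeps_trans k3 _; split=> //= r hr; rewrite ifN //; apply/eqP; lia.
Qed.

Lemma compiles_len : compiles Len.
Proof.
move=> rho t k ds env tabs s c; rewrite /= expn1 => le; have i0 := ctx_ip c.
apply: wp_seq; apply: wp_wipe => _; apply: wp_seq; apply: wp_ilen => //=.
- exact: leq_trans le.
- by rewrite eqxx.
move=> _ s1 e1 h1 h2 h3; apply: wp_home => b0; split=> //; split=> //= r hr.
by rewrite h1 /= ?ifN //; apply/eqP; lia.
Qed.

Lemma compiles_get q a : compiles a -> compiles (Get q a).
Proof.
move=> IHa rho t k ds env tabs s c le; rewrite /= in le *; have i0 := ctx_ip c.
have {}le : X ^ dg ds a <= V by apply: exp_le_trans le _.
have vle : ev env tabs a <= V := ev_le (ctx_env0 c) (ctx_bd c) le.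
case: ltnP => hq; last first.
  apply: (@wp_weaken _ _ _ _ 1 _ _ _ _ _ _ (fun _ _ h => h)); last by lia.
  apply: wp_wipe => b0; split; last exact: keeps_setr.
  by rewrite /= eqxx [nth [::] _ _]nth_default ?(ctx_tabs c) // nth_nil.
move: (ev env tabs a) vle (IHa rho t k.+1 ds env tabs s
  (ctx_keeps c (keeps_refl t k i0) (leqnSn k)) le) => n nV IH.
apply: wp_seq; apply: wp_weaken IH _ _ => // _ s1 [e1 k1].
apply: wp_seq; apply: wp_rewind => _; apply: wp_seq.
set T := nth [::] tabs q.
have eT s' : keeps t k s s' -> ls s' q.*2 = T.
  by move=> k'; rewrite (keeps_ls k') ?ltn_double // (ctx_tab c).
have KL s' s'' : keeps t k s s' -> s'' = setr (setl s' q.*2 (ls s' q.*2)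
    (if ps s' q.*2 < size (ls s' q.*2) then (ps s' q.*2).+1 else ps s' q.*2)) k
    (nth 0 (ls s' q.*2) (ps s' q.*2)) -> keeps t k s s''.
  move=> k' ->; apply: (keeps_trans k' (keeps_trans (keeps_setp _ _ _ _ _) (keeps_setr _ _ _ _)))
    => //=; try exact: keeps_ip k'.
  by rewrite odd_double.
apply: wp_weaken (wp_loop (m := n) (n := 1)
  (I := fun j s' => [/\ rg s' k.+1 = j, ps s' q.*2 = minn (n - j) (size T), j <= n
     & keeps t k s s']) _ _ _) _ _.
- by move=> j s' [].
- move=> j s2 lj [r1 r2 r3 k2].
  have k3 : keeps t k s (setr s2 k.+1 j).
    by apply: (keeps_trans k2 (keeps_setr _ _ _ _)) => //; exact: keeps_ip k2.
  apply: wp_load => _; split=> /=.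
  + by rewrite ifN ?eqxx //; apply/eqP; lia.
  + by rewrite eqxx (eT _ k2) r2; move: (size T) => L; case: ifP => ?; lia.
  + by lia.
  + exact: KL k3 (erefl _).
- have i1 := keeps_ip k1; split=> //=; first by rewrite eqxx subnn min0n.
  apply: keeps_trans (keeps_sub k1 _ _) (keeps_setp _ _ _ _ _) => //.
  by rewrite odd_double.
- by rewrite ltnS leq_mul2r nV orbT.
move=> _ s2 [_ r2 _ k2]; rewrite subn0 in r2.
apply: wp_load => b0; split; last exact: KL k2 (erefl _).
rewrite /= eqxx (eT _ k2) r2; case: (leqP n (size T)) => hn //.
by rewrite !nth_default // ltnW.
Qed.

Lemma neq_lt r k : r < k -> r != k. Proof. by move=> h; apply/eqP; lia. Qed.

Lemma compiles_iter a b : compiles a -> compiles b -> compiles (Iter a b).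
Proof.
move=> IHa IHb rho t k ds env tabs s c le; rewrite /= in le *; have i0 := ctx_ip c.
have lea : X ^ dg (rcons ds 1) a <= V by apply: exp_le_trans le _; lia.
have leb : X ^ dg ds b <= V by apply: exp_le_trans le _; lia.
have MX : nth 0 env 0 <= X by case: (ctx_bd c).
have MMx := ctx_M c.
have MV : nth 0 env 0 <= V := leq_trans MX (ctx_X c).
set M := nth 0 env 0.
have tabX := @tabstep_bound env tabs a.
have tabS := @size_tabstep env tabs a.
rewrite -/M in MX MMx MV tabX tabS.
set Z := nseq M 0 in tabX tabS *.
set stp := fun T => mkseq _ M; rewrite -/(tabstep env tabs a) -/stp in tabX tabS.
set cur := t.*2; set new := t.*2.+1.
have nc : new != cur by apply/eqP; rewrite /new /cur; lia.
have cn : cur != new by rewrite eq_sym.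
have on : odd new by rewrite /new /= odd_double.
have KV s' x v : keeps t k s s' -> k <= x -> keeps t k s (setr s' x v).
  by move=> k' h; apply: (keeps_trans k' (keeps_setr _ _ _ h)); exact: keeps_ip k'.
have KL s' q es p : keeps t k s s' -> cur <= q -> keeps t k s (setl s' q es p).
  by move=> k' h; apply: (keeps_trans k' (keeps_setl _ _ _ _ h)); exact: keeps_ip k'.
have KS s' s'' : keeps t k s s' -> same_rest s' s'' ->
    (forall r, r < k -> rg s'' r = rg s' r) -> keeps t k s s''.
  by move=> k' sr h; apply: (keeps_trans k' (keeps_same _ sr h)); exact: keeps_ip k'.
have k0 := keeps_refl t k i0.
apply: wp_seq; apply: wp_wipe => _.
have k1 := KV _ k 0 k0 (leqnn k).
apply: wp_seq; apply: (comp_var_ok (ctx_keeps c k1 (leqnn k))); [by lia|by []|].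
move=> _ s2 sr2 e2 h2.
have k2 : keeps t k s s2 by apply: KS k1 sr2 _ => r hr; apply: h2; lia.
have z2 : rg s2 k = 0 by rewrite h2 //= eqxx.
apply: wp_seq; apply: wp_reset => _.
apply: wp_seq.
apply: wp_weaken (wp_loop (m := M) (n := 1) (I := fun j s' => [/\ rg s' k.+1 = j,
  rg s' k = 0, ls s' cur = nseq (M - j) 0, ps s' cur = M - j & j <= M /\ keeps t k s s'])
  _ _ _) _ _.
- by move=> j s' [].
- move=> j s3 lj [r1 r2 r3 r4 [r5 k3]]; apply: wp_emit => /=.
  + by rewrite r3 size_nseq.
  + by rewrite r3 size_nseq; lia.
  move=> _; split=> /=.
  + by rewrite eqxx.
  + by rewrite (negbTE (neq_lt (ltnSn k))).
  + have -> : M - j = (M - j.+1).+1 by lia.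
    by rewrite eqxx (negbTE (neq_lt (ltnSn k))) r2 r3 -cats1 -[[:: 0]]/(nseq 1 0) -nseqD addn1.
  + by rewrite eqxx r4; lia.
  + by split; [lia|apply: KL (KV _ _ _ k3 _) _].
- by split=> //=; rewrite ?eqxx ?subnn //; split=> //; apply: KL k2 _.
- by rewrite ltnS leq_mul2r MV orbT.
move=> _ s3 [_ _ T3 _ [_ k3]]; rewrite subn0 in T3.
apply: wp_seq; apply: (comp_var_ok (ctx_keeps c k3 (leqnn k))); [by []|by []|].
move=> _ s4 sr4 e4 h4.
have k4 : keeps t k s s4 by apply: KS k3 sr4 _ => r hr; apply: h4; lia.
have T4 : ls s4 cur = Z by case: sr4 => -> _ _.
apply: wp_seq.
apply: wp_weaken (wp_loop (m := M)
  (n := 1 + ((5 * V + 4) + (1 +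
        ((V * (cost V a + (cost V a + ((5 * V + 4) + ((V * 2).+1 + ((V * 2).+1 +
               (1 + 1)))))).+1).+1 +
        (1 + (1 + ((5 * V + 4) + (V * (1 + 1).+1).+1)))))))
  (I := fun j s' => [/\ rg s' k = j,
  ls s' cur = iter (M - j) stp Z, j <= M & keeps t k s s']) _ _ _) _ _.
- by move=> j s' [].
- move=> j s5 lj [r1 r2 r3 k5].
  set T := iter (M - j.+1) stp Z in r2.
  have TX : forall i, nth 0 T i <= X by move=> i; apply: tabX.
  set f := fun i => minn (ev (rcons env i) (rcons tabs T) a) M.
  have eT : iter (M - j) stp Z = mkseq f M.
    by have -> : M - j = (M - j.+1).+1 by lia.
  have k6 := KV _ k j k5 (leqnn k); set s6 := setr s5 k j in k6 *.
  have R6 : rg s6 k = j by rewrite /= eqxx.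
  have T6 : ls s6 cur = T by [].
  apply: wp_seq; apply: wp_reset => _.
  have k7 := KL s6 new [::] 0 k6 (leqnSn cur); set s7 := setl s6 new [::] 0 in k7 *.
  apply: wp_seq; apply: (comp_var_ok (ctx_keeps c k7 (leqnn k))); [by lia|by []|].
  move=> _ s8 sr8 e8 h8.
  have k8 : keeps t k s s8 by apply: KS k7 sr8 _ => r hr; apply: h8; lia.
  have R8 : rg s8 k = j by rewrite h8.
  have T8 : ls s8 cur = T by case: sr8 => -> _ _; rewrite /s7 /= (negbTE cn).
  have N8 : ls s8 new = [::] by case: sr8 => -> _ _; rewrite /s7 /= eqxx.
  have P8 : ps s8 new = 0 by case: sr8 => _ -> _; rewrite /s7 /= eqxx.
  apply: wp_seq; apply: wp_wipe => _.
  apply: wp_seq.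
  apply: wp_weaken (wp_loop (m := M) (n := cost V a + (cost V a + ((5 * V + 4) +
      ((V * 2).+1 + ((V * 2).+1 + (1 + 1))))))
    (I := fun i s' => [/\ rg s' k.+1 = i, rg s' k.+2 = M - i, rg s' k = j,
      ls s' cur = T /\ ls s' new = mkseq f (M - i) & ps s' new = M - i /\
      (i <= M /\ keeps t k s s')]) _ _ _) _ _.
  + by move=> i s' [].
  + move=> i s9 li [q1 q2 q3 [q4 q5] [q6 [q7 k9]]].
    have k10 := KV _ k.+1 i k9 (leqnSn k); set s10 := setr s9 k.+1 i in k10 *.
    set m := M - i.+1 in q2 q5 q6.
    have mM : m < M by rewrite /m; lia.
    have c10 := ctx_pusht (ctx_keeps c k10 (leqnn k)) (q4 : ls s10 cur = T) TX.
    have q2' : rg s10 k.+2 = m by rewrite /= ifN ?q2 //; apply/eqP; lia.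
    have mX : m <= X ^ 1 by rewrite expn1; lia.
    have c10' := ctx_push c10 (leqW (leqnSn k)) q2' mX.
    apply: wp_seq; apply: wp_weaken (IHa _ _ _ _ _ _ _ c10' lea) _ _ => // _ s11 [e11 k11].
    have c11 := ctx_keeps c10' k11 (leqnSn _).
    apply: wp_seq; apply: wp_weaken (IHa _ _ _ _ _ _ _ c11 lea) _ _ => // _ s12 [e12 k12].
    have v12 : rg s12 k.+3 = rg s12 k.+4 by rewrite e12 (keeps_rg k12) // e11.
    have vV : rg s12 k.+4 <= V.
      by rewrite e12; apply: ev_le lea; [exact: ctx_env0 c10'|exact: ctx_bd c10'].
    (* With t + 1 tables in scope, lists below 2 t + 2 are protected; this includes [new], to which
       the loop is appending. *)
    have K12 : keeps t.+1 k.+3 s10 s12 := keeps_trans k11 (keeps_sub k12 (leqnn _) (leqnSn _)).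
    have k12' : keeps t k s s12 by apply: keeps_trans k10 (keeps_sub K12 _ _); lia.
    apply: wp_seq; apply: (comp_var_ok (ctx_keeps c k12' (leqnn k))); [by lia|by []|].
    move=> _ s13 sr13 e13 h13.
    apply: wp_seq; apply: wp_subto; [by apply/eqP; lia|by rewrite e13|].
    move=> _ s14 sr14 h14.
    apply: wp_seq; apply: wp_subto; [by apply/eqP; lia| |].
      by rewrite h14 eqxx h13 //; lia.
    move=> _ s15 sr15 h15.
    have h15' r : r < k.+3 -> rg s15 r = rg s10 r.
      move=> hr; rewrite h15 !ifN ?h14 ?ifN ?h13 ?(keeps_rg K12) //; try apply/eqP; lia.
    (* Here v - (v - M) becomes the truncated entry. *)
    have v15 : rg s15 k.+3 = f m.
      rewrite h15 eqxx !h14 ifN; last by apply/eqP; lia.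
      rewrite ifN; last by apply/eqP; lia.
      rewrite eqxx e13 !h13 // v12 e12 /f.
      by move: (ev _ _ _) => u; rewrite /= -/M; lia.
    have l15 q : ls s15 q = ls s12 q.
      by case: sr15 => -> _ _; case: sr14 => -> _ _; case: sr13 => -> _ _.
    have p15 q : ps s15 q = ps s12 q.
      by case: sr15 => _ -> _; case: sr14 => _ -> _; case: sr13 => _ -> _.
    have i15 : ip s15 = 0.
      by case: sr15 => _ _ ->; case: sr14 => _ _ ->; case: sr13 => _ _ ->; exact: keeps_ip k12.
    have k15 : keeps t k s s15.
      apply: (keeps_trans k12'); split=> // r hr.
      by rewrite h15' ?(keeps_rg K12) //; lia.
    have n15 : ls s15 new = mkseq f m.
      by rewrite l15 (keeps_ls K12) // /new; lia.
    have pn15 : ps s15 new = m.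
      by rewrite p15 (keeps_ps K12) // /new; lia.
    have c15 : ls s15 cur = T.
      by rewrite l15 (keeps_ls K12) // /cur; lia.
    apply: wp_seq; apply: wp_emit.
    * by rewrite n15 pn15 size_mkseq.
    * by rewrite n15 size_mkseq; lia.
    move=> _; apply: wp_inc.
      by rewrite /= h15' // q2'; lia.
    move=> _; split=> /=.
    * rewrite ifN; last by apply/eqP; lia.
      by rewrite h15' //= eqxx.
    * by rewrite eqxx h15' // q2' /m; lia.
    * rewrite ifN; last by apply/eqP; lia.
      by rewrite h15' /= ?ifN ?q3 //; try apply/eqP; lia.
    * rewrite (negbTE cn) eqxx c15 n15 v15; split=> //.
      have -> : M - i = m.+1 by rewrite /m; lia.
      by rewrite mkseqS.
    * rewrite eqxx pn15; split; first by rewrite /m; lia.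
      by split; [lia|apply: KV; [apply: KL k15 _; rewrite /new /cur; lia|lia]].
  + split=> /=.
    * by rewrite ifN ?e8 //; apply/eqP; lia.
    * by rewrite eqxx subnn.
    * by rewrite ifN ?R8 //; apply/eqP; lia.
    * by rewrite subnn T8 N8.
    * by rewrite subnn P8; split=> //; split=> //; apply: KV k8 _; lia.
  + by rewrite ltnS leq_mul2r MV orbT.
  move=> _ s9 [_ _ R9 [T9 N9] [_ [_ k9]]]; rewrite subn0 in N9.
  apply: wp_seq; apply: wp_rewind => _.
  apply: wp_seq; apply: wp_reset => _.
  set s10 := setl (setl _ _ _ _) _ _ _.
  have k10 : keeps t k s s10 by apply: KL (KL _ _ _ _ k9 _) _; rewrite /new /cur; lia.
  apply: wp_seq; apply: (comp_var_ok (ctx_keeps c k10 (leqnn k))); [by lia|by []|].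
  move=> _ s11 sr11 e11 h11.
  have k11 : keeps t k s s11 by apply: KS k10 sr11 _ => r hr; apply: h11; lia.
  have R11 : rg s11 k = j by rewrite h11.
  have C11 : ls s11 cur = [::] by case: sr11 => -> _ _; rewrite /= eqxx.
  have PC11 : ps s11 cur = 0 by case: sr11 => _ -> _; rewrite /= eqxx.
  have N11 : ls s11 new = mkseq f M.
    by case: sr11 => -> _ _; rewrite /= (negbTE nc) eqxx.
  have PN11 : ps s11 new = 0 by case: sr11 => _ -> _; rewrite /= (negbTE nc) eqxx.
  apply: wp_weaken (wp_loop (m := M) (n := 1 + 1)
    (I := fun i s' => [/\ rg s' k.+1 = i, rg s' k = j,
      ls s' cur = mkseq f (M - i) /\ ps s' cur = M - i,
      ls s' new = mkseq f M /\ ps s' new = M - i & i <= M /\ keeps t k s s']) _ _ _) _ _.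
  + by move=> i s' [].
  + move=> i s12 li [q1 q2 [q3 q4] [q5 q6] [q7 k12]].
    have e1 : M - i = (M - i.+1).+1 by lia.
    have l1 : M - i.+1 < M by lia.
    apply: wp_seq; apply: wp_load => _; apply: wp_emit.
    * by rewrite /= (negbTE cn) q3 q4 size_mkseq.
    * by rewrite /= (negbTE cn) q3 size_mkseq; lia.
    move=> _; split=> /=.
    * rewrite ifN ?eqxx //; apply/eqP; lia.
    * rewrite !ifN ?q2 //; apply/eqP; lia.
    * rewrite !eqxx (negbTE cn) q3 q4 q5 q6 nth_mkseq // e1; split=> //.
      by rewrite mkseqS.
    * by rewrite (negbTE nc) eqxx q5 q6 size_mkseq l1 e1.
    * split; first by lia.
      apply: (KL _ cur); last by [].
      apply: (KV _ k.+2); last by lia.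
      apply: (KL _ new); last by rewrite /new /cur; lia.
      by apply: KV k12 _; lia.
  + by rewrite subnn C11 PC11 N11 PN11; split=> //; split.
  + by rewrite ltnS leq_mul2r MV orbT.
  move=> _ s12 [_ q2 [q3 _] _ [_ k12]]; rewrite subn0 in q3.
  by split=> //; rewrite ?q3 ?eT //; lia.
- by rewrite e4 subnn T4; split.
- by rewrite ltnS leq_mul2r MV orbT.
move=> _ s5 [_ T5 _ k5]; rewrite subn0 in T5.
have c5 := ctx_pusht (ctx_keeps c k5 (leqnn k)) T5 (tabX M ^~ MX).
apply: wp_weaken (IHb _ _ _ _ _ _ _ c5 leb) _ _ => // b0 s6 [e6 k6]; split=> //.
by apply: keeps_trans k5 (keeps_sub k6 _ _).
Qed.

Lemma comp_ok e : compiles e.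
Proof.
elim: e => [l|c|a IHa b IHb|a IHa b IHb|a IHa b IHb|x a IHa||t a IHa|a IHa b IHb].
- exact: compiles_var.
- exact: compiles_cst.
- exact: compiles_add.
- exact: compiles_sub.
- exact: compiles_sum.
- exact: compiles_inp.
- exact: compiles_len.
- exact: compiles_get.
- exact: compiles_iter.
Qed.

End Compile.

(** The table size is itself the value of an expression. It is computed with register 0, which still
    holds 0, as level 0, and then serves as level 0 of the main expression. *)
Definition program eM e :=
  Seq (comp [:: 0] 0 1 eM) (Seq (comp [:: 1] 0 2 e) (TestDec 2)).

Lemma program_run w X V Mx eM e (M := ev w [:: 0] [::] eM) :
  2 <= X -> (size w).+1 <= X -> M <= X -> M <= Mx -> X <= V ->
  X ^ dg [:: 0] eM <= V -> X ^ dg [:: 1] e <= V ->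
  exists t d, mexec w (Bd V Mx) (program eM e) data0 t (ev w [:: M] [::] e != 0) d /\
    t <= (cost V eM + (cost V e + 1)) * U w V Mx.
Proof.
move=> X2 Xw MX MMx XV le1 le2.
pose s0 := St (fun _ => 0) (fun _ => [::]) (fun _ => 0) 0.
have r0 : rep w V Mx s0 data0.
  split=> // [r|q].
  - by exists [::]; split=> //; split=> // -[].
  - by exists [::]; split=> //; split=> // -[].
have c0 : ctx X V Mx [:: 0] 0 1 [:: 0] [:: 0] [::] s0.
  split=> //=; try by case.
  by split=> //= [[|l]|t i]; rewrite /= ?nth_nil.
have : wp w V Mx (program eM e) (cost V eM + (cost V e + 1))
    (fun b _ => b = (ev w [:: M] [::] e != 0)) s0.
  apply: wp_seq; apply: wp_weaken (comp_ok X2 Xw c0 le1) _ _ => // _ s1 [e1 k1].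
  have c1 : ctx X V Mx [:: 1] 0 2 [:: 1] [:: M] [::] s1.
    split=> //=; try by case.
    - exact: keeps_ip k1.
    - by split=> //= [[|l]|t i]; rewrite /= ?nth_nil ?expn1.
  apply: wp_seq; apply: wp_weaken (comp_ok X2 Xw c1 le2) _ _ => // _ s2 [e2 k2].
  rewrite -e2; case E : (rg s2 2) => [|v].
    exact: wp_testdec0.
  exact: wp_testdecS E _.
move=> /(_ _ r0)[t [b [d [x y [s' [_ eb]]]]]]; subst b.
by exists t, d.
Qed.

(** * Polynomially bounded functions *)

Definition polyb (f : nat -> nat) := exists k, forall V, f V <= (V + 2) ^ k.

Lemma exp_mono a b k : a <= b -> a ^ k <= b ^ k.
Proof. by move=> h; case: k => // k; rewrite leq_exp2r. Qed.

Lemma polyb_cst c : polyb (fun _ => c).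
Proof.
exists c => V; apply: leq_trans (ltnW (ltn_expl c (isT : 1 < 2))) _.
by apply: exp_mono; rewrite leq_addl.
Qed.

Lemma polyb_id : polyb id.
Proof. by exists 1 => V; rewrite expn1 leq_addr. Qed.

Lemma polyb_mul f g : polyb f -> polyb g -> polyb (fun V => f V * g V).
Proof. by move=> [a ha] [b hb]; exists (a + b) => V; rewrite expnD leq_mul. Qed.

Lemma polyb_add f g : polyb f -> polyb g -> polyb (fun V => f V + g V).
Proof.
move=> [a ha] [b hb]; exists (a + b).+1 => V; rewrite expnS expnD.
apply: leq_trans (leq_add (ha V) (hb V)) _.
have pa : 0 < (V + 2) ^ a by rewrite expn_gt0 addnC.
have pb : 0 < (V + 2) ^ b by rewrite expn_gt0 addnC.
move: pa pb; move: (_ ^ a) (_ ^ b) => p q hp hq.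
by apply: (@leq_trans (2 * (p * q))); nia.
Qed.

Lemma polyb_S f : polyb f -> polyb (fun V => (f V).+1).
Proof.
move=> h; have [k hk] := polyb_add h (polyb_cst 1).
by exists k => V; rewrite -addn1.
Qed.

Lemma polyb_cost e : polyb (cost ^~ e).
Proof.
elim: e => *; rewrite /cost -/cost;
  repeat first [assumption | apply: polyb_S | apply: polyb_add | apply: polyb_mul
               | exact: polyb_id | exact: polyb_cst].
Qed.

(** * Terms with binders and their values *)

Definition world := (seq nat * seq (seq nat))%type.
Definition wle (E E' : world) := prefix E.1 E'.1 && prefix E.2 E'.2.
(** A term is an expression that depends on the numbers of variables and tables in
    scope; binders can then be written as functions on terms. *)
Definition tm := nat -> nat -> expr.

Lemma wle_refl E : wle E E. Proof. by rewrite /wle !prefix_refl. Qed.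
Lemma wle_trans E E' E'' : wle E E' -> wle E' E'' -> wle E E''.
Proof.
by move=> /andP[a b] /andP[c d]; rewrite /wle (prefix_trans a c) (prefix_trans b d).
Qed.
Lemma wle_rcons E E' i : wle E E' -> wle E (rcons E'.1 i, E'.2).
Proof.
by move=> h; apply: wle_trans h _; rewrite /wle /= prefix_refl -cats1 prefix_prefix.
Qed.
Lemma wle_rconst E E' T : wle E E' -> wle E (E'.1, rcons E'.2 T).
Proof.
by move=> h; apply: wle_trans h _; rewrite /wle /= prefix_refl -cats1 prefix_prefix.
Qed.

Lemma prefix_nth (T : eqType) (x : T) s s' i : prefix s s' -> i < size s ->
  nth x s' i = nth x s i.
Proof. by move=> /prefixP[r ->] h; rewrite nth_cat h. Qed.

Lemma prefix_size (T : eqType) (s s' : seq T) : prefix s s' -> size s <= size s'.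
Proof. by move=> /prefixP[r ->]; rewrite size_cat leq_addr. Qed.

(** The bound variable is the level that is next at the binder. Levels, unlike indices, do not
    change under further binders, so the variable can be handed to [f] as a constant function. *)
Definition tsum (n : tm) (f : tm -> tm) : tm :=
  fun m q => Sum (n m q) (f (fun _ _ => Var m) m.+1 q).
Definition titer (F : (tm -> tm) -> tm -> tm) (G : (tm -> tm) -> tm) : tm := fun m q =>
  Iter (F (fun e m' q' => Get q (e m' q')) (fun _ _ => Var m) m.+1 q.+1)
       (G (fun e m' q' => Get q (e m' q')) m q.+1).
Definition tadd (a b : tm) : tm := fun m q => Add (a m q) (b m q).
Definition tsub (a b : tm) : tm := fun m q => Sub (a m q) (b m q).
Definition tcst c : tm := fun _ _ => Cst c.
Definition tinp x (a : tm) : tm := fun m q => Inp x (a m q).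
Definition tlen : tm := fun _ _ => Len.
Definition tvar l : tm := fun _ _ => Var l.

Section Val.
Variable w : seq letter.
Implicit Types (E : world) (x a b : tm) (v : nat).

(** Quantifying over the extensions of the context makes weakening trivial. *)
Definition val E x v :=
  forall E', wle E E' -> ev w E'.1 E'.2 (x (size E'.1) (size E'.2)) = v.

Definition tabval E (g : tm -> tm) (T : seq nat) :=
  forall E' e v, wle E E' -> val E' e v -> val E' (g e) (nth 0 T v).

Lemma val_le E E' x v : wle E E' -> val E x v -> val E' x v.
Proof. by move=> h H E'' h'; apply: H; apply: wle_trans h h'. Qed.

Lemma tabval_le E E' g T : wle E E' -> tabval E g T -> tabval E' g T.
Proof. by move=> h H E'' e v h'; apply: H; apply: wle_trans h h'. Qed.

Lemma val_eq E x u v : u = v -> val E x u -> val E x v.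
Proof. by move=> ->. Qed.

Lemma val_var E l : l < size E.1 -> val E (tvar l) (nth 0 E.1 l).
Proof. by move=> h E' /andP[p _]; exact: prefix_nth p h. Qed.

Lemma val_cst E c : val E (tcst c) c. Proof. by []. Qed.

Lemma val_add E a b u v : val E a u -> val E b v -> val E (tadd a b) (u + v).
Proof. by move=> h1 h2 E' h; rewrite /= h1 // h2. Qed.

Lemma val_sub E a b u v : val E a u -> val E b v -> val E (tsub a b) (u - v).
Proof. by move=> h1 h2 E' h; rewrite /= h1 // h2. Qed.

Lemma val_inp E c a u : val E a u -> val E (tinp c a) (onth w u == Some c).
Proof. by move=> h1 E' h; rewrite /= h1. Qed.

Lemma val_len E : val E tlen (size w).+1. Proof. by []. Qed.

Lemma val_sum E n f v g : val E n v ->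
  (forall E' x i, wle E E' -> i < v -> val E' x i -> val E' (f x) (g i)) ->
  val E (tsum n f) (\sum_(0 <= i < v) g i).
Proof.
move=> hn hf E' h /=; rewrite hn //; apply: eq_big_nat => i /andP[_ hi].
have h' : wle E (rcons E'.1 i, E'.2) by apply: wle_rcons.
have := hf _ (tvar (size E'.1)) i h' hi _ _ (wle_refl _).
rewrite /= size_rcons; apply.
apply: val_eq (val_var _) => /=; rewrite ?nth_rcons ?ltnn ?eqxx ?size_rcons //.
Qed.

(** The bound on [f] makes the truncation built into [Iter] invisible, so the table is the plain
    iteration. *)
Lemma val_iter E F G M f v : 0 < size E.1 -> nth 0 E.1 0 = M ->
  (forall E' T x i g, wle E E' -> i < M -> size T = M -> tabval E' g T ->
     val E' x i -> val E' (F g x) (f T i)) ->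
  (forall T i, size T = M -> i < M -> f T i <= M) ->
  (forall E' g, wle E E' ->
     tabval E' g (iter M (fun T => mkseq (f T) M) (nseq M 0)) -> val E' (G g) v) ->
  val E (titer F G) v.
Proof.
move=> e0 eM hF fM hG E' h.
have [p1 p2] := andP h.
have M' : nth 0 E'.1 0 = M by rewrite (prefix_nth _ p1) // eM.
have TV T : tabval (E'.1, rcons E'.2 T) (fun e m' q' => Get (size E'.2) (e m' q')) T.
  move=> E1 e u hE he E2 hE2 /=; rewrite he //; congr nth.
  have /andP[_ q] := wle_trans hE hE2.
  by rewrite (prefix_nth _ q) /= ?size_rcons // nth_rcons ltnn eqxx.
rewrite /titer /= M'.
set T1 := iter M _ _; set T2 := iter M (fun T => mkseq (f T) M) (nseq M 0) in hG.
have e12 : T1 = T2.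
  rewrite /T1 /T2.
  have : forall r, size (iter r (fun T => mkseq (f T) M) (nseq M 0)) = M.
    by case=> [|r] /=; rewrite ?size_nseq ?size_mkseq.
  elim: (M in iter M) => //= r IH sz; rewrite IH // {IH}.
  set T := iter r _ _; have sT : size T = M by apply: sz.
  apply/eq_in_map => i; rewrite mem_iota /= add0n => hi.
  set E1 := (rcons E'.1 i, rcons E'.2 T).
  have hE1 : wle E E1 by apply: wle_rcons (wle_rconst _ h).
  have tv : tabval E1 (fun e m' q' => Get (size E'.2) (e m' q')) T.
    by apply: tabval_le (TV T); exact: wle_rcons (wle_refl _).
  have vx : val E1 (tvar (size E'.1)) i.
    by apply: val_eq (val_var _) => /=; rewrite ?nth_rcons ?ltnn ?eqxx ?size_rcons.
  have := hF _ _ _ _ _ hE1 hi sT tv vx _ (wle_refl _).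
  by rewrite /= !size_rcons => ->; apply/minn_idPl; apply: fM.
rewrite e12.
have hE2 : wle E (E'.1, rcons E'.2 T2) by apply: wle_rconst.
have := hG _ _ hE2 (TV T2) _ (wle_refl _).
by rewrite /= size_rcons.
Qed.

End Val.

(** * The refinement algorithm as a function on numbers *)

Section Algorithm.
Variables (k1 k2 N : nat) (dm : nat -> seq nat) (E : rel nat) (cl : nat -> nat).

Definition base := N.+1.
Definition ntup := base ^ k1.
Definition nidx := 2 * ntup.
Definition dig (i c : nat) := (i %/ base ^ c) %% base.
Definition sbs (i c u : nat) := i - dig i c * base ^ c + u * base ^ c.
(** Values of the variables, x's before y's, in the position with x-digits [i] and
    y-values [y]; 0 stands for undefined. *)
Definition av (i : nat) (y : nat -> nat) (l : nat) := if l < k1 then dig i l else y (l - k1).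
Definition updy (y : nat -> nat) (j u l : nat) := if l == j then u else y l.
(** An undefined variable may share the value 0 with a color name; [atp] tells them apart by
    comparing domains. *)
Definition cz x := (x != 0) * cl x.
Definition ez x y := (x != 0) && (y != 0) && E x y.

Definition atp (a b : nat -> nat) : bool :=
  all (fun l => ((a l == 0) == (b l == 0)) && (cz (a l) == cz (b l)) &&
    all (fun l' => ((a l == a l') == (b l == b l')) &&
                   (ez (a l) (a l') == ez (b l) (b l'))) (iota 0 (k1 + k2)))
  (iota 0 (k1 + k2)).

Definition tester := nat -> nat -> (nat -> nat) -> nat -> nat -> (nat -> nat) -> bool.

(** An index is a (k1 + 1)-digit number whose leading digit selects the structure
    P or Q. *)
Section Refine.
Variables (rec : tester) (zP : nat) (yP : nat -> nat) (zQ : nat) (yQ : nat -> nat).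

Definition Zi i := if i %/ ntup == 0 then zP else zQ.
Definition Yi i l := if i %/ ntup == 0 then yP l else yQ l.
Definition cntX (T : seq nat) i c h :=
  count (fun u => nth 0 T (sbs i c u) == nth 0 T h) (dm (Zi i)).
(** The pair [h], [u] names a class of extensions by a representative. The leading digit is stripped
    from both indices because the recursive call gets the structures as separate arguments. *)
Definition cntY i j h u :=
  count (fun u' => rec (Zi i) (i %% ntup) (updy (Yi i) j u')
                       (Zi h) (h %% ntup) (updy (Yi h) j u)) (dm (Zi i)).
(** The first conjunct makes each round refine the previous one, on which the bound for the number
    of rounds rests. The y's have the same domain in both structures, so [yP] alone tells which of
    them are undefined. *)
Definition same (T : seq nat) i i' : bool :=
  (nth 0 T i == nth 0 T i') && atp (av i (Yi i)) (av i' (Yi i')) &&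
  all (fun c => all (fun h => cntX T i c h == cntX T i' c h) (iota 0 nidx)) (iota 0 k1) &&
  all (fun j => (yP j != 0) || all (fun h => all (fun u => cntY i j h u.+1 == cntY i' j h u.+1)
     (iota 0 N)) (iota 0 nidx)) (iota 0 k2).
Definition rstep (T : seq nat) := mkseq (fun i => find (same T i) (iota 0 nidx)) nidx.
Definition rtab := iter nidx rstep (nseq nidx 0).
End Refine.

Definition mkeq (rec : tester) : tester := fun zP sP yP zQ sQ yQ =>
  let T := rtab rec zP yP zQ yQ in nth 0 T sP == nth 0 T (ntup + sQ).

(** The depth bounds the number of undefined y's; at depth 0 the y-tests are vacuous and the
    recursion ends. *)
Fixpoint eqv (l : nat) : tester :=
  if l is l'.+1 then mkeq (eqv l') else mkeq (fun _ _ _ _ _ _ => true).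

End Algorithm.

(** * Boolean and arithmetic operations as terms *)

Definition tnot a := tsub (tcst 1) a.
Definition tmul a b := tsum a (fun _ => b).
Definition teq a b := tnot (tadd (tsub a b) (tsub b a)).
Definition tleq a b := tnot (tsub a b).
Definition tor a b := tnot (tmul (tnot a) (tnot b)).
Definition tall n (f : tm -> tm) := tnot (tsum n (fun i => tnot (f i))).
Definition tif c a b := tadd (tmul c a) (tmul (tnot c) b).
Definition tS a := tadd a (tcst 1).
(** The least solution is the number of indices i such that no j <= i is a solution; without a
    solution this is [n], as for [find]. In the same way a quotient is the number of i with (i + 1)
    b <= a. *)
Definition tmin n (f : tm -> tm) := tsum n (fun i => tall (tS i) (fun j => tnot (f j))).
Definition tdiv a b := tsum a (fun i => tleq (tmul (tS i) b) a).
Definition tmod a b := tsub a (tmul (tdiv a b) b).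
Definition tpow b c := iter c (tmul b) (tcst 1).
(** Unrolled outside the language, for ranges that depend on k1 and k2 only. *)
Definition tallm n (f : nat -> tm) := foldr (fun l acc => tmul (f l) acc) (tcst 1) (iota 0 n).

Lemma sum_indic_lt n b : b <= n -> \sum_(0 <= i < n) (i < b : nat) = b.
Proof.
move=> h; rewrite (@big_cat_nat _ _ _ b) //=.
have -> : \sum_(b <= i < n) (i < b : nat) = 0.
  by rewrite big_nat; apply: big1 => i /andP[hi _]; rewrite ltnNge hi.
have -> : \sum_(0 <= i < b) (i < b : nat) = \sum_(0 <= i < b) 1.
  by apply: eq_big_nat => i /andP[_ ->].
by rewrite addn0 sum_nat_const_nat subn0 muln1.
Qed.

Lemma sum_count n (g : nat -> bool) : \sum_(0 <= i < n) (g i : nat) = count g (iota 0 n).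
Proof.
rewrite -sum1_count [RHS]big_mkcond /= /index_iota subn0.
by apply: eq_bigr => i _; case: (g i).
Qed.

Lemma find_iota_lt n (g : nat -> bool) i : i < n ->
  all (fun j => ~~ g j) (iota 0 i.+1) = (i < find g (iota 0 n)).
Proof.
move=> hi; apply/idP/idP => [/allP h|h].
  rewrite ltnNge; apply/negP => hf.
  have lf : find g (iota 0 n) < n := leq_ltn_trans hf hi.
  have hs : has g (iota 0 n) by rewrite has_find size_iota.
  have := nth_find 0 hs; rewrite nth_iota // add0n => gf.
  by have := h (find g (iota 0 n)); rewrite mem_iota add0n ltnS hf gf => /(_ isT).
apply/allP => j; rewrite mem_iota add0n /= ltnS => hj.
have := before_find 0 (leq_ltn_trans hj h); rewrite nth_iota ?add0n => [->//|].
exact: leq_ltn_trans hj hi.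
Qed.

Section Val2.
Variable w : seq letter.
Local Notation val := (val w).
Local Notation tabval := (tabval w).
Implicit Types (W : world) (x a b : tm) (v : nat).

Lemma val_not W a (u : bool) : val W a u -> val W (tnot a) (~~ u).
Proof. by move=> h; apply: val_eq (val_sub (val_cst _ 1) h); case: u {h}. Qed.

Lemma val_mul W a b u v : val W a u -> val W b v -> val W (tmul a b) (u * v).
Proof.
move=> ha hb; apply: val_eq (@val_sum _ _ _ _ _ (fun _ => v) ha _).
  by rewrite sum_nat_const_nat subn0.
by move=> E' x i h _ _; exact: val_le h hb.
Qed.

Lemma val_and W a b (u v : bool) : val W a u -> val W b v -> val W (tmul a b) (u && v).
Proof. by move=> ha hb; apply: val_eq (val_mul ha hb); rewrite mulnb. Qed.

Lemma val_eqn W a b u v : val W a u -> val W b v -> val W (teq a b) (u == v).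
Proof.
move=> ha hb; apply: val_eq (val_sub (val_cst _ 1) (val_add (val_sub ha hb) (val_sub hb ha))).
by case: eqP; lia.
Qed.

Lemma val_leq W a b u v : val W a u -> val W b v -> val W (tleq a b) (u <= v).
Proof.
move=> ha hb; apply: val_eq (val_sub (val_cst _ 1) (val_sub ha hb)).
by case: leqP; lia.
Qed.

Lemma val_or W a b (u v : bool) : val W a u -> val W b v -> val W (tor a b) (u || v).
Proof.
by move=> ha hb; apply: val_eq (val_not (val_and (val_not ha) (val_not hb))); rewrite negb_and !negbK.
Qed.

Lemma val_S W a u : val W a u -> val W (tS a) u.+1.
Proof. by move=> h; apply: val_eq (val_add h (val_cst _ 1)); rewrite addn1. Qed.

Lemma val_if W c a b (q : bool) u v : val W c q -> val W a u -> val W b v ->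
  val W (tif c a b) (if q then u else v).
Proof.
move=> hc ha hb; apply: val_eq (val_add (val_mul hc ha) (val_mul (val_not hc) hb)).
by case: q {hc} => /=; rewrite ?mul1n ?mul0n ?addn0.
Qed.

Lemma val_all W n f v (g : nat -> bool) : val W n v ->
  (forall E' x i, wle W E' -> i < v -> val E' x i -> val E' (f x) (g i)) ->
  val W (tall n f) (all g (iota 0 v)).
Proof.
move=> hn hf.
apply: val_eq (val_sub (val_cst _ 1) (@val_sum _ _ _ _ _ (fun i => ~~ g i : nat) hn _)).
  rewrite sum_count all_count -(count_predC g) -[X in X == _]addn0 eqn_add2l.
  rewrite [count (fun i => ~~ g i) _](eq_count (a2 := predC g)) //.
  by case: (count _ _) => // n'.
by move=> E' x i h hi hx; apply: val_not; apply: hf.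
Qed.

Lemma val_min W n f v (g : nat -> bool) : val W n v ->
  (forall E' x i, wle W E' -> i < v -> val E' x i -> val E' (f x) (g i)) ->
  val W (tmin n f) (find g (iota 0 v)).
Proof.
move=> hn hf.
apply: val_eq (@val_sum _ _ _ _ _ (fun i => i < find g (iota 0 v) : nat) hn _).
  by apply: sum_indic_lt; rewrite -{2}(size_iota 0 v) find_size.
move=> E' x i h hi hx; rewrite -(find_iota_lt _ hi).
apply: val_all (val_S hx) _ => E2 y j h2 hj hy; apply: val_not; apply: hf => //.
- exact: wle_trans h h2.
- exact: leq_trans hj hi.
Qed.

Lemma val_div W a b u v : 0 < v -> val W a u -> val W b v -> val W (tdiv a b) (u %/ v).
Proof.
move=> v0 ha hb.
apply: val_eq (@val_sum _ _ _ _ _ (fun i => i < u %/ v : nat) ha _).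
  by apply: sum_indic_lt; exact: leq_div.
move=> E' x i h hi hx; rewrite -[i < _]/(i.+1 <= _) leq_divRL //.
by apply: val_leq; [apply: val_mul; [exact: val_S|exact: val_le h hb]|exact: val_le h ha].
Qed.

Lemma val_mod W a b u v : 0 < v -> val W a u -> val W b v -> val W (tmod a b) (u %% v).
Proof.
move=> v0 ha hb; apply: val_eq (val_sub ha (val_mul (val_div v0 ha hb) hb)).
by rewrite {1}(divn_eq u v) addKn.
Qed.

Lemma val_pow W b u c : val W b u -> val W (tpow b c) (u ^ c).
Proof. by move=> h; elim: c => [|c IH] //; rewrite expnS; apply: val_mul. Qed.

Lemma val_allm W n f (g : nat -> bool) : (forall i, i < n -> val W (f i) (g i)) ->
  val W (tallm n f) (all g (iota 0 n)).
Proof.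
move=> h; rewrite /tallm.
have : forall i, i \in iota 0 n -> val W (f i) (g i).
  by move=> i; rewrite mem_iota => hi; exact: h.
elim: (iota 0 n) => //= i s IH H; apply: val_and; first by apply: H; rewrite inE eqxx.
by apply: IH => j hj; apply: H; rewrite inE hj orbT.
Qed.

End Val2.

(** * Decoding the input word *)

Definition isn (w : seq letter) p : bool := onth w p == Some None.
Definition nn w b q := \sum_(0 <= j < q) (isn w (b + j) : nat).
(** Start of field [f] when the word is cut after each [None] from position [b] on. *)
Definition fstart w b f := b + \sum_(0 <= q < (size w).+1) (nn w b q < f : nat).
Definition flen w b f := fstart w b f.+1 - fstart w b f - 1.
(** Vertices of G have the codes 1 .. inG, those of H the next inH codes. *)
Definition inG w := flen w 0 0.
Definition iaG w := (inG w).+1.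
Definition icG w := iaG w + inG w * inG w.
(** Behind the matrix of G, the fields are its colors, one per vertex, and then the order of H; so
    the latter is field number [inG w]. *)
Definition inH w := flen w (icG w) (inG w).
Definition iaH w := fstart w (icG w) (inG w).+1.
Definition icH w := iaH w + inH w * inH w.
Definition iN w := inG w + inH w.
Definition idm w z := if z == 0 then iota 1 (inG w) else iota (inG w).+1 (inH w).
Definition icl w x := if x <= inG w then flen w (icG w) (x - 1)
                      else flen w (icH w) (x - 1 - inG w).
Definition ist (w : seq letter) p : bool := onth w p == Some (Some true).
Definition iE w x y : bool :=
  if x <= inG w then (y <= inG w) && ist w (iaG w + (x - 1) * inG w + (y - 1))
  else ~~ (y <= inG w) &&
       ist w (iaH w + (x - 1 - inG w) * inH w + (y - 1 - inG w)).

Definition tnn b q := tsum q (fun j => tinp None (tadd b j)).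
Definition tfstart b f := tadd b (tsum tlen (fun q => tleq (tS (tnn b q)) f)).
Definition tflen b f := tsub (tsub (tfstart b (tS f)) (tfstart b f)) (tcst 1).
Definition tnG := tflen (tcst 0) (tcst 0).
Definition taG := tS tnG.
Definition tcG := tadd taG (tmul tnG tnG).
Definition tnH := tflen tcG tnG.
Definition taH := tfstart tcG (tS tnG).
Definition tcH := tadd taH (tmul tnH tnH).
Definition tN := tadd tnG tnH.
Definition tcl x := tif (tleq x tnG) (tflen tcG (tsub x (tcst 1)))
                        (tflen tcH (tsub (tsub x (tcst 1)) tnG)).
Definition tE x y := tif (tleq x tnG)
  (tmul (tleq y tnG) (tinp (Some true)
     (tadd (tadd taG (tmul (tsub x (tcst 1)) tnG)) (tsub y (tcst 1)))))
  (tmul (tnot (tleq y tnG)) (tinp (Some true)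
     (tadd (tadd taH (tmul (tsub (tsub x (tcst 1)) tnG) tnH)) (tsub (tsub y (tcst 1)) tnG)))).
Definition tcount z (f : tm -> tm) :=
  tsum (tif (teq z (tcst 0)) tnG tnH)
       (fun v => f (tadd (tif (teq z (tcst 0)) (tcst 1) (tS tnG)) v)).

Section Val3.
Variable w : seq letter.
Local Notation val := (val w).
Local Notation tabval := (tabval w).
Implicit Types (W : world) (x y a b : tm) (v : nat).

Lemma val_nn W b q u v : val W b u -> val W q v -> val W (tnn b q) (nn w u v).
Proof.
move=> hb hq; apply: (@val_sum _ _ _ _ _ (fun j => isn w (u + j) : nat) hq) => E' x i h _ hx.
apply: val_inp; apply: val_add hx.
exact: val_le h hb.
Qed.

Lemma val_fstart W b f u v : val W b u -> val W f v -> val W (tfstart b f) (fstart w u v).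
Proof.
move=> hb hf; apply: (val_add hb).
apply: (@val_sum _ _ _ _ _ (fun q => nn w u q < v : nat) (@val_len w W)) => E' x i h _ hx.
apply: val_leq (val_le h hf); apply: val_S; apply: val_nn hx; exact: val_le h hb.
Qed.

Lemma val_flen W b f u v : val W b u -> val W f v -> val W (tflen b f) (flen w u v).
Proof.
move=> hb hf; apply: val_sub (val_cst _ _); apply: val_sub; apply: val_fstart => //.
exact: val_S.
Qed.

Lemma val_nG W : val W tnG (inG w). Proof. exact: val_flen (val_cst _ _) (val_cst _ _). Qed.
Lemma val_aG W : val W taG (iaG w). Proof. exact: val_S (@val_nG _). Qed.
Lemma val_cG W : val W tcG (icG w).
Proof. exact: val_add (@val_aG _) (val_mul (@val_nG _) (@val_nG _)). Qed.
Lemma val_nH W : val W tnH (inH w). Proof. exact: val_flen (@val_cG _) (@val_nG _). Qed.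
Lemma val_aH W : val W taH (iaH w).
Proof. exact: val_fstart (@val_cG _) (val_S (@val_nG _)). Qed.
Lemma val_cH W : val W tcH (icH w).
Proof. exact: val_add (@val_aH _) (val_mul (@val_nH _) (@val_nH _)). Qed.
Lemma val_N W : val W tN (iN w). Proof. exact: val_add (@val_nG _) (@val_nH _). Qed.

Lemma val_cl W x u : val W x u -> val W (tcl x) (icl w u).
Proof.
move=> hx; apply: val_if; first exact: val_leq hx (@val_nG _).
- exact: val_flen (@val_cG _) (val_sub hx (val_cst _ _)).
- exact: val_flen (@val_cH _) (val_sub (val_sub hx (val_cst _ _)) (@val_nG _)).
Qed.

Lemma val_E W x y u v : val W x u -> val W y v -> val W (tE x y) (iE w u v).
Proof.
move=> hx hy; have h1 := val_sub hx (val_cst _ 1); have h2 := val_sub hy (val_cst _ 1).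
rewrite /iE; set A := _ && _; set B := _ && _.
have -> : ((if u <= inG w then A else B) : nat) = if u <= inG w then (A : nat) else B.
  by case: ifP.
apply: val_if; first exact: val_leq hx (@val_nG _).
- apply: val_and (val_leq hy (@val_nG _)) (val_inp _ _).
  exact: val_add (val_add (@val_aG _) (val_mul h1 (@val_nG _))) h2.
- apply: val_and (val_not (val_leq hy (@val_nG _))) (val_inp _ _).
  exact: val_add (val_add (@val_aH _) (val_mul (val_sub h1 (@val_nG _)) (@val_nH _)))
    (val_sub h2 (@val_nG _)).
Qed.

Lemma val_count W z u f (g : nat -> bool) : val W z u ->
  (forall E' x i, wle W E' -> val E' x i -> val E' (f x) (g i)) ->
  val W (tcount z f) (count g (idm w u)).
Proof.
move=> hz hf; have hz0 := val_eqn hz (val_cst _ 0).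
apply: val_eq (@val_sum _ _ _ _ _ (fun i => g ((if u == 0 then 1 else (inG w).+1) + i) : nat)
  (val_if hz0 (@val_nG _) (@val_nH _)) _).
  rewrite sum_count /idm; case: (u == 0).
  - by rewrite (iotaDl 1 0) count_map.
  - by rewrite -[(inG w).+1 in RHS]addn0 iotaDl count_map.
move=> E' x i h _ hx; apply: hf => //; apply: val_add hx.
by apply: val_le h _; apply: val_if hz0 (val_cst _ _) (val_S (@val_nG _)).
Qed.

End Val3.

(** * The refinement algorithm as a term *)

Section AlgTerm.
Variables (k1 k2 : nat).

Definition tB := tS tN.
Definition tntup := tpow tB k1.
Definition tnidx := tmul (tcst 2) tntup.
Definition tdig i c := tmod (tdiv i (tpow tB c)) tB.
Definition tsbs i c u := tadd (tsub i (tmul (tdig i c) (tpow tB c))) (tmul u (tpow tB c)).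
Definition tav i (y : nat -> tm) l := if l < k1 then tdig i l else y (l - k1).
Definition tupdy (y : nat -> tm) j u l := if l == j then u else y l.
Definition tnz x := tnot (teq x (tcst 0)).
Definition tcz x := tmul (tnz x) (tcl x).
Definition tez x y := tmul (tmul (tnz x) (tnz y)) (tE x y).
Definition tiff a b := teq a b.
Definition tatp (a b : nat -> tm) :=
  tallm (k1 + k2) (fun l => tmul (tmul (tiff (teq (a l) (tcst 0)) (teq (b l) (tcst 0)))
      (teq (tcz (a l)) (tcz (b l))))
    (tallm (k1 + k2) (fun l' => tmul (tiff (teq (a l) (a l')) (teq (b l) (b l')))
        (tiff (tez (a l) (a l')) (tez (b l) (b l')))))).

Definition ttester := tm -> tm -> (nat -> tm) -> tm -> tm -> (nat -> tm) -> tm.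

Section RefineTerm.
Variables (rec : ttester) (zP : tm) (yP : nat -> tm) (zQ : tm) (yQ : nat -> tm).
Definition tfirst i := teq (tdiv i tntup) (tcst 0).
Definition tZ i := tif (tfirst i) zP zQ.
Definition tY i l := tif (tfirst i) (yP l) (yQ l).
Definition tcntX (g : tm -> tm) i c h :=
  tcount (tZ i) (fun u => teq (g (tsbs i c u)) (g h)).
Definition tcntY i j h u :=
  tcount (tZ i) (fun u' => rec (tZ i) (tmod i tntup) (tupdy (tY i) j u')
    (tZ h) (tmod h tntup) (tupdy (tY h) j u)).
Definition tsame g i i' :=
  tmul (tmul (tmul (teq (g i) (g i')) (tatp (tav i (tY i)) (tav i' (tY i'))))
    (tallm k1 (fun c => tall tnidx (fun h => teq (tcntX g i c h) (tcntX g i' c h)))))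
    (tallm k2 (fun j => tor (tnz (yP j)) (tall tnidx (fun h => tall tN (fun u =>
       teq (tcntY i j h (tS u)) (tcntY i' j h (tS u))))))).
End RefineTerm.

Definition tmkeq (rec : ttester) : ttester := fun zP sP yP zQ sQ yQ =>
  titer (fun g i => tmin tnidx (tsame rec zP yP zQ yQ g i))
        (fun g => teq (g sP) (g (tadd tntup sQ))).

Fixpoint teqv (l : nat) : ttester :=
  if l is l'.+1 then tmkeq (teqv l') else tmkeq (fun _ _ _ _ _ _ => tcst 1).

Section ValAlg.
Variable w : seq letter.
Local Notation val := (val w).
Local Notation tabval := (tabval w).
Local Notation N := (iN w).
Local Notation M := (nidx k1 N).
Local Notation vsame := (same k1 k2 N (idm w) (iE w) (icl w)).
Implicit Types (W : world) (x a b : tm) (v : nat).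

Lemma val_B W : val W tB (base N). Proof. exact: val_S (@val_N w _). Qed.
Lemma val_Bpow W c : val W (tpow tB c) (base N ^ c). Proof. exact: val_pow (@val_B _). Qed.
Lemma val_ntup W : val W tntup (ntup k1 N). Proof. exact: val_Bpow. Qed.
Lemma val_nidx W : val W tnidx M.
Proof. exact: val_mul (val_cst _ _) (@val_ntup _). Qed.
Lemma Bpow_gt0 c : 0 < base N ^ c. Proof. by rewrite expn_gt0. Qed.

Lemma val_dig W a u c : val W a u -> val W (tdig a c) (dig N u c).
Proof.
move=> h; apply: val_mod (@val_B _) => //.
by apply: val_div h (@val_Bpow _ _); exact: Bpow_gt0.
Qed.

Lemma val_sbs W a u b v c : val W a u -> val W b v -> val W (tsbs a c b) (sbs N u c v).
Proof.
move=> ha hb; apply: val_add (val_sub ha (val_mul (val_dig c ha) (@val_Bpow _ _)))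
  (val_mul hb (@val_Bpow _ _)).
Qed.

Lemma val_av W a u y vy l : val W a u -> (forall l, val W (y l) (vy l)) ->
  val W (tav a y l) (av k1 N u vy l).
Proof. by move=> ha hy; rewrite /tav /av; case: ifP => _ //; exact: val_dig. Qed.

Lemma val_updy W y vy j b v l : (forall l, val W (y l) (vy l)) -> val W b v ->
  val W (tupdy y j b l) (updy vy j v l).
Proof. by move=> hy hb; rewrite /tupdy /updy; case: ifP. Qed.

Lemma val_nz W a u : val W a u -> val W (tnz a) (u != 0).
Proof. by move=> h; apply: val_not; apply: val_eqn h (val_cst _ _). Qed.

Lemma val_iff W a b (u v : bool) : val W a u -> val W b v -> val W (tiff a b) (u == v).
Proof. by move=> ha hb; apply: val_eq (val_eqn ha hb); case: u v {ha hb} => -[]. Qed.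

Lemma val_cz W a u : val W a u -> val W (tcz a) (cz (icl w) u).
Proof. by move=> h; apply: val_mul (val_nz h) (val_cl h). Qed.

Lemma val_ez W a b u v : val W a u -> val W b v -> val W (tez a b) (ez (iE w) u v).
Proof.
by move=> ha hb; apply: val_and (val_and (val_nz ha) (val_nz hb)) (val_E ha hb).
Qed.

Lemma val_atp W (a b : nat -> tm) (va vb : nat -> nat) : (forall l, val W (a l) (va l)) ->
  (forall l, val W (b l) (vb l)) ->
  val W (tatp a b) (atp k1 k2 (iE w) (icl w) va vb).
Proof.
move=> ha hb; apply: val_allm => l _; apply: val_and.
  apply: val_and; last exact: val_eqn (val_cz (ha l)) (val_cz (hb l)).
  exact: val_iff (val_eqn (ha l) (val_cst _ _)) (val_eqn (hb l) (val_cst _ _)).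
apply: val_allm => l' _; apply: val_and.
  exact: val_iff (val_eqn (ha l) (ha l')) (val_eqn (hb l) (hb l')).
exact: val_iff (val_ez (ha l) (ha l')) (val_ez (hb l) (hb l')).
Qed.

Definition W0 : world := ([:: M], [::]).

(** Correctness is stated for every world with the table size at level 0, since a tester is called
    under binders and inside the tables of outer levels. *)
Definition recval (trec : ttester) (rec : tester) :=
  forall W z s y z' s' y' vz vs vy vz' vs' vy', wle W0 W ->
  val W z vz -> val W s vs -> (forall l, val W (y l) (vy l)) ->
  val W z' vz' -> val W s' vs' -> (forall l, val W (y' l) (vy' l)) ->
  val W (trec z s y z' s' y') (rec vz vs vy vz' vs' vy').

Section RV.
Variables (trec : ttester) (rec : tester).
Hypothesis hrec : recval trec rec.
Variables (zP : tm) (yP : nat -> tm) (zQ : tm) (yQ : nat -> tm).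
Variables (vzP : nat) (vyP : nat -> nat) (vzQ : nat) (vyQ : nat -> nat).

Definition okctx W := [/\ wle W0 W, val W zP vzP, val W zQ vzQ,
  forall l, val W (yP l) (vyP l) & forall l, val W (yQ l) (vyQ l)].

Lemma okctx_le W W' : wle W W' -> okctx W -> okctx W'.
Proof.
move=> h [h0 h1 h2 h3 h4]; split; first exact: wle_trans h0 h.
- exact: val_le h h1.
- exact: val_le h h2.
- by move=> l; exact: val_le h (h3 l).
- by move=> l; exact: val_le h (h4 l).
Qed.

Lemma val_first W i vi : val W i vi -> val W (tfirst i) (vi %/ ntup k1 N == 0).
Proof. by move=> h; apply: val_eqn (val_div (Bpow_gt0 _) h (@val_ntup _)) (val_cst _ _). Qed.

Lemma val_Z W i vi : okctx W -> val W i vi -> val W (tZ zP zQ i) (Zi k1 N vzP vzQ vi).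
Proof. by case=> _ h1 h2 _ _ hi; apply: val_if (val_first hi) h1 h2. Qed.

Lemma val_Y W i vi l : okctx W -> val W i vi -> val W (tY yP yQ i l) (Yi k1 N vyP vyQ vi l).
Proof. by case=> _ _ _ h1 h2 hi; apply: val_if (val_first hi) (h1 l) (h2 l). Qed.

Lemma val_modt W i vi : val W i vi -> val W (tmod i tntup) (vi %% ntup k1 N).
Proof. by move=> h; apply: val_mod (Bpow_gt0 _) h (@val_ntup _). Qed.

Lemma val_cntX W g T i c h vi vh : okctx W -> tabval W g T -> val W i vi -> val W h vh ->
  val W (tcntX zP zQ g i c h) (cntX k1 N (idm w) vzP vzQ T vi c vh).
Proof.
move=> ok tv hi hh; apply: val_count (val_Z ok hi) _ => W' x u le hx.
apply: val_eqn; apply: tv => //; last exact: val_le le hh.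
exact: val_sbs (val_le le hi) hx.
Qed.

Lemma val_cntY W i j h u vi vh vu : okctx W -> val W i vi -> val W h vh -> val W u vu ->
  val W (tcntY trec zP yP zQ yQ i j h u) (cntY k1 N (idm w) rec vzP vyP vzQ vyQ vi j vh vu).
Proof.
move=> ok hi hh hu; apply: val_count (val_Z ok hi) _ => W' x u' le hx.
have ok' := okctx_le le ok; have hi' := val_le le hi; have hh' := val_le le hh.
apply: hrec; [by case: ok'|exact: val_Z|exact: val_modt| |exact: val_Z|exact: val_modt|].
- by move=> l; apply: val_updy => // l'; exact: val_Y.
- by move=> l; apply: val_updy; [move=> l'; exact: val_Y|exact: val_le le hu].
Qed.

Lemma val_same W g T i i' vi vi' : okctx W -> tabval W g T -> val W i vi -> val W i' vi' ->
  val W (tsame trec zP yP zQ yQ g i i') (vsame rec vzP vyP vzQ vyQ T vi vi').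
Proof.
move=> ok tv hi hi'; apply: val_and; first apply: val_and; first apply: val_and.
- by apply: val_eqn; apply: tv => //; exact: wle_refl.
- by apply: val_atp => l; apply: val_av => // l'; exact: val_Y.
- apply: val_allm => c _; apply: val_all (@val_nidx _) _ => W' x h le _ hx.
  by apply: val_eqn; apply: val_cntX (okctx_le le ok) (tabval_le le tv) (val_le le _) hx.
- apply: val_allm => j _; apply: val_or; first by case: ok => _ _ _ h _; exact: val_nz.
  apply: val_all (@val_nidx _) _ => W1 x h le _ hx.
  apply: val_all (@val_N w _) _ => W2 x2 u le2 _ hx2.
  have le' := wle_trans le le2.
  by apply: val_eqn;
    apply: val_cntY (okctx_le le' ok) (val_le le' _) (val_le le2 hx) (val_S hx2).
Qed.

End RV.

Lemma recval_mkeq trec rec : recval trec rec ->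
  recval (tmkeq trec) (mkeq k1 k2 N (idm w) (iE w) (icl w) rec).
Proof.
move=> hr W z s y z' s' y' vz vs vy vz' vs' vy' h0 hz hs hy hz' hs' hy'.
have ok : okctx z y z' y' vz vy vz' vy' W by split.
have [/= p1 _] := andP h0.
apply: (@val_iter w W _ _ M
  (fun T i => find (vsame rec vz vy vz' vy' T i) (iota 0 M))).
- exact: leq_trans (prefix_size p1).
- by rewrite (prefix_nth _ p1).
- move=> W' T x i g le hi sT tv hx; apply: val_min (@val_nidx _) _ => W2 x2 i2 le2 hi2 hx2.
  apply: val_same hx2 => //; first exact: okctx_le (wle_trans le le2) ok.
  - exact: tabval_le le2 tv.
  - exact: val_le le2 hx.
- by move=> T i _ _; rewrite -{2}(size_iota 0 M) find_size.
- move=> W' g le tv; apply: val_eqn; apply: tv; try exact: wle_refl.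
  + exact: val_le le hs.
  + exact: val_add (@val_ntup _) (val_le le hs').
Qed.

Lemma recval_eqv l : recval (teqv l) (eqv k1 k2 N (idm w) (iE w) (icl w) l).
Proof.
elim: l => [|l IH]; apply: recval_mkeq => //.
Qed.

End ValAlg.
End AlgTerm.

(** * Counting and digits *)

Lemma count_split (I : eqType) (P r : pred I) (C : seq I) :
  {in C, forall x, r x -> P x} ->
  count P C = count r C + count P (filter (predC r) C).
Proof.
elim: C => //= x C IH H; rewrite IH; last by move=> y hy; apply: H; rewrite inE hy orbT.
have := H x; rewrite inE eqxx => /(_ isT).
by case: (r x) => /= [->//|_]; case: (P x); lia.
Qed.

Lemma count_filter_disj (I : eqType) (q r : pred I) (C : seq I) :
  {in C, forall x, q x -> ~~ r x} -> count q (filter (predC r) C) = count q C.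
Proof.
move=> H; rewrite count_filter; apply: eq_in_count => x hx /=.
by case hq : (q x) => //=; exact: H.
Qed.

(** Induction on the total length: the class of an element that satisfies [P] lies inside [P],
    contributes equally to both counts, and is removed. *)
Lemma count_classes (I : eqType) (r : rel I) (A B : seq I) (P : pred I) :
  {in A ++ B, forall a, r a a} -> {in A ++ B &, forall a b, r a b -> r b a} ->
  {in A ++ B & &, forall a b c, r a b -> r b c -> r a c} ->
  (forall h, h \in A ++ B -> count (r h) A = count (r h) B) ->
  {in A ++ B &, forall a b, r a b -> P a = P b} ->
  count P A = count P B.
Proof.
have [n] := ubnP (size (A ++ B)); elim: n A B => // n IH A B; rewrite ltnS => sz rr rs rt rc rP.
case hP : (has P (A ++ B)); last first.
  have := negbT hP; rewrite has_cat negb_or !has_count -!eqn0Ngt => /andP[/eqP-> /eqP->//].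
have [h hh Ph] := hasP hP.
pose A' := filter (predC (r h)) A; pose B' := filter (predC (r h)) B.
have sub : {subset A' ++ B' <= A ++ B}.
  by move=> x; rewrite !mem_cat !mem_filter => /orP[]/andP[_ ->]; rewrite ?orbT.
have nr x : x \in A' ++ B' -> ~~ r h x.
  by rewrite mem_cat !mem_filter => /orP[]/andP[].
have sA : {subset A <= A ++ B} by move=> x; rewrite mem_cat => ->.
have sB : {subset B <= A ++ B} by move=> x; rewrite mem_cat => ->; rewrite orbT.
rewrite (count_split (r := r h) (C := A)); last first.
  by move=> x /sA hx hr; rewrite -(rP h x hh hx hr).
rewrite (count_split (r := r h) (C := B)); last first.
  by move=> x /sB hx hr; rewrite -(rP h x hh hx hr).
rewrite (rc h hh); congr (_ + _); apply: IH.
- rewrite -filter_cat size_filter; apply: leq_trans sz.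
  rewrite -(count_predC (r h) (A ++ B)) addnC -addn1 leq_add2l -has_count.
  by apply/hasP; exists h => //; exact: rr.
- by move=> a /sub; exact: rr.
- by move=> a b /sub ha /sub; exact: rs.
- by move=> a b c /sub ha /sub hb /sub; exact: rt.
- move=> x hx; have hx' := sub _ hx.
  rewrite !count_filter_disj; first exact: rc.
  + move=> y /sB hy rxy; apply: contra (nr _ hx) => rhy.
    by apply: (rt h y x) => //; apply: rs.
  + move=> y /sA hy rxy; apply: contra (nr _ hx) => rhy.
    by apply: (rt h y x) => //; apply: rs.
- by move=> a b /sub ha /sub; exact: rP.
Qed.

Lemma undup_map_lt (h : nat -> nat) (l : seq nat) v v' :
  v \in l -> v' \in l -> v != v' -> h v = h v' ->
  size (undup (map h l)) < size (undup l).
Proof.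
move=> hv hv' ne e.
have : size (undup (map h l)) <= size (map h (rem v (undup l))).
  apply: uniq_leq_size; first exact: undup_uniq.
  move=> x; rewrite mem_undup => /mapP[y hy ->].
  case: (eqVneq y v) => [->|ny].
    by rewrite e; apply: map_f; rewrite mem_rem_uniq ?undup_uniq // inE mem_undup eq_sym ne.
  by apply: map_f; rewrite mem_rem_uniq ?undup_uniq // inE mem_undup ny.
rewrite size_map size_rem ?mem_undup //.
by have : 0 < size (undup l); [case: (undup l) (mem_undup l v) => //; rewrite hv|lia].
Qed.

(** On [s], the function [f] factors through [g], and the factor [h] identifies two values of [g];
    so a proper refinement gains a class. *)
Lemma refine_lt (f g : nat -> nat) (s : seq nat) x y :
  {in s &, forall a b, g a = g b -> f a = f b} ->
  x \in s -> y \in s -> f x = f y -> g x != g y ->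
  size (undup (map f s)) < size (undup (map g s)).
Proof.
move=> H hx hy e ne; pose h v := f (nth 0 s (index v (map g s))).
have fh : {in s, forall a, h (g a) = f a}.
  move=> a ha; have ga : g a \in map g s by apply: map_f.
  have hi : index (g a) (map g s) < size s by rewrite -(size_map g) index_mem.
  by apply: H; rewrite ?mem_nth // -(nth_map 0 0) // nth_index.
have -> : map f s = map h (map g s) by rewrite -map_comp; apply/eq_in_map => a /fh.
by apply: undup_map_lt (map_f g hx) (map_f g hy) ne _; rewrite !fh.
Qed.

Lemma find_equiv (S : rel nat) n i i' :
  (forall a, S a a) -> (forall a b, S a b -> S b a) ->
  (forall a b c, S a b -> S b c -> S a c) -> i < n -> i' < n ->
  (find (S i) (iota 0 n) == find (S i') (iota 0 n)) = S i i'.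
Proof.
move=> sr ss st hi hi'; apply/eqP/idP => [e|h].
  have hs : has (S i) (iota 0 n) by apply/hasP; exists i; rewrite ?mem_iota.
  have hs' : has (S i') (iota 0 n) by apply/hasP; exists i'; rewrite ?mem_iota.
  by have := nth_find 0 hs; have := nth_find 0 hs'; rewrite e => h1 h2; apply: st h2 (ss _ _ h1).
apply: eq_find => x; apply/idP/idP => h'; last exact: st h h'.
by apply: st h'; apply: ss.
Qed.

Section Digits.
Variables (k1 N : nat).
Local Notation B := (base N).
Local Notation digN := (dig N).
Local Notation sbsN := (sbs N).

Lemma Bx_gt0 c : 0 < B ^ c. Proof. by rewrite expn_gt0. Qed.

Lemma dig_le i c : digN i c <= N. Proof. by rewrite -ltnS ltn_pmod. Qed.

Lemma dig_high i c c' : c <= c' -> digN i c' = (i %/ B ^ c %/ B ^ (c' - c)) %% B.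
Proof. by move=> h; rewrite -divnMA -expnD subnKC. Qed.

Lemma dig_low i c c' : c' < c -> digN i c' = digN (i %% B ^ c) c'.
Proof.
move=> h; have e x : digN x c' = (x %% B ^ c'.+1) %/ B ^ c' by rewrite /dig modn_divl -expnS.
by rewrite !e modn_dvdm // dvdn_exp2l.
Qed.

(** Separates the digits above, at and below [c], which reduces the facts about substitution to
    division with remainder. *)
Lemma sbs_eq i c u : sbsN i c u = ((i %/ B ^ c.+1) * B + u) * B ^ c + i %% B ^ c.
Proof.
rewrite /sbs -/(digN i c).
have e : i = (i %/ B ^ c.+1 * B) * B ^ c + digN i c * B ^ c + i %% B ^ c.
  by rewrite -mulnDl expnSr divnMA -divn_eq -divn_eq.
rewrite mulnDl; move: e; move: (_ * B ^ c) (digN i c * _) (_ %% _) (u * _) => p q r t e.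
by rewrite e; lia.
Qed.

Lemma sbs_div i c u : u <= N -> sbsN i c u %/ B ^ c = (i %/ B ^ c.+1) * B + u.
Proof. by move=> h; rewrite sbs_eq divnMDl ?Bx_gt0 // [_ %% _ %/ _]divn_small ?addn0 // ltn_pmod ?Bx_gt0. Qed.

Lemma sbs_mod i c u : sbsN i c u %% B ^ c = i %% B ^ c.
Proof. by rewrite sbs_eq modnMDl modn_mod. Qed.

Lemma sbs_divS i c u : u <= N -> sbsN i c u %/ B ^ c.+1 = i %/ B ^ c.+1.
Proof.
move=> h; rewrite {1}expnSr divnMA sbs_div // divnMDl // [u %/ _]divn_small ?addn0 //.
Qed.

Lemma dig_sbs i c u c' : u <= N -> digN (sbsN i c u) c' = if c' == c then u else digN i c'.
Proof.
move=> h; case: eqP => [->|ne].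
  by rewrite /dig sbs_div // modnMDl modn_small.
case: (ltnP c' c) => hc; first by rewrite (dig_low _ hc) sbs_mod -dig_low.
have hc' : c.+1 <= c' by lia.
by rewrite !(dig_high _ hc') sbs_divS.
Qed.

(** Changing an x-digit does not touch the leading digit, hence not the structure. *)
Lemma sbs_ntup i c u : c < k1 -> u <= N -> sbsN i c u %/ ntup k1 N = i %/ ntup k1 N.
Proof.
move=> hc hu; have -> : ntup k1 N = B ^ c.+1 * B ^ (k1 - c.+1) by rewrite -expnD subnKC.
by rewrite !divnMA sbs_divS.
Qed.

Lemma nidx_lt i : (i < nidx k1 N) = (i %/ ntup k1 N < 2).
Proof. by rewrite ltn_divLR ?Bx_gt0. Qed.

Lemma sbs_lt i c u : c < k1 -> u <= N -> i < nidx k1 N -> sbsN i c u < nidx k1 N.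
Proof. by move=> hc hu; rewrite !nidx_lt sbs_ntup. Qed.

Lemma dig_mod i c : c < k1 -> digN (i %% ntup k1 N) c = digN i c.
Proof. by move=> h; rewrite (dig_low i h). Qed.

End Digits.

(** * Formulas and indistinguishability of positions *)

Section Bound.
Variable V : eqType.
Implicit Types (phi psi : form V) (v : V).

(** With [nest] below, a decidable counterpart of the quantifier conditions in [requantified],
    computed along the formula instead of through its subformulas. *)
Fixpoint bnds phi v : bool :=
  match phi with
  | Equal _ _ | Edge _ _ | Color _ _ => false
  | Not a => bnds a v
  | And a b | Or a b | Imp a b => bnds a v || bnds b v
  | Quant _ y a => (v == y) || bnds a v
  end.

Fixpoint nest phi v : bool :=
  match phi with
  | Equal _ _ | Edge _ _ | Color _ _ => false
  | Not a => nest a v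
  | And a b | Or a b | Imp a b => nest a v || nest b v
  | Quant _ y a => (v == y) && bnds a v || nest a v
  end.

Lemma subform_bnds phi psi v : subform phi psi -> bnds phi v -> bnds psi v.
Proof. by elim=> //= *; apply/orP; auto. Qed.

Lemma subform_nest phi psi v : subform phi psi -> nest phi v -> nest psi v.
Proof. by elim=> //= *; apply/orP; auto. Qed.

Lemma boundP v phi : bound v phi <-> bnds phi v.
Proof.
split=> [[q [psi s]]|]; first by apply: subform_bnds s _; rewrite /= eqxx.
elim: phi => //=.
- by move=> a IH /IH[q [psi s]]; exists q, psi; constructor.
- by move=> a IHa b IHb /orP[/IHa|/IHb] [q [psi s]]; exists q, psi;
    [apply: subform_andl|apply: subform_andr].
- by move=> a IHa b IHb /orP[/IHa|/IHb] [q [psi s]]; exists q, psi;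
    [apply: subform_orl|apply: subform_orr].
- by move=> a IHa b IHb /orP[/IHa|/IHb] [q [psi s]]; exists q, psi;
    [apply: subform_impl|apply: subform_impr].
- move=> q y a IH /orP[/eqP->|/IH[q' [psi s]]]; first by exists q, a; constructor.
  by exists q', psi; constructor.
Qed.

Lemma nestP v phi : (exists q psi, subform (Quant q v psi) phi /\
   exists q' chi, subform (Quant q' v chi) psi) <-> nest phi v.
Proof.
split=> [[q [psi [s b]]]|].
  apply: subform_nest s _; rewrite /= eqxx /=; apply/orP; left.
  by apply/boundP; case: b => q' [chi c]; exists q', chi.
elim: phi => //=.
- by move=> a IH /IH[q [psi [s b]]]; exists q, psi; split=> //; constructor.
- by move=> a IHa b IHb /orP[/IHa|/IHb] [q [psi [s c]]]; exists q, psi; split=> //;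
    [apply: subform_andl|apply: subform_andr].
- by move=> a IHa b IHb /orP[/IHa|/IHb] [q [psi [s c]]]; exists q, psi; split=> //;
    [apply: subform_orl|apply: subform_orr].
- by move=> a IHa b IHb /orP[/IHa|/IHb] [q [psi [s c]]]; exists q, psi; split=> //;
    [apply: subform_impl|apply: subform_impr].
- move=> q y a IH /orP[/andP[/eqP<- /boundP b]|/IH[q' [psi [s c]]]].
    by exists q, a; split=> //; constructor.
  by exists q', psi; split=> //; constructor.
Qed.

End Bound.

Section Logic.
Variables (k1 k2 : nat).
Local Notation var := (var k1 k2).
Local Notation form := (form var).
Variables (N : nat) (dm : nat -> seq nat) (E : rel nat) (col0 : nat -> nat).
Hypothesis dmP : forall z u, u \in dm z -> 0 < u <= N.
Implicit Types (phi psi : form) (D : pred var) (x v : var).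

(** Formulas that may be evaluated at positions with domain [D]. Unlike in
    [C_equiv], the defined y's need not all be free. *)
Definition good D phi :=
  [/\ forall v, free phi v -> D v, forall j : 'I_k2, D (inr j) -> ~~ bnds phi (inr j)
    & forall j : 'I_k2, ~~ nest phi (inr j)].

Lemma good_ext D D' phi : D =1 D' -> good D phi -> good D' phi.
Proof. by move=> e [h1 h2 h3]; split=> // [v /h1|j]; rewrite -e //; exact: h2. Qed.

Definition upd (p : var -> nat) x u : var -> nat := fun y => if y == x then u else p y.

Fixpoint nsat (z : nat) (p : var -> nat) phi : bool :=
  match phi with
  | Equal x y => (p x != 0) && (p x == p y)
  | Edge x y => ez E (p x) (p y)
  | Color c x => (p x != 0) && (col0 (p x) == c)
  | Not a => ~~ nsat z p a
  | And a b => nsat z p a && nsat z p b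
  | Or a b => nsat z p a || nsat z p b
  | Imp a b => nsat z p a ==> nsat z p b
  | Quant Forall x a => all (fun u => nsat z (upd p x u) a) (dm z)
  | Quant Exists x a => has (fun u => nsat z (upd p x u) a) (dm z)
  | Quant (AtLeast n) x a => n <= count (fun u => nsat z (upd p x u) a) (dm z)
  end.

Lemma upd_ext p p' x u : p =1 p' -> upd p x u =1 upd p' x u.
Proof. by move=> e y; rewrite /upd e. Qed.

Lemma nsat_ext z p p' phi : p =1 p' -> nsat z p phi = nsat z p' phi.
Proof.
elim: phi p p' => //=.
- by move=> x y p p' e; rewrite !e.
- by move=> x y p p' e; rewrite !e.
- by move=> c x p p' e; rewrite !e.
- by move=> a IH p p' e; rewrite (IH p p' e).
- by move=> a IHa b IHb p p' e; rewrite (IHa p p' e) (IHb p p' e).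
- by move=> a IHa b IHb p p' e; rewrite (IHa p p' e) (IHb p p' e).
- by move=> a IHa b IHb p p' e; rewrite (IHa p p' e) (IHb p p' e).
- move=> q x a IH p p' e.
  have H : (fun u => nsat z (upd p x u) a) =1 (fun u => nsat z (upd p' x u) a).
    by move=> u; apply: IH; exact: upd_ext.
  by case: q => [||n]; [exact: eq_all|exact: eq_has|rewrite (eq_count H)].
Qed.

Definition pos := (nat * (var -> nat))%type.
Definition pdom (a : pos) : pred var := fun v => a.2 v != 0.
Definition psat (a : pos) phi := nsat a.1 a.2 phi.
Definition approx (a b : pos) :=
  pdom a =1 pdom b /\ forall phi, good (pdom a) phi -> psat a phi = psat b phi.

Lemma approx_sym a b : approx a b -> approx b a.
Proof.
by move=> [h1 h2]; split=> [v|phi g]; rewrite ?h1 // h2 //; apply: good_ext g => v.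
Qed.
Lemma approx_trans a b c : approx a b -> approx b c -> approx a c.
Proof.
move=> [h1 h2] [h3 h4]; split=> [v|phi g]; first by rewrite h1.
by rewrite h2 // h4 //; apply: good_ext g.
Qed.

Lemma approx_ext a b a' b' : a.1 = a'.1 -> a.2 =1 a'.2 -> b.1 = b'.1 -> b.2 =1 b'.2 ->
  approx a b -> approx a' b'.
Proof.
move=> e1 e2 e3 e4 [h1 h2]; split=> [v|phi g].
  by have := h1 v; rewrite /pdom e2 e4.
rewrite /psat -e1 -e3 -(nsat_ext _ _ e2) -(nsat_ext _ _ e4); apply: h2.
by apply: good_ext g => v; rewrite /pdom e2.
Qed.

Variable v0 : var.

(** The syntax has no truth constant. If [v0] is undefined, it may not occur free, but then
    quantifying it is permitted, even if it is a y. *)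
Definition tru D : form := if D v0 then Equal v0 v0 else Quant Defs.Forall v0 (Equal v0 v0).

Lemma tru_good D : good D (tru D).
Proof.
rewrite /tru; case: ifP => h; split=> //=.
- by move=> v; rewrite /= orbb => /eqP->.
- by move=> v; rewrite /= /predD /= orbb => /andP[/negbTE->].
- by move=> j Dj; rewrite orbF; apply: contraTneq Dj => ->; rewrite h.
- by move=> j; rewrite andbF.
Qed.

Lemma tru_sat a : psat a (tru (pdom a)).
Proof.
rewrite /tru /psat; case: ifP => h /=; first by rewrite eqxx andbT.
by apply/allP => u /dmP /andP[u0 _]; rewrite /upd eqxx eqxx andbT -lt0n.
Qed.

Lemma good_not D phi : good D phi -> good D (Not phi). Proof. by case. Qed.
Lemma good_and D phi psi : good D phi -> good D psi -> good D (And phi psi).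
Proof.
move=> [a1 a2 a3] [b1 b2 b3]; split=> /=.
- by move=> v /orP[/a1|/b1].
- by move=> j h; rewrite negb_or a2 // b2.
- by move=> j; rewrite negb_or a3 b3.
Qed.
Lemma good_or D phi psi : good D phi -> good D psi -> good D (Or phi psi).
Proof. exact: good_and. Qed.

Lemma good_andE D phi psi : good D (And phi psi) -> good D phi /\ good D psi.
Proof.
move=> [g1 g2 g3]; split; split=> [v hv|j Dj|j]; try (by apply: g1; rewrite /= hv ?orbT);
try (by have := g2 j Dj; rewrite /= negb_or => /andP[]);
by have := g3 j; rewrite /= negb_or => /andP[].
Qed.

(** Excluded middle yields a formula on which the two positions differ; negating it if necessary
    makes it true at the first. *)
Lemma separate a b : pdom a =1 pdom b -> ~ approx a b ->
  exists phi, [/\ good (pdom a) phi, psat a phi & ~~ psat b phi].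
Proof.
move=> e na; apply: NNPP => H; apply: na; split=> // phi g.
case ha : (psat a phi); case hb : (psat b phi) => //; exfalso; apply: H.
- by exists phi; rewrite ha hb.
- by exists (Not phi); split; [exact: good_not|rewrite /psat /= -/(psat a phi) ha
    |rewrite /psat /= -/(psat b phi) hb].
Qed.

(** The formula is a disjunction, over the positions in [P], of conjunctions of formulas that
    separate such a position from each position outside [P]. *)
Lemma definable (I : eqType) (F : I -> pos) (s : seq I) D (P : pred I) :
  (forall i, i \in s -> pdom (F i) =1 D) ->
  (forall i j, i \in s -> j \in s -> approx (F i) (F j) -> P i = P j) ->
  exists phi, good D phi /\ forall i, i \in s -> psat (F i) phi = P i.
Proof.
move=> hD hP.
have trus i : i \in s -> psat (F i) (tru D).
  move=> hi; rewrite /tru -(hD i hi); exact: tru_sat.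
(* One conjunction: it holds at position i and fails at all listed positions outside [P]. *)
have S1 i (t : seq I) : i \in s -> P i -> {subset t <= s} -> exists phi, [/\ good D phi,
    psat (F i) phi & forall j, j \in t -> ~~ P j -> ~~ psat (F j) phi].
  move=> hi Pi; elim: t => [|j t IH] st.
    by exists (tru D); split=> //; [exact: tru_good|exact: trus].
  have st' : {subset t <= s} by move=> x hx; apply: st; rewrite inE hx orbT.
  have [phi [g p n]] := IH st'.
  have hj : j \in s by apply: st; rewrite inE eqxx.
  case Pj : (P j).
    by exists phi; split=> // x; rewrite inE => /orP[/eqP->|/n//]; rewrite Pj.
  have [||psi [g' p' n']] := @separate (F i) (F j).
  - by move=> v; rewrite !hD.
  - by move=> ap; have := hP _ _ hi hj ap; rewrite Pi Pj.
  exists (And phi psi); split.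
  - by apply: good_and g _; apply: good_ext g'; exact: hD.
  - by rewrite /psat /= -/(psat _ phi) -/(psat _ psi) p.
  - move=> x; rewrite inE /psat /= -/(psat _ phi) -/(psat _ psi) negb_and.
    by case/orP=> [/eqP->|hx nx]; rewrite ?n' ?orbT // n.
(* The disjunction of these conjunctions over the listed positions in [P]. *)
have S2 (t : seq I) : {subset t <= s} -> exists phi, [/\ good D phi,
    forall i, i \in t -> P i -> psat (F i) phi &
    forall j, j \in s -> ~~ P j -> ~~ psat (F j) phi].
  elim: t => [|i t IH] st.
    exists (Not (tru D)); split=> //; first by apply: good_not; exact: tru_good.
    by move=> j hj _; rewrite /psat /= negbK; exact: trus.
  have st' : {subset t <= s} by move=> x hx; apply: st; rewrite inE hx orbT.
  have [phi [g p n]] := IH st'.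
  have hi : i \in s by apply: st; rewrite inE eqxx.
  case Pi : (P i); last first.
    by exists phi; split=> // x; rewrite inE => /orP[/eqP->|/p//]; rewrite Pi.
  have [psi [g' p' n']] := S1 i s hi Pi (fun _ h => h).
  exists (Or phi psi); split; first exact: good_or.
  - move=> x; rewrite inE /psat /= -/(psat _ phi) -/(psat _ psi).
    by case/orP=> [/eqP-> _|hx Px]; rewrite ?p' ?orbT // p.
  - move=> x hx Px; rewrite /psat /= -/(psat _ phi) -/(psat _ psi) negb_or.
    by rewrite n // n'.
have [phi [g p n]] := S2 s (fun _ h => h); exists phi; split=> // i hi.
by case Pi : (P i); [exact: p|apply/negbTE/n; rewrite ?Pi].
Qed.

Definition move_pos (a : pos) x u : pos := (a.1, upd a.2 x u).
(** The difference between the two kinds of variables: an x can be reassigned at any time, a y only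
    as long as it is undefined. *)
Definition movable D x := if x is inr _ then ~~ D x else true.

Lemma pdom_move a x u : 0 < u -> pdom (move_pos a x u) =1 (fun v => (v == x) || pdom a v).
Proof. by move=> h v; rewrite /pdom /= /upd; case: ifP => //= _; rewrite -lt0n h. Qed.

Lemma good_quant D q x phi : movable D x -> good (fun v => (v == x) || D v) phi ->
  good D (Quant q x phi).
Proof.
move=> m [g1 g2 g3]; split=> /=.
- by move=> v /andP[/= nv /g1]; rewrite (negbTE nv).
- move=> j Dj; rewrite negb_or g2 ?Dj ?orbT // andbT.
  by apply: contraTneq m => <-; rewrite /= Dj.
- move=> j; rewrite negb_or g3 andbT negb_and.
  by case: eqP => //= e; apply: g2; rewrite e eqxx.
Qed.

Lemma good_quantE D q x phi : good D (Quant q x phi) ->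
  movable D x /\ good (fun v => (v == x) || D v) phi.
Proof.
move=> [g1 g2 g3]; split.
  case: x g1 g2 g3 => // j g1 g2 g3 /=; apply/negP => Dj.
  by have := g2 _ Dj; rewrite /= eqxx.
split.
- by move=> v hv; case: eqP => //= /eqP nv; apply: g1; rewrite /= /predD /= nv.
- move=> j; case: eqP => [e|_] /=.
    by move=> _; have := g3 j; rewrite /= e eqxx /= negb_or => /andP[].
  by move=> Dj; have := g2 _ Dj; rewrite /= negb_or => /andP[].
- by move=> j; have := g3 j; rewrite /= negb_or => /andP[].
Qed.

(** The extensions of [a] and [b] form one finite family, tagged by their origin. One formula
    defines [P] on the first half and [Q] on the second, and the statement that at least m
    extensions satisfy it is transferred from [a] to [b] and back, with m the count on either
    side. *)
Lemma move_count a b x (P Q : pred nat) : approx a b -> movable (pdom a) x ->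
  (forall c d (u v : nat), u \in dm (if c then a.1 else b.1) -> v \in dm (if d then a.1 else b.1) ->
     approx (move_pos (if c then a else b) x u) (move_pos (if d then a else b) x v) ->
     (if c then P u else Q u) = (if d then P v else Q v)) ->
  count P (dm a.1) = count Q (dm b.1).
Proof.
move=> ab mx H.
pose F (i : bool * nat) := move_pos (if i.1 then a else b) x i.2.
pose s := [seq (true, u) | u <- dm a.1] ++ [seq (false, u) | u <- dm b.1].
have sP i : i \in s -> i.2 \in dm (if i.1 then a.1 else b.1).
  by rewrite mem_cat => /orP[]/mapP[u hu ->].
have [| |phi [g hphi]] := @definable _ F s (fun v => (v == x) || pdom a v)
  (fun i => if i.1 then P i.2 else Q i.2).
- move=> i /sP hi v; rewrite /F pdom_move; last by have /andP[] := dmP hi.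
  by case: i.1 => //; case: ab => <-.
- by move=> [c u] [d v] /sP hi /sP hj; apply: H.
have e1 : count P (dm a.1) = count (fun u => nsat a.1 (upd a.2 x u) phi) (dm a.1).
  apply: eq_in_count => u hu; rewrite -[RHS]/(psat (F (true, u)) phi) hphi //.
  by rewrite mem_cat map_f.
have e2 : count Q (dm b.1) = count (fun u => nsat b.1 (upd b.2 x u) phi) (dm b.1).
  apply: eq_in_count => u hu; rewrite -[RHS]/(psat (F (false, u)) phi) hphi //.
  by rewrite mem_cat map_f ?orbT.
rewrite e1 e2; apply/eqP; rewrite eqn_leq; apply/andP; split.
- by have := ab.2 (Quant (AtLeast (count (fun u => nsat a.1 (upd a.2 x u) phi) (dm a.1))) x phi)
    (good_quant _ mx g); rewrite /psat /= leqnn => <-.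
- by have := ab.2 (Quant (AtLeast (count (fun u => nsat b.1 (upd b.2 x u) phi) (dm b.1))) x phi)
    (good_quant _ mx g); rewrite /psat /= leqnn => ->.
Qed.

(** The negation is counted for [Forall], which says that no extension satisfies it. *)
Lemma quant_transfer a b q x phi :
  (forall psi, psi = phi \/ psi = Not phi ->
   count (fun u => psat (move_pos a x u) psi) (dm a.1) =
   count (fun u => psat (move_pos b x u) psi) (dm b.1)) ->
  psat a (Quant q x phi) = psat b (Quant q x phi).
Proof.
move=> H; have h1 := H phi (or_introl erefl); have h2 := H (Not phi) (or_intror erefl).
rewrite /psat /=; case: q => [||n].
- have e c : all (fun u => nsat c.1 (upd c.2 x u) phi) (dm c.1) =
    (count (fun u => psat (move_pos c x u) (Not phi)) (dm c.1) == 0).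
    rewrite -[all _ _]negbK -has_predC has_count -eqn0Ngt.
    by congr (_ == _); apply: eq_count => u.
  by rewrite !e h2.
- by rewrite !has_count; congr (_ < _).
- by congr (_ <= _).
Qed.

End Logic.

(** * Correctness of the refinement algorithm *)

Section Correct.
Variables (k1 k2 N : nat) (dm : nat -> seq nat) (E : rel nat) (cl col0 : nat -> nat).
Local Notation var := (var k1 k2).
Hypothesis dmP : forall z u, u \in dm z -> 0 < u <= N.
Hypothesis clP : forall x y, 0 < x <= N -> 0 < y <= N ->
  (cl x == cl y) = (col0 x == col0 y).
Variable v0 : var.
Local Notation approx := (approx dm E col0).
Local Notation psatN := (psat dm E col0).
Local Notation ntup := (ntup k1 N).
Local Notation nidxN := (nidx k1 N).
Local Notation atp := (atp k1 k2 E cl).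
Local Notation sbsN := (sbs N).
Local Notation avN := (av k1 N).

Definition vidx (v : var) : nat := match v with inl c => c | inr j => k1 + j end.
Definition posn z s y : pos k1 k2 := (z, fun v => avN s y (vidx v)).

Lemma vidx_lt v : vidx v < k1 + k2.
Proof. by case: v => x /=; [apply: ltn_addr|rewrite ltn_add2l]. Qed.

Lemma vidx_surj l : l < k1 + k2 -> exists v, vidx v = l.
Proof.
move=> h; case: (ltnP l k1) => hl; first by exists (inl (Ordinal hl)).
have h2 : l - k1 < k2 by lia.
by exists (inr (Ordinal h2)); rewrite /= subnKC.
Qed.

Lemma av_inl s y (c : 'I_k1) : avN s y (vidx (inl c)) = dig N s c.
Proof. by rewrite /av /= ltn_ord. Qed.
Lemma av_inr s y (j : 'I_k2) : avN s y (vidx (inr j)) = y j.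
Proof. by rewrite /av /= ltnNge leq_addr /= addKn. Qed.

Lemma atpP (a b : nat -> nat) : reflect
  (forall l l', l < k1 + k2 -> l' < k1 + k2 ->
   [/\ (a l == 0) = (b l == 0), cz cl (a l) = cz cl (b l), (a l == a l') = (b l == b l')
     & ez E (a l) (a l') = ez E (b l) (b l')]) (atp a b).
Proof.
apply: (iffP idP) => [/allP h l l' hl hl'|h].
  have := h l; rewrite mem_iota add0n => /(_ hl)/andP[/andP[/eqP h1 /eqP h2] /allP h3].
  by have := h3 l'; rewrite mem_iota add0n => /(_ hl')/andP[/eqP h4 /eqP h5].
apply/allP => l; rewrite mem_iota add0n => /= hl.
have [h1 h2 _ _] := h l l hl hl; rewrite h1 h2 !eqxx /=.
apply/allP => l'; rewrite mem_iota add0n => /= hl'.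
by have [_ _ h3 h4] := h l l' hl hl'; rewrite h3 h4 !eqxx.
Qed.

(** Domains are compared first; on defined variables every component of the atomic type is expressed
    by an atomic formula. *)
Lemma approx_atp z s y z' s' y' :
  (forall j, j < k2 -> y j <= N) -> (forall j, j < k2 -> y' j <= N) ->
  approx (posn z s y) (posn z' s' y') -> atp (avN s y) (avN s' y').
Proof.
move=> yN yN' [hd hs]; apply/atpP => l l' /vidx_surj[v <-] /vidx_surj[v' <-].
have le v1 : avN s y (vidx v1) <= N.
  by case: v1 => x; rewrite ?av_inl ?av_inr ?dig_le ?yN.
have le' v1 : avN s' y' (vidx v1) <= N.
  by case: v1 => x; rewrite ?av_inl ?av_inr ?dig_le ?yN'.
have e0 v1 : (avN s y (vidx v1) == 0) = (avN s' y' (vidx v1) == 0).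
  by have := hd v1; rewrite /pdom /=; do 2 case: (_ == 0).
split=> //.
- rewrite /cz e0; case: eqP => //= /eqP n0; rewrite !mul1n; apply/eqP.
  rewrite clP ?le ?le' ?lt0n ?e0 ?n0 //.
  have := hs (Color (col0 (avN s y (vidx v))) v); rewrite /psat /= e0 n0 eqxx /= eq_sym.
  move=> <- //; split=> // v1 /= /eqP->; by rewrite /pdom /= e0.
- case: (eqVneq (avN s y (vidx v)) 0) => [z1|n1].
    rewrite z1; have := e0 v; rewrite z1 eqxx => /esym/eqP->.
    by rewrite !(eq_sym 0) e0.
  have := hs (Equal v v'); rewrite /psat /= -e0 (negbTE n1) /=.
  case: (eqVneq (avN s y (vidx v')) 0) => [z2|n2].
    have := e0 v'; rewrite z2 eqxx => /esym/eqP->; by rewrite -e0.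
  by move=> -> //; split=> // v1 /= /orP[]/eqP->; rewrite /pdom /=.
- rewrite /ez -!e0; case: eqP => //= n1; case: eqP => //= n2.
  have := hs (Edge v v'); rewrite /psat /= /ez -!e0.
  move/eqP/negbTE: n1 => n1; move/eqP/negbTE: n2 => n2; rewrite n1 n2 /=.
  by move=> -> //; split=> // v1 /= /orP[]/eqP->; rewrite /pdom /= ?n1 ?n2.
Qed.

(** * One level of the recursion: stable partition and logical equivalence *)

Section Level.
Variables (rec : tester) (zP : nat) (yP : nat -> nat) (zQ : nat) (yQ : nat -> nat).
Hypotheses (yPN : forall j, j < k2 -> yP j <= N) (yQN : forall j, j < k2 -> yQ j <= N).
Hypothesis ydom : forall j, j < k2 -> (yP j == 0) = (yQ j == 0).
Local Notation Z := (Zi k1 N zP zQ).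
Local Notation Y := (Yi k1 N yP yQ).
Local Notation sameN := (same k1 k2 N dm E cl rec zP yP zQ yQ).
Local Notation rstep := (rstep k1 k2 N dm E cl rec zP yP zQ yQ).

Definition posi i := posn (Z i) i (Y i).
Definition posu i j u := posn (Z i) (i %% ntup) (updy (Y i) j u).

Hypothesis recP : forall j i u h v, j < k2 -> yP j = 0 -> i < nidxN -> h < nidxN ->
  0 < u <= N -> 0 < v <= N ->
  rec (Z i) (i %% ntup) (updy (Y i) j u) (Z h) (h %% ntup) (updy (Y h) j v)
  <-> approx (posu i j u) (posu h j v).

Lemma Y_le i j : j < k2 -> Y i j <= N.
Proof. by move=> h; rewrite /Yi; case: ifP => _; [exact: yPN|exact: yQN]. Qed.

Lemma Y_dom i j : j < k2 -> (Y i j == 0) = (yP j == 0).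
Proof. by move=> h; rewrite /Yi; case: ifP => _ //; rewrite ydom. Qed.

Lemma posi_sbs i (c : 'I_k1) u : u <= N ->
  (posi (sbsN i c u)).1 = (posi i).1 /\
  (posi (sbsN i c u)).2 =1 (move_pos (posi i) (inl c) u).2.
Proof.
move=> hu; have e := sbs_ntup i (ltn_ord c) hu.
split; first by rewrite /= /Zi e.
move=> v; rewrite /= /upd; case: v => [c'|j].
  by rewrite !av_inl dig_sbs.
by rewrite !av_inr /= /Yi e.
Qed.

Lemma posi_posu i (j : 'I_k2) u :
  (posu i j u).1 = (posi i).1 /\ (posu i j u).2 =1 (move_pos (posi i) (inr j) u).2.
Proof.
split=> // v; rewrite /= /upd; case: v => [c|j'].
  by rewrite !av_inl dig_mod.
by rewrite !av_inr /updy.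
Qed.

Lemma same_refl T i : sameN T i i.
Proof.
rewrite /same eqxx /=; apply/andP; split; last first.
  apply/allP => j _; apply/orP; right; apply/allP => h _; apply/allP => u _; exact: eqxx.
apply/andP; split; first by apply/atpP.
by apply/allP => c _; apply/allP => h _; exact: eqxx.
Qed.

Lemma same_sym T i i' : sameN T i i' -> sameN T i' i.
Proof.
move=> /andP[/andP[/andP[/eqP h1 /atpP h2] /allP h3] /allP h4].
apply/andP; split; last first.
  apply/allP => j /h4 /orP[->//|/allP h]; apply/orP; right.
  by apply/allP => x /h /allP h'; apply/allP => u /h'; rewrite eq_sym.
apply/andP; split; last first.
  by apply/allP => c /h3 /allP h; apply/allP => x /h; rewrite eq_sym.
by rewrite h1 eqxx /=; apply/atpP => l l' hl hl'; have [-> -> -> ->] := h2 _ _ hl hl'.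
Qed.

Lemma same_trans T i i' i'' : sameN T i i' -> sameN T i' i'' -> sameN T i i''.
Proof.
move=> /andP[/andP[/andP[/eqP h1 /atpP h2] /allP h3] /allP h4].
move=> /andP[/andP[/andP[/eqP g1 /atpP g2] /allP g3] /allP g4].
apply/andP; split; last first.
  apply/allP => j hj; have := h4 _ hj; have := g4 _ hj.
  case/orP=> [->//|/allP g] /orP[->//|/allP h]; apply/orP; right.
  apply/allP => x hx; have /allP g' := g _ hx; have /allP h' := h _ hx.
  by apply/allP => u hu; have /eqP-> := h' _ hu; exact: g'.
apply/andP; split; last first.
  apply/allP => c hc; have /allP g := g3 _ hc; have /allP h := h3 _ hc.
  by apply/allP => x hx; have /eqP-> := h _ hx; exact: g.
rewrite h1 g1 eqxx /=; apply/atpP => l l' hl hl'.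
by have [-> -> -> ->] := h2 _ _ hl hl'; exact: g2.
Qed.

Definition Tr r := iter r rstep (nseq nidxN 0).
Definition tv r i := nth 0 (Tr r) i.

Lemma tvS r i i' : i < nidxN -> i' < nidxN -> (tv r.+1 i == tv r.+1 i') = sameN (Tr r) i i'.
Proof.
move=> hi hi'; rewrite /tv /= !nth_mkseq //; apply: find_equiv => //.
- exact: same_refl.
- exact: same_sym.
- exact: same_trans.
Qed.

Lemma tv_refine r i i' : i < nidxN -> i' < nidxN -> tv r.+1 i = tv r.+1 i' -> tv r i = tv r i'.
Proof.
by move=> hi hi' /eqP; rewrite tvS // => /andP[/andP[/andP[/eqP]]].
Qed.

(** No round separates indistinguishable positions. By [move_count], they have equal counts for
    every property that is invariant under indistinguishability of the extensions. The previous
    table has such properties by induction, the recursive test by [recP]. *)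
Lemma approx_tv r i i' : i < nidxN -> i' < nidxN -> approx (posi i) (posi i') ->
  tv r i = tv r i'.
Proof.
elim: r i i' => [|r IH] i i' hi hi' ap.
  by rewrite /tv /= !nth_nseq hi hi'.
apply/eqP; rewrite tvS //; apply/andP; split; first apply/andP; first split.
- apply/andP; split; first by rewrite -[nth 0 _ i]/(tv r i) (IH i i').
  by apply: approx_atp ap => j; exact: Y_le.
- apply/allP => c; rewrite mem_iota add0n => /= hc; apply/allP => h; rewrite mem_iota /= => hh.
  pose co : 'I_k1 := Ordinal hc.
  apply/eqP; apply: (move_count dmP v0 (x := inl co) ap) => // b d u v hu hv ap'.
  have hu' : 0 < u <= N by apply: dmP hu.
  have hv' : 0 < v <= N by apply: dmP hv.
  have : tv r (sbsN (if b then i else i') c u) = tv r (sbsN (if d then i else i') c v).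
    have [a1 a2] := @posi_sbs (if b then i else i') co u (proj2 (andP hu')).
    have [b1 b2] := @posi_sbs (if d then i else i') co v (proj2 (andP hv')).
    apply: IH.
    - by apply: sbs_lt => //; [case/andP: hu'|case: (b)].
    - by apply: sbs_lt => //; [case/andP: hv'|case: (d)].
    apply: approx_ext ap'.
    - by rewrite a1; case: (b).
    - by move=> x; rewrite a2; case: (b).
    - by rewrite b1; case: (d).
    - by move=> x; rewrite b2; case: (d).
  by rewrite /tv; case: (b); case: (d) => ->.
- apply/allP => j; rewrite mem_iota add0n => /= hj.
  case: eqP => //= yj; apply/allP => h; rewrite mem_iota /= => hh.
  apply/allP => u; rewrite mem_iota /= add0n => hu.
  pose jo : 'I_k2 := Ordinal hj.
  apply/eqP; apply: (move_count dmP v0 (x := inr jo) ap).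
    have e : (posi i).2 (inr jo) = Y i j by apply: av_inr.
    by rewrite /movable /pdom e Y_dom // yj.
  move=> b d u1 u2 hu1 hu2 ap'.
  have hu1' := dmP hu1; have hu2' := dmP hu2.
  have hib : (if b then i else i') < nidxN by case: (b).
  have hid : (if d then i else i') < nidxN by case: (d).
  have R1 := @recP j (if b then i else i') u1 h u.+1 hj yj hib hh hu1' hu.
  have R2 := @recP j (if d then i else i') u2 h u.+1 hj yj hid hh hu2' hu.
  have [a1 a2] := @posi_posu (if b then i else i') jo u1.
  have [b1 b2] := @posi_posu (if d then i else i') jo u2.
  have {}ap' : approx (posu (if b then i else i') j u1) (posu (if d then i else i') j u2).
    apply: approx_ext ap'.
    - by rewrite a1; case: (b).
    - by move=> x; rewrite a2; case: (b).
    - by rewrite b1; case: (d).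
    - by move=> x; rewrite b2; case: (d).
  have : rec (Z (if b then i else i')) ((if b then i else i') %% ntup)
      (updy (Y (if b then i else i')) j u1) (Z h) (h %% ntup) (updy (Y h) j u.+1) =
    rec (Z (if d then i else i')) ((if d then i else i') %% ntup)
      (updy (Y (if d then i else i')) j u2) (Z h) (h %% ntup) (updy (Y h) j u.+1).
    apply/idP/idP => [/R1 x|/R2 x].
    - by apply/R2; apply: approx_trans x; apply: approx_sym.
    - by apply/R1; apply: approx_trans x.
  by case: (b); case: (d).
Qed.

Definition stable r := forall i i', i < nidxN -> i' < nidxN -> tv r i = tv r i' ->
  tv r.+1 i = tv r.+1 i'.

(** A round uses the table only through the partition that it induces, so a stable round stays
    stable. *)
Lemma same_part T T' i i' : i < nidxN -> i' < nidxN ->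
  (forall a b, a < nidxN -> b < nidxN -> (nth 0 T a == nth 0 T b) = (nth 0 T' a == nth 0 T' b)) ->
  sameN T i i' = sameN T' i i'.
Proof.
move=> hi hi' H; rewrite /same H //; congr (_ && _ && _ && _).
apply: eq_in_all => c; rewrite mem_iota add0n => /= hc.
apply: eq_in_all => h; rewrite mem_iota add0n => /= hh.
have e a : a < nidxN -> cntX k1 N dm zP zQ T a c h = cntX k1 N dm zP zQ T' a c h.
  move=> ha; apply: eq_in_count => u /dmP/andP[_ hu]; apply: H => //.
  exact: sbs_lt.
by rewrite !e.
Qed.

Lemma stableS r : stable r -> stable r.+1.
Proof.
move=> st i i' hi hi' /eqP e; apply/eqP; move: e; rewrite !tvS //.
rewrite (@same_part (Tr r.+1) (Tr r)) // => a b ha hb.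
by apply/eqP/eqP; [exact: tv_refine|exact: st].
Qed.

(** Each round that is not stable adds a class, and there are at most as many classes as indices. *)
Lemma stable_nidx : stable nidxN.
Proof.
have H r : (exists2 r', r' <= r & stable r') \/
    r < size (undup [seq tv r.+1 i | i <- iota 0 nidxN]).
  elim: r => [|r [[r' le st]|IH]].
  - case: (classic (stable 0)) => [st|ns]; first by left; exists 0.
    right; have n0 : 0 < nidxN by rewrite /nidx muln_gt0 Bx_gt0.
    have : tv 1 0 \in undup [seq tv 1 i | i <- iota 0 nidxN].
      by rewrite mem_undup map_f // mem_iota.
    by case: (undup _).
  - by left; exists r' => //; apply: leq_trans le _.
  case: (classic (stable r.+1)) => [st|ns]; first by left; exists r.+1.
  right; apply: leq_ltn_trans IH _.
  have [i [i' [hi hi' e ne]]] : exists i i', [/\ i < nidxN, i' < nidxN,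
     tv r.+1 i = tv r.+1 i' & tv r.+2 i <> tv r.+2 i'].
    apply: NNPP => X; apply: ns => i i' hi hi' e; apply: NNPP => ne; apply: X.
    by exists i, i'.
  apply: (@refine_lt _ _ _ i i') => //; rewrite ?mem_iota //.
  - by move=> a b; rewrite !mem_iota => ha hb; exact: tv_refine.
  - by apply/eqP.
have [[r le st]|] := H nidxN.
  have Hs : forall d, stable (r + d) by elim=> [|d IH]; rewrite ?addn0 // addnS; exact: stableS.
  by rewrite -(subnKC le); exact: Hs.
move=> lt; exfalso.
have : size (undup [seq tv nidxN.+1 i | i <- iota 0 nidxN]) <= nidxN.
  by apply: leq_trans (size_undup _) _; rewrite size_map size_iota.
by lia.
Qed.

(** Induction on the formula, for all pairs in a common class. For a quantified x, the extensions
    are again indices, and the induction hypothesis applies to their classes. For a quantified y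
    they are classified by the recursive test, which already decides agreement on the body. *)
Lemma bisim i i' phi : i < nidxN -> i' < nidxN -> tv nidxN i = tv nidxN i' ->
  good (pdom (posi i)) phi -> psatN (posi i) phi = psatN (posi i') phi.
Proof.
have SM a b : a < nidxN -> b < nidxN -> tv nidxN a = tv nidxN b -> sameN (Tr nidxN) a b.
  by move=> ha hb e; rewrite -tvS //; apply/eqP; apply: stable_nidx.
elim: phi i i' => [x y|x y|c x|a IH|a IHa b IHb|a IHa b IHb|a IHa b IHb|q x a IH]
  i i' hi hi' e g; have /andP[/andP[/andP[_ /atpP at_] /allP sX] /allP sY] := SM _ _ hi hi' e;
  have atv v v' := at_ _ _ (vidx_lt v) (vidx_lt v').
- by rewrite /psat /=; have [-> _ -> _] := atv x y.
- by rewrite /psat /=; have [_ _ _ ->] := atv x y.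
- rewrite /psat /=; have [e0 ec _ _] := atv x x; rewrite -e0.
  case: eqP => //= /eqP n0; apply/eqP/eqP => <-; apply/eqP.
  + move: ec; rewrite /cz -e0 n0 !mul1n => /esym/eqP; rewrite clP //.
    * by rewrite lt0n -e0 n0 /=; case: (x) => v; rewrite ?av_inl ?av_inr ?dig_le ?Y_le.
    * by rewrite lt0n n0 /=; case: (x) => v; rewrite ?av_inl ?av_inr ?dig_le ?Y_le.
  + move: ec; rewrite /cz -e0 n0 !mul1n => /eqP; rewrite clP //.
    * by rewrite lt0n n0 /=; case: (x) => v; rewrite ?av_inl ?av_inr ?dig_le ?Y_le.
    * by rewrite lt0n -e0 n0 /=; case: (x) => v; rewrite ?av_inl ?av_inr ?dig_le ?Y_le.
- by have := IH i i' hi hi' e g; rewrite /psat /= => ->.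
- have [g1 g2] : good (pdom (posi i)) a /\ good (pdom (posi i)) b := good_andE g.
  by have := IHa i i' hi hi' e g1; have := IHb i i' hi hi' e g2; rewrite /psat /= => -> ->.
- have [g1 g2] : good (pdom (posi i)) a /\ good (pdom (posi i)) b := good_andE g.
  by have := IHa i i' hi hi' e g1; have := IHb i i' hi hi' e g2; rewrite /psat /= => -> ->.
- have [g1 g2] : good (pdom (posi i)) a /\ good (pdom (posi i)) b := good_andE g.
  by have := IHa i i' hi hi' e g1; have := IHb i i' hi hi' e g2; rewrite /psat /= => -> ->.
have [mx ga] := good_quantE g.
(* The extensions are tagged by their side because both positions may lie in the same structure. *)
pose A := [seq (true, u) | u <- dm (Z i)]; pose B := [seq (false, u) | u <- dm (Z i')].
have ABP (t : bool * nat) : t \in A ++ B -> 0 < t.2 <= N.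
  by rewrite mem_cat => /orP[]/mapP[u /dmP hu ->].
pose ix (t : bool * nat) := if t.1 then i else i'.
have hix t : ix t < nidxN by rewrite /ix; case: ifP.
have dix t : pdom (posi (ix t)) =1 pdom (posi i).
  rewrite /ix; case: ifP => // _ v; rewrite /pdom /=; have [h _ _ _] := atv v v.
  by rewrite h.
(* It remains to give an equivalence relation on the tagged extensions whose classes have equally
   many members on both sides and that preserves the truth of the body. *)
have C (r : rel (bool * nat)) :
    {in A ++ B, forall t, r t t} -> {in A ++ B &, forall t t', r t t' -> r t' t} ->
    {in A ++ B & &, forall t t' t'', r t t' -> r t' t'' -> r t t''} ->
    (forall h, h \in A ++ B -> count (r h) A = count (r h) B) ->
    {in A ++ B &, forall t t', r t t' -> psatN (move_pos (posi (ix t)) x t.2) a =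
       psatN (move_pos (posi (ix t')) x t'.2) a} ->
    psatN (posi i) (Quant q x a) = psatN (posi i') (Quant q x a).
  move=> r1 r2 r3 r4 r5; apply: quant_transfer => psi hpsi.
  have := @count_classes _ r A B (fun t => psatN (move_pos (posi (ix t)) x t.2) psi) r1 r2 r3 r4.
  rewrite !count_map; apply=> t t' ht ht' rt; have := r5 t t' ht ht' rt.
  by case: hpsi => -> //; rewrite /psat /= => ->.
case: x g mx ga C => [c|j] g mx ga C.
  - pose F (t : bool * nat) := sbsN (ix t) c t.2.
    have FP t : t \in A ++ B -> F t < nidxN.
      by move=> /ABP/andP[_ ht]; apply: sbs_lt.
    apply: (C (fun t t' => tv nidxN (F t) == tv nidxN (F t'))).
    + by move=> t _ /=.
    + by move=> t t' _ _ /=; rewrite eq_sym.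
    + by move=> t t' t'' _ _ _ /= /eqP->.
    + move=> h hh; have := sX c; rewrite mem_iota add0n => /(_ (ltn_ord c))/allP/(_ (F h)).
      rewrite mem_iota add0n => /(_ (FP _ hh))/eqP; rewrite /cntX !count_map => ec.
      rewrite (eq_count (a2 := fun u => nth 0 (Tr nidxN) (sbsN i c u) == nth 0 (Tr nidxN) (F h))).
        rewrite ec; apply: eq_count => u /=; by rewrite eq_sym.
      by move=> u /=; rewrite eq_sym.
    + move=> t t' ht ht' /eqP et.
      have N1 := proj2 (andP (ABP _ ht)); have N2 := proj2 (andP (ABP _ ht')).
      have [a1 a2] := @posi_sbs (ix t) c t.2 N1.
      have [b1 b2] := @posi_sbs (ix t') c t'.2 N2.
      have gt : good (pdom (posi (F t))) a.
        apply: good_ext ga => v; rewrite -(dix t); have h0 := proj1 (andP (ABP _ ht)).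
        apply: etrans (esym (pdom_move (posi (ix t)) (inl c) h0 v)) _.
        by rewrite /pdom a2.
      have := IH _ _ (FP _ ht) (FP _ ht') et gt.
      by rewrite /psat a1 b1 (nsat_ext _ _ _ _ _ a2) (nsat_ext _ _ _ _ _ b2).
  - have yj : yP j = 0.
      have e' : (posi i).2 (inr j) = Y i j by apply: av_inr.
      by move: mx; rewrite /movable /pdom e' negbK Y_dom // => /eqP.
    have RP t t' : t \in A ++ B -> t' \in A ++ B ->
      (rec (Z (ix t')) (ix t' %% ntup) (updy (Y (ix t')) j t'.2) (Z (ix t)) (ix t %% ntup)
        (updy (Y (ix t)) j t.2)) <-> approx (posu (ix t') j t'.2) (posu (ix t) j t.2).
      by move=> ht ht'; apply: recP => //; exact: ABP.
    apply: (C (fun t t' => rec (Z (ix t')) (ix t' %% ntup) (updy (Y (ix t')) j t'.2)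
       (Z (ix t)) (ix t %% ntup) (updy (Y (ix t)) j t.2))).
    + by move=> t ht /=; apply/RP.
    + by move=> t t' ht ht' /RP h; apply/RP => //; apply: approx_sym; exact: h.
    + move=> t t' t'' ht ht' ht'' /RP h1 /RP h2; apply/RP => //.
      by apply: approx_trans (h2 _ _) (h1 _ _).
    + move=> h hh; have := sY j; rewrite mem_iota add0n => /(_ (ltn_ord j)).
      (* The representative of the class is [h] itself. In [same] the values of y_j run over
         successors, hence the predecessor. *)
      rewrite yj /= => /allP/(_ (ix h)); rewrite mem_iota add0n => /(_ (hix h))/allP/(_ h.2.-1).
      have /andP[h0 hN] := ABP _ hh.
      rewrite mem_iota add0n prednK // => /(_ hN)/eqP.
      by rewrite /cntY !count_map.
    + move=> t t' ht ht' /RP h.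
      have [_ hs] := approx_sym (h ht ht').
      have [a1 a2] := @posi_posu (ix t) j t.2.
      have [b1 b2] := @posi_posu (ix t') j t'.2.
      have gt : good (pdom (posu (ix t) j t.2)) a.
        apply: good_ext ga => v; rewrite -(dix t); have h0 := proj1 (andP (ABP _ ht)).
        apply: etrans (esym (pdom_move (posi (ix t)) (inr j) h0 v)) _.
        by rewrite /pdom a2.
      have := hs _ gt.
      by rewrite /psat a1 b1 (nsat_ext _ _ _ _ _ a2) (nsat_ext _ _ _ _ _ b2).
Qed.

Lemma tv_approx i i' : i < nidxN -> i' < nidxN ->
  tv nidxN i = tv nidxN i' <-> approx (posi i) (posi i').
Proof.
move=> hi hi'; split=> [e|]; last exact: approx_tv.
split=> [v|phi g]; last exact: bisim.
have : sameN (Tr nidxN) i i' by rewrite -tvS //; apply/eqP; apply: stable_nidx.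
move=> /andP[/andP[/andP[_ /atpP at_] _] _].
by have [h _ _ _] := at_ _ _ (vidx_lt v) (vidx_lt v); rewrite /pdom /= h.
Qed.

End Level.

(** * Correctness at every depth *)

Definition ylike (yP y : nat -> nat) :=
  forall l, l < k2 -> y l <= N /\ (y l == 0) = (yP l == 0).

Lemma mkeqP (rec : tester) zP sP yP zQ sQ yQ :
  ylike yP yP -> ylike yP yQ -> sP < ntup -> sQ < ntup ->
  (forall j z s y u z' s' y' v, j < k2 -> yP j = 0 -> s < ntup -> s' < ntup ->
    0 < u <= N -> 0 < v <= N -> ylike yP y -> ylike yP y' ->
    rec z s (updy y j u) z' s' (updy y' j v)
    <-> approx (posn z s (updy y j u)) (posn z' s' (updy y' j v))) ->
  mkeq k1 k2 N dm E cl rec zP sP yP zQ sQ yQ <-> approx (posn zP sP yP) (posn zQ sQ yQ).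
Proof.
move=> lP lQ hP hQ H.
have yl i : ylike yP (Yi k1 N yP yQ i).
  by move=> l hl; rewrite /Yi; case: ifP => _; [exact: lP|exact: lQ].
have n0 : 0 < ntup by rewrite Bx_gt0.
have R := @tv_approx rec zP yP zQ yQ (fun j h => proj1 (lP j h)) (fun j h => proj1 (lQ j h))
  (fun j h => esym (proj2 (lQ j h))) _ sP (ntup + sQ) _ _.
have dP : sP %/ ntup = 0 by rewrite divn_small.
have dQ : (ntup + sQ) %/ ntup = 1 by rewrite divnDl ?dvdnn // divnn n0 divn_small.
have e : mkeq k1 k2 N dm E cl rec zP sP yP zQ sQ yQ <->
    tv rec zP yP zQ yQ nidxN sP = tv rec zP yP zQ yQ nidxN (ntup + sQ).
  by split=> [/eqP|h]; last exact/eqP.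
apply: (iff_trans e); apply: (iff_trans (R _ _ _)).
- move=> j i u h v hj yj hi hh hu hv; apply: H => //; exact: ltn_pmod.
- by rewrite nidx_lt dP.
- by rewrite nidx_lt dQ.
have a1 : (posi zP yP zQ yQ sP).1 = zP by rewrite /= /Zi dP.
have a2 : (posi zP yP zQ yQ sP).2 =1 (posn zP sP yP).2.
  by move=> v; rewrite /= /av /Yi dP.
have b1 : (posi zP yP zQ yQ (ntup + sQ)).1 = zQ by rewrite /= /Zi dQ.
have b2 : (posi zP yP zQ yQ (ntup + sQ)).2 =1 (posn zQ sQ yQ).2.
  move=> v; rewrite -[LHS]/(avN (ntup + sQ) (Yi k1 N yP yQ (ntup + sQ)) (vidx v)).
  rewrite -[RHS]/(avN sQ yQ (vidx v)); case: v => [c|j]; rewrite ?av_inl ?av_inr.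
    by rewrite -(dig_mod _ _ (ltn_ord c)) modnDl dig_mod.
  by rewrite /Yi dQ.
split; apply: approx_ext => //; try by move=> v; rewrite ?a2 ?b2.
Qed.

(** Assigning an undefined y lowers the number of undefined y's, which the depth bounds. *)
Lemma eqvP l z s y z' s' y' :
  ylike y y -> ylike y y' -> s < ntup -> s' < ntup ->
  count (fun j => y j == 0) (iota 0 k2) <= l ->
  eqv k1 k2 N dm E cl l z s y z' s' y' <-> approx (posn z s y) (posn z' s' y').
Proof.
elim: l z s y z' s' y' => [|l IH] z s y z' s' y' ly ly' hs hs' hc /=.
  apply: mkeqP => // j z1 s1 y1 u z2 s2 y2 v hj yj.
  have : 0 < count (fun j => y j == 0) (iota 0 k2).
    by rewrite -has_count; apply/hasP; exists j; rewrite ?mem_iota // yj.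
  by lia.
apply: mkeqP => // j z1 s1 y1 u z2 s2 y2 v hj yj h1 h2 hu hv l1 l2.
have u0 : u != 0 by case/andP: hu; case: (u).
have v0' : v != 0 by case/andP: hv; case: (v).
apply: IH => //.
- move=> k hk; rewrite /updy; case: eqP => _; first by case/andP: hu.
  by have [] := l1 k hk.
- move=> k hk; rewrite /updy; case: eqP => _; first by rewrite (negbTE u0) (negbTE v0'); case/andP: hv.
  by have [_ ->] := l1 k hk; exact: l2.
rewrite -ltnS; apply: leq_trans hc.
rewrite (count_split (r := pred1 j) (C := iota 0 k2) (P := fun k => y k == 0)); last first.
  by move=> k _ /eqP->; rewrite yj.
have -> : count (pred1 j) (iota 0 k2) = 1 by rewrite count_uniq_mem ?iota_uniq // mem_iota hj.
rewrite add1n ltnS count_filter.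
apply: eq_leq; apply: eq_in_count => k; rewrite mem_iota add0n /= => hk; rewrite /updy.
by case: (k =P j) => [_|_]; rewrite ?(negbTE u0) ?andbF // andbT; have [_ ->] := l1 k hk.
Qed.

End Correct.

(** * Reading the encoding *)

Definition encs (ns : seq nat) : seq letter := flatten [seq enc_nat n | n <- ns].

Lemma onth_cat (T : Type) (s1 s2 : seq T) i :
  onth (s1 ++ s2) i = if i < size s1 then onth s1 i else onth s2 (i - size s1).
Proof. by elim: s1 i => [|x s IH] [|i] //=; rewrite IH. Qed.

Lemma encs_cat s t : encs (s ++ t) = encs s ++ encs t.
Proof. by rewrite /encs map_cat flatten_cat. Qed.

Lemma count_encs s : count (pred1 None) (encs s) = size s.
Proof.
elim: s => //= n s IH; rewrite /encs /= count_cat -/(encs s) IH /enc_nat -cats1 count_cat.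
by rewrite count_nseq.
Qed.

Lemma size_encs_rcons s n : size (encs (rcons s n)) = size (encs s) + n.+1.
Proof. by rewrite -cats1 encs_cat size_cat /encs /= cats0 /enc_nat size_rcons size_nseq. Qed.

Lemma nn_count (pre m : seq letter) q : nn (pre ++ m) (size pre) q = count (pred1 None) (take q m).
Proof.
rewrite /nn; elim: q => [|q IH]; first by rewrite big_geq // take0.
rewrite big_nat_recr //= IH /isn onth_cat ltnNge leq_addr /= addKn.
case: (ltnP q (size m)) => hq.
  rewrite (take_nth None) // -cats1 count_cat /= addn0; congr (_ + _).
  by rewrite onthE (nth_map None).
by rewrite !take_oversize ?onth_default ?addn0 // ltnW.
Qed.

(** A nonempty sequence of fields ends with a separator, so a proper prefix misses at least one. *)
Lemma take_encs s q : q < size (encs s) -> count (pred1 None) (take q (encs s)) < size s.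
Proof.
case/lastP: s => // s n; rewrite -(count_encs (rcons s n)) => hq.
have e : exists A, encs (rcons s n) = rcons A None.
  exists (encs s ++ nseq n (Some true)).
  by rewrite -cats1 encs_cat rcons_cat /encs /= cats0.
case: e => A e; rewrite e in hq *; rewrite size_rcons ltnS in hq.
rewrite -cats1 takel_cat // count_cat /= addn1 ltnS.
by rewrite -{2}(cat_take_drop q A) count_cat leq_addr.
Qed.

(** Longer prefixes contain more separators, and [f] of them are reached exactly at the end of the
    first [f] fields. The sum of indicators thus counts the positions before that end. *)
Lemma fstart_ok pre ns suf f : f <= size ns ->
  fstart (pre ++ encs ns ++ suf) (size pre) f = size pre + size (encs (take f ns)).
Proof.
move=> hf; congr (_ + _); set w := pre ++ _.
have -> : \sum_(0 <= q < (size w).+1) (nn w (size pre) q < f : nat) =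
   \sum_(0 <= q < (size w).+1) (q < size (encs (take f ns)) : nat).
  apply: eq_big_nat => q _; congr nat_of_bool; rewrite nn_count.
  have e : encs ns = encs (take f ns) ++ encs (drop f ns) by rewrite -encs_cat cat_take_drop.
  have sf : size (take f ns) = f by rewrite size_takel.
  rewrite e -catA; case: (ltnP q (size (encs (take f ns)))) => hq.
    by rewrite takel_cat ?(ltnW hq) // -{2}sf take_encs.
  by apply/negbTE; rewrite -leqNgt take_cat ltnNge hq /= count_cat count_encs sf leq_addr.
apply: sum_indic_lt; apply: leqW; rewrite /w !size_cat.
have : size (encs (take f ns)) <= size (encs ns).
  by rewrite -{2}(cat_take_drop f ns) encs_cat size_cat leq_addr.
by lia.
Qed.

Lemma flen_ok pre ns suf f : f < size ns ->
  flen (pre ++ encs ns ++ suf) (size pre) f = nth 0 ns f.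
Proof.
move=> hf; rewrite /flen !fstart_ok ?(ltnW hf) // (take_nth 0) // size_encs_rcons.
by lia.
Qed.

Lemma onth_flatten (T : Type) (rows : seq (seq T)) n a b :
  all (fun r => size r == n) rows -> a < size rows -> b < n ->
  onth (flatten rows) (a * n + b) = onth (nth [::] rows a) b.
Proof.
elim: rows a => //= r rows IH [|a] /andP[/eqP sr h] ha hb; rewrite onth_cat sr.
  by rewrite mul0n add0n hb.
have e : a.+1 * n + b = n + (a * n + b) by rewrite mulSn addnA.
by rewrite e ltnNge leq_addr /= addKn IH.
Qed.

Lemma map_rank (T : finType) o : [seq o + (enum_rank u).+1 | u <- enum T] = iota o.+1 #|T|.
Proof.
apply: (@eq_from_nth _ 0); first by rewrite size_map size_iota cardE.
move=> i; rewrite size_map -cardE => hi.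
have x0 : T by case: (pickP (mem T)) (eq_card0 (A := T)) => [x _ //|h0 e0]; move: hi; rewrite e0.
rewrite (nth_map x0) -?cardE // nth_iota //.
have -> : nth x0 (enum T) i = enum_val (Ordinal hi) by rewrite (enum_val_nth x0).
by rewrite enum_valK /=; lia.
Qed.

(** * Graphs and assignments as numbers *)

Section Bridge.
Variables (k1 k2 : nat) (K : cgraph) (o z : nat) (dm : nat -> seq nat) (E : rel nat)
  (col0 : nat -> nat).
Local Notation var := (var k1 k2).
Definition vcode (u : K) := o + (enum_rank u).+1.
Hypothesis dmz : dm z = [seq vcode u | u <- enum K].
Hypothesis Ez : forall u v : K, E (vcode u) (vcode v) = edge u v.
Hypothesis colz : forall u : K, col0 (vcode u) = color u.

Definition acode (a : assignment var K) : var -> nat :=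
  fun v => if a v is Some u then vcode u else 0.

Lemma vcode_inj : injective vcode.
Proof. by move=> u v /addnI [] /val_inj /enum_rank_inj. Qed.

Lemma vcode_neq0 u : (vcode u != 0). Proof. by rewrite /vcode addnS. Qed.

Lemma acode_update a x u : acode (update a x u) =1 upd (acode a) x (vcode u).
Proof. by move=> y; rewrite /acode /update /upd; case: eqP. Qed.

Lemma acode_dom a v : (acode a v != 0) = isSome (a v).
Proof. by rewrite /acode; case: (a v) => [u|] //; rewrite vcode_neq0. Qed.

Lemma sat_nsat a (phi : form var) : sat a phi = nsat dm E col0 z (acode a) phi.
Proof.
elim: phi a => /=.
- move=> x y a; rewrite /acode; case: (a x) => [u|] //; case: (a y) => [v|] //.
  + by rewrite vcode_neq0 /= (inj_eq vcode_inj).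
  + by rewrite (negbTE (vcode_neq0 u)) andbF.
- move=> x y a; rewrite /acode /ez; case: (a x) => [u|] //; case: (a y) => [v|] //.
  + by rewrite !vcode_neq0 /= Ez.
  + by rewrite andbF.
- by move=> c x a; rewrite /acode; case: (a x) => [u|] //; rewrite vcode_neq0 /= colz.
- by move=> f IH a; rewrite IH.
- by move=> f IHf g IHg a; rewrite IHf IHg.
- by move=> f IHf g IHg a; rewrite IHf IHg.
- by move=> f IHf g IHg a; rewrite IHf IHg.
- move=> q x f IH a.
  have H u : sat (update a x u) f = nsat dm E col0 z (upd (acode a) x (vcode u)) f.
    by rewrite IH; apply: nsat_ext; exact: acode_update.
  case: q => [||n]; rewrite dmz.
  + rewrite all_map; apply/forallP/allP => [h u _|h u]; first by rewrite /= -H.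
    by rewrite H; apply: (h u); rewrite mem_enum.
  + rewrite has_map; apply/existsP/hasP => [[u h]|[u _ h]]; exists u => //=.
    * by rewrite mem_enum.
    * by rewrite -H.
    * by rewrite H.
  + rewrite count_map cardsE cardE -size_filter /enum_mem.
    rewrite -filter_predI; congr (_ <= size _).
    by apply: eq_filter => u; rewrite /= -H andbT.
Qed.

End Bridge.

Section Equiv.
Variables (k1 k2 : nat) (G H : cgraph) (dm : nat -> seq nat) (E : rel nat)
  (col0 : nat -> nat) (oG oH : nat).
Local Notation var := (var k1 k2).
Hypothesis satG : forall a (phi : form var), sat a phi = nsat dm E col0 0 (@acode k1 k2 G oG a) phi.
Hypothesis satH : forall a (phi : form var), sat a phi = nsat dm E col0 1 (@acode k1 k2 H oH a) phi.
Variables (alpha : assignment var G) (beta : assignment var H).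
Hypothesis conf : configuration alpha beta.

(** Conjoins [y_j = y_j] for the defined y's, which makes them free. *)
Definition padf (D : pred var) (s : seq 'I_k2) (phi : form var) : form var :=
  foldr (fun j acc => if D (inr j) then And (Equal (inr j) (inr j)) acc else acc) phi s.

Lemma padf_bnds D s phi v : bnds (padf D s phi) v = bnds phi v.
Proof. by elim: s => //= j s IH; case: ifP. Qed.

Lemma padf_nest D s phi v : nest (padf D s phi) v = nest phi v.
Proof. by elim: s => //= j s IH; case: ifP. Qed.

Lemma padf_free D s phi v :
  free (padf D s phi) v = free phi v || has (fun j => D (inr j) && (v == inr j)) s.
Proof.
elim: s => [|j s IH] /=; first by rewrite orbF.
case: ifP => h /=; rewrite IH //= orbb -[v == inr j]/(v == inr j).
by rewrite orbCA.
Qed.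

Lemma padf_sat (K : cgraph) (a : assignment var K) (D : pred var) s phi :
  (forall j, D (inr j) -> isSome (a (inr j))) -> sat a (padf D s phi) = sat a phi.
Proof.
move=> h; elim: s => //= j s IH; case: ifP => // /h /=; rewrite IH.
by case: (a (inr j)) => // u _; rewrite eqxx.
Qed.

(** [C_equiv] evaluates only formulas in which all defined y's are free. Padding turns any good
    formula into such a formula without binding anything or changing its truth value. *)
Lemma C_equivP : C_equiv alpha beta <->
  approx dm E col0 (0, @acode k1 k2 G oG alpha) (1, @acode k1 k2 H oH beta).
Proof.
set a := (0, _); set b := (1, _).
have da v : pdom a v = isSome (alpha v) by rewrite /pdom acode_dom.
have db v : pdom b v = isSome (beta v) by rewrite /pdom acode_dom.
split=> [eq|[_ ap] phi inC fx fy].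
  split=> [v|phi [g1 g2 g3]]; first by rewrite da db conf.
  pose psi := padf (pdom a) (enum 'I_k2) phi.
  have fpsi v : free psi v -> pdom a v.
    rewrite padf_free => /orP[/g1//|/hasP[j _ /andP[h /eqP->]]] //.
  have : sat alpha psi <-> sat beta psi.
    apply: eq.
    - move=> j [[/fpsi D]|]; first by move/boundP; rewrite padf_bnds => b'; have := g2 j D; rewrite b'.
      by move/nestP; rewrite padf_nest => n; have := g3 j; rewrite n.
    - by move=> i /fpsi; rewrite da.
    - move=> j; rewrite -da; apply/idP/idP; first exact: fpsi.
      move=> D; rewrite padf_free; apply/orP; right; apply/hasP; exists j.
        by rewrite mem_enum.
      by rewrite D eqxx.
  rewrite !padf_sat; last first.
  - by move=> j; rewrite da.
  - by move=> j; rewrite da conf.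
  by rewrite satG satH /psat => h; apply/idP/idP => /h.
have g : good (pdom a) phi.
  split.
  - by case=> i h; rewrite da -?fy // fx.
  - move=> j; rewrite da -fy => f; apply/negP => /boundP bd.
    by apply: (inC j); left.
  - by move=> j; apply/negP => /nestP n; apply: (inC j); right.
by have := ap _ g; rewrite /psat /= -satG -satH => ->.
Qed.

End Equiv.

Fixpoint encd N (g : nat -> nat) k :=
  if k is k'.+1 then encd N g k' + g k' * base N ^ k' else 0.

Lemma encd_lt N g k : (forall c, c < k -> g c <= N) -> encd N g k < base N ^ k.
Proof.
elim: k => //= k IH h; have h1 := IH (fun c hc => h c (leqW hc)).
have h2 := h k (leqnn _); rewrite expnS.
have : g k * base N ^ k <= N * base N ^ k by rewrite leq_mul2r h2 orbT.
by rewrite /base in h1 *; move: (_ ^ k) h1 => p h1; rewrite mulSn; lia.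
Qed.

Lemma dig_encd N g k c : (forall c, c < k -> g c <= N) -> c < k -> dig N (encd N g k) c = g c.
Proof.
elim: k => // k IH h hc; have h0 : forall c, c < k -> g c <= N.
  by move=> c' hc'; exact: h c' (leqW hc').
have lt := encd_lt h0; move: hc; rewrite ltnS leq_eqVlt => /orP[/eqP->|hc] /=.
  rewrite /dig addnC divnMDl ?Bx_gt0 // divn_small // addn0 modn_small //.
  by rewrite ltnS h.
by rewrite (dig_low _ _ hc) addnC modnMDl modn_small // IH.
Qed.

Fixpoint tencd (f : nat -> tm) k : tm :=
  if k is k'.+1 then tadd (tencd f k') (tmul (f k') (tpow tB k')) else tcst 0.

Lemma val_encd w W f g k : (forall c, val w W (f c) (g c)) ->
  val w W (tencd f k) (encd (iN w) g k).
Proof.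
move=> h; elim: k => [|k IH] //=; apply: (val_add IH); apply: val_mul (h k) _.
exact: val_Bpow.
Qed.

(** * The expressions run by the machine and their value on an instance *)

Section Main.
Variables (k1 k2 : nat).

Definition iraw w (l : nat) := flen w (icH w) (inH w + l).
Definition iA w l := iraw w l.
Definition iB w l := if iraw w (k1 + k2 + l) == 0 then 0 else inG w + iraw w (k1 + k2 + l).
Definition traw (l : nat) := tflen tcH (tadd tnH (tcst l)).
Definition tA l := traw l.
Definition tBt l := tif (teq (traw (k1 + k2 + l)) (tcst 0)) (tcst 0)
  (tadd tnG (traw (k1 + k2 + l))).

Definition tmain : tm :=
  teqv k1 k2 k2 (tcst 0) (tencd tA k1) (fun l => tA (k1 + l))
    (tcst 1) (tencd tBt k1) (fun l => tBt (k1 + l)).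

Definition expr_size := tnidx k1 1 0.
Definition expr_main := tmain 1 0.

Definition answer w : bool :=
  eqv k1 k2 (iN w) (idm w) (iE w) (icl w) k2 0 (encd (iN w) (iA w) k1)
    (fun l => iA w (k1 + l)) 1 (encd (iN w) (iB w) k1) (fun l => iB w (k1 + l)).

Lemma ev_size w : ev w [:: 0] [::] expr_size = nidx k1 (iN w).
Proof. exact: (@val_nidx k1 w ([:: 0], [::]) ([:: 0], [::]) (wle_refl _)). Qed.

Lemma val_raw w W l : val w W (traw l) (iraw w l).
Proof. exact: val_flen (@val_cH w _) (val_add (@val_nH w _) (val_cst _ _)). Qed.

Lemma val_Bt w W l : val w W (tBt l) (iB w l).
Proof.
apply: val_if (val_eqn (@val_raw _ _ _) (val_cst _ _)) (val_cst _ _) _.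
exact: val_add (@val_nG w _) (@val_raw _ _ _).
Qed.

Lemma ev_main w : ev w [:: nidx k1 (iN w)] [::] expr_main = answer w.
Proof.
have h := wle_refl ([:: nidx k1 (iN w)], [::]).
apply: (@recval_eqv k1 k2 w k2 _ _ _ _ _ _ _ _ _ _ _ _ _ h _ _ _ _ _ _ _ h).
- exact: val_cst.
- by apply: val_encd => c; exact: val_raw.
- by move=> l; exact: val_raw.
- exact: val_cst.
- by apply: val_encd => c; exact: val_Bt.
- by move=> l; exact: val_Bt.
Qed.

Section Instance.
Variables (G H : cgraph) (alpha : assignment (var k1 k2) G) (beta : assignment (var k1 k2) H).
Variable nm : nat -> nat.
Hypotheses (conf : configuration alpha beta) (naming : color_naming G H nm).
Let w := enc_instance nm alpha beta.
Let nG := nb_vertices G.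
Let nH := nb_vertices H.

Definition adj (K : cgraph) : seq letter :=
  flatten [seq [seq Some (edge u v) | v <- enum (vertex K)] | u <- enum (vertex K)].

Definition rawc (K : cgraph) (a : assignment (var k1 k2) K) (v : var k1 k2) :=
  if a v is Some u then (enum_rank u).+1 else 0.
Definition rawcs (K : cgraph) (a : assignment (var k1 k2) K) :=
  [seq rawc a (inl i) | i <- enum 'I_k1] ++ [seq rawc a (inr j) | j <- enum 'I_k2].

Lemma enc_assignment_encs (K : cgraph) (a : assignment (var k1 k2) K) :
  enc_assignment a = encs (rawcs a).
Proof.
rewrite /enc_assignment /rawcs encs_cat /encs -!map_comp.
by congr (flatten _ ++ flatten _); apply: eq_map => i /=; rewrite /rawc /enc_vertex; case: (a _).
Qed.

Lemma enc_graph_encs (K : cgraph) :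
  enc_graph nm K = encs [:: nb_vertices K] ++ adj K ++ encs (map nm (colors K)).
Proof. by rewrite /enc_graph /encs /= cats0 -map_comp. Qed.

Lemma size_adj (K : cgraph) : size (adj K) = nb_vertices K * nb_vertices K.
Proof.
rewrite /adj size_flatten /shape -map_comp sumnE big_map.
rewrite (eq_bigr (fun _ => nb_vertices K)) => [|u _]; last by rewrite /= size_map -cardE.
by rewrite big_const_seq count_predT iter_addn_0 /nb_vertices cardE.
Qed.

Lemma size_colors0 (K : cgraph) : size (colors K) = nb_vertices K.
Proof. by rewrite /colors size_map /nb_vertices cardE. Qed.

Lemma size_colors (K : cgraph) : size (map nm (colors K)) = nb_vertices K.
Proof. by rewrite size_map size_colors0. Qed.

(** The three splittings each expose one maximal run of fields as a block for [flen_ok] and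
    [fstart_ok]; the matrices, which have no separators, lie between the runs. *)
Lemma w_split1 : w = [::] ++ encs [:: nG] ++ (adj G ++ encs (map nm (colors G)) ++
  encs [:: nH] ++ adj H ++ encs (map nm (colors H) ++ rawcs alpha ++ rawcs beta)).
Proof.
by rewrite /w /enc_instance !enc_graph_encs !enc_assignment_encs !encs_cat -!catA.
Qed.

Lemma w_split2 : w = (encs [:: nG] ++ adj G) ++ encs (map nm (colors G) ++ [:: nH]) ++
  (adj H ++ encs (map nm (colors H) ++ rawcs alpha ++ rawcs beta)).
Proof. by rewrite w_split1 !encs_cat -!catA. Qed.

Lemma w_split3 : w = ((encs [:: nG] ++ adj G) ++ encs (map nm (colors G) ++ [:: nH]) ++ adj H)
  ++ encs (map nm (colors H) ++ rawcs alpha ++ rawcs beta) ++ [::].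
Proof. by rewrite w_split1 cats0 !encs_cat -!catA. Qed.

Lemma nG_ok : inG w = nG.
Proof. by rewrite /inG w_split1 (@flen_ok [::]). Qed.

Lemma size_encs1 n : size (encs [:: n]) = n.+1.
Proof. by rewrite (size_encs_rcons [::]). Qed.

Lemma aG_ok : iaG w = size (encs [:: nG]).
Proof. by rewrite /iaG nG_ok size_encs1. Qed.

Lemma cG_ok : icG w = size (encs [:: nG] ++ adj G).
Proof. by rewrite /icG aG_ok nG_ok size_cat size_adj. Qed.

Lemma nH_ok : inH w = nH.
Proof.
rewrite /inH cG_ok nG_ok w_split2 flen_ok; last by rewrite size_cat size_colors addn1.
by rewrite nth_cat size_colors ltnn subnn.
Qed.

Lemma aH_ok : iaH w = size ((encs [:: nG] ++ adj G) ++ encs (map nm (colors G) ++ [:: nH])).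
Proof.
rewrite /iaH cG_ok nG_ok {1}w_split2 fstart_ok; last by rewrite size_cat size_colors addn1.
by rewrite take_oversize ?size_cat ?size_colors ?addn1.
Qed.

Lemma cH_ok : icH w =
  size ((encs [:: nG] ++ adj G) ++ encs (map nm (colors G) ++ [:: nH]) ++ adj H).
Proof. by rewrite /icH aH_ok nH_ok catA [RHS]size_cat size_adj. Qed.

Lemma N_ok : iN w = nG + nH.
Proof. by rewrite /iN nG_ok nH_ok. Qed.

Lemma adj_ok (K : cgraph) (u v : K) :
  onth (adj K) (enum_rank u * nb_vertices K + enum_rank v) = Some (Some (edge u v)).
Proof.
rewrite /adj; set rows := map _ _.
have al : all (fun r => size r == nb_vertices K) rows.
  by apply/allP => r /mapP[x _ ->]; rewrite size_map -cardE.
have ha : enum_rank u < size rows by rewrite size_map -cardE ltn_ord.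
rewrite (onth_flatten al ha (ltn_ord (enum_rank v))) /rows.
have hr (x : K) : enum_rank x < size (enum (vertex K)) by have := ltn_ord (enum_rank x); rewrite [X in _ < X]cardE.
rewrite (nth_map u) // onthE (nth_map None); last by rewrite size_map.
by rewrite (nth_map u) // !nth_enum_rank.
Qed.

Lemma adj_lt (K : cgraph) (u v : K) :
  enum_rank u * nb_vertices K + enum_rank v < size (adj K).
Proof.
rewrite size_adj; have := ltn_ord (enum_rank u); have := ltn_ord (enum_rank v).
rewrite -/(nb_vertices K); move: (nat_of_ord _) (nat_of_ord _) => a b; nia.
Qed.

Lemma E_okG (u v : G) : iE w (vcode 0 u) (vcode 0 v) = edge u v.
Proof.
rewrite /iE aG_ok /vcode !add0n nG_ok !ltn_ord andTb /ist !subn1 !succnK -addnA.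
rewrite {1}w_split1 cat0s onth_cat ltnNge leq_addr /= addKn onth_cat adj_lt adj_ok.
by case: (edge u v).
Qed.

Lemma E_okH (u v : H) : iE w (vcode nG u) (vcode nG v) = edge u v.
Proof.
have hv (x : H) : (nG + (enum_rank x).+1 <= nG) = false by rewrite addnS ltnNge leq_addr.
rewrite /iE aH_ok /vcode nG_ok !hv andTb /ist nH_ok !subn1 !addnS !succnK !addKn -addnA.
rewrite {1}w_split2 catA onth_cat ltnNge leq_addr /= addKn onth_cat adj_lt adj_ok.
by case: (edge u v).
Qed.

Definition icol x := if x <= nG then nth 0 (colors G) (x - 1) else nth 0 (colors H) (x - 1 - nG).

Lemma col_okG (u : G) : icol (vcode 0 u) = color u.
Proof.
by rewrite /icol /vcode add0n ltn_ord subn1 /= (nth_map u) ?nth_enum_rank // -cardE ltn_ord.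
Qed.

Lemma col_okH (u : H) : icol (vcode nG u) = color u.
Proof.
by rewrite /icol /vcode addnS ltnNge leq_addr /= subn1 /= addKn (nth_map u) ?nth_enum_rank // -cardE ltn_ord.
Qed.

(** The membership is recorded because the naming is injective only on colors that occur. *)
Lemma cl_icol x : 0 < x <= iN w -> icl w x = nm (icol x) /\ icol x \in colors G ++ colors H.
Proof.
rewrite N_ok /icl /icol nG_ok => /andP[x0 xN]; case: (leqP x nG) => hx.
  have h : x - 1 < size (colors G) by rewrite size_colors0 -/nG; lia.
  rewrite cG_ok w_split2 flen_ok; last by rewrite size_cat size_map; lia.
  by rewrite nth_cat size_map h (nth_map 0) // mem_cat mem_nth.
have h : x - 1 - nG < size (colors H).
  by rewrite size_colors0 -/nH; lia.
rewrite cH_ok w_split3 flen_ok; last by rewrite size_cat size_map; lia.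
by rewrite nth_cat size_map h (nth_map 0) // mem_cat mem_nth ?orbT.
Qed.

Lemma clP x y : 0 < x <= iN w -> 0 < y <= iN w ->
  (icl w x == icl w y) = (icol x == icol y).
Proof.
move=> /cl_icol[-> hx] /cl_icol[-> hy]; apply/eqP/eqP => [|->//].
by case: naming => inj _; exact: inj.
Qed.

Lemma dm_ok z u : u \in idm w z -> 0 < u <= iN w.
Proof.
by rewrite /idm N_ok nG_ok nH_ok; case: ifP => _; rewrite mem_iota; lia.
Qed.

Lemma satG a (phi : form (var k1 k2)) :
  sat a phi = nsat (idm w) (iE w) icol 0 (@acode k1 k2 G 0 a) phi.
Proof.
apply: sat_nsat; [|exact: E_okG|exact: col_okG].
by rewrite /idm /= nG_ok -map_rank.
Qed.

Lemma satH a (phi : form (var k1 k2)) :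
  sat a phi = nsat (idm w) (iE w) icol 1 (@acode k1 k2 H nG a) phi.
Proof.
apply: sat_nsat; [|exact: E_okH|exact: col_okH].
by rewrite /idm /= nG_ok nH_ok -map_rank.
Qed.

Lemma size_rawcs (K : cgraph) (a : assignment (var k1 k2) K) : size (rawcs a) = k1 + k2.
Proof. by rewrite size_cat; congr (_ + _); rewrite size_map size_enum_ord. Qed.

Lemma nth_rawcs (K : cgraph) (a : assignment (var k1 k2) K) v :
  nth 0 (rawcs a) (vidx v) = rawc a v.
Proof.
rewrite nth_cat size_map size_enum_ord; case: v => [c|j] /=.
  by rewrite ltn_ord (nth_map c) ?size_enum_ord // nth_ord_enum.
by rewrite ltnNge leq_addr /= addKn (nth_map j) ?size_enum_ord // nth_ord_enum.
Qed.

Lemma rawA v : iA w (vidx v) = @acode k1 k2 G 0 alpha v.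
Proof.
rewrite /iA /iraw nH_ok cH_ok w_split3 flen_ok; last first.
  by rewrite 2!size_cat size_colors !size_rawcs; have := vidx_lt v; lia.
rewrite nth_cat size_colors ltnNge leq_addr /= addKn nth_cat size_rawcs vidx_lt nth_rawcs.
by rewrite /rawc /acode; case: (alpha v).
Qed.

Lemma rawB v : iB w (vidx v) = @acode k1 k2 H nG beta v.
Proof.
have e : iraw w (k1 + k2 + vidx v) = rawc beta v.
  rewrite /iraw nH_ok cH_ok w_split3 flen_ok; last first.
    by rewrite 2!size_cat size_colors !size_rawcs; have := vidx_lt v; lia.
  rewrite nth_cat size_colors ltnNge leq_addr /= addKn nth_cat size_rawcs.
  by rewrite ltnNge leq_addr /= addKn nth_rawcs.
rewrite /iB e nG_ok /rawc /acode; case: (beta v) => //.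
Qed.

Lemma acode_leG v : @acode k1 k2 G 0 alpha v <= iN w.
Proof.
rewrite N_ok /acode; case: (alpha v) => // u; rewrite /vcode add0n.
by apply: leq_trans (ltn_ord _) (leq_addr _ _).
Qed.

Lemma acode_leH v : @acode k1 k2 H nG beta v <= iN w.
Proof. by rewrite N_ok /acode; case: (beta v) => // u; rewrite /vcode leq_add2l ltn_ord. Qed.

Lemma answerP : 1 <= k1 + k2 -> answer w <-> C_equiv alpha beta.
Proof.
move=> hk.
have [v0 _] := vidx_surj hk.
have A1 c : c < k1 -> iA w c <= iN w.
  by move=> hc; rewrite -[c]/(vidx (inl (Ordinal hc) : var k1 k2)) rawA acode_leG.
have B1 c : c < k1 -> iB w c <= iN w.
  by move=> hc; rewrite -[c]/(vidx (inl (Ordinal hc) : var k1 k2)) rawB acode_leH.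
have yA (j : 'I_k2) : iA w (k1 + j) = @acode k1 k2 G 0 alpha (inr j) by rewrite -rawA.
have yB (j : 'I_k2) : iB w (k1 + j) = @acode k1 k2 H nG beta (inr j) by rewrite -rawB.
have R := C_equivP satG satH conf.
apply: (iff_trans _ (iff_sym R)); rewrite /answer.
set sA := encd _ (iA w) k1; set sB := encd _ (iB w) k1.
set yPA := fun l => iA w _; set yPB := fun l => iB w _.
have EV := @eqvP k1 k2 (iN w) (idm w) (iE w) (icl w) icol dm_ok clP v0 k2 0 sA yPA 1 sB yPB
  _ _ (encd_lt A1) (encd_lt B1) _.
apply: (iff_trans (EV _ _ _)) => {EV}.
- move=> l hl; split=> //.
  by rewrite /yPA -[l]/(nat_of_ord (Ordinal hl)) yA acode_leG.
- move=> l hl; rewrite /yPA /yPB -[l]/(nat_of_ord (Ordinal hl)) yA yB acode_leH; split=> //.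
  by apply: negb_inj; rewrite !acode_dom conf.
- by rewrite -{2}(size_iota 0 k2) count_size.
have e1 : (@posn k1 k2 (iN w) 0 sA yPA).2 =1 @acode k1 k2 G 0 alpha.
  move=> v; rewrite -[LHS]/(av k1 (iN w) sA yPA (vidx v)); case: v => [c|j].
    by rewrite av_inl dig_encd // -rawA.
  by rewrite av_inr -rawA.
have e2 : (@posn k1 k2 (iN w) 1 sB yPB).2 =1 @acode k1 k2 H nG beta.
  move=> v; rewrite -[LHS]/(av k1 (iN w) sB yPB (vidx v)); case: v => [c|j].
    by rewrite av_inl dig_encd // -rawB.
  by rewrite av_inr -rawB.
by split; apply: approx_ext.
Qed.

End Instance.
End Main.

(** * Resource bounds *)

Lemma Lb_le V : 0 < V -> Lb V <= V + 1.
Proof.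
move=> V0; rewrite /Lb addn1 ltnS; apply: leq_trans (ltnW (ltn_expl _ (isT : 1 < 2))) _.
by rewrite trunc_logP.
Qed.

Lemma U_le w V Mx : (size w).+2 <= V -> Mx <= V ->
  U w V Mx <= 10 * (V * (V + 2) + (V + 1) + V + 10).
Proof.
move=> wV MV; have lV : Lb V <= V + 1 by apply: Lb_le; apply: leq_trans wV.
rewrite /U leq_mul2l; apply/orP; right.
have h1 : Mx * (Lb V).+1 <= V * (V + 2) by apply: leq_mul => //; rewrite addn2 ltnS -addn1.
have h2 : size w <= V by apply: leq_trans wV; rewrite leqW.
by rewrite leq_add2r; apply: leq_add h2; apply: leq_add lV.
Qed.

Section Resources.
Variables (k1 k2 : nat).
Let eM := expr_size k1.
Let e := expr_main k1 k2.
Let dM := dg [:: 0] eM.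
(** With s the length of the word, X = (s + 2)^(dM + 1) bounds the input length and the table size.
    The values need X to a power above the degrees of both expressions, and [D] is the product of
    the two exponents. *)
Let D := (dM.+1 * (dM + dg [:: 1] e).+1).

Definition value_bound (w : seq letter) := (size w).+2 ^ D.

Lemma nidx_le w : nidx k1 (iN w) <= (size w).+2 ^ dM.
Proof.
rewrite -(ev_size k1 w).
apply: (@ev_bound w (size w).+2 _ _ eM [:: 0] [:: 0] [::]) => //.
by split=> //= [[|l]|t i]; rewrite /= ?nth_nil.
Qed.

Lemma nidx_value w : nidx k1 (iN w) <= value_bound w.
Proof. by apply: leq_trans (nidx_le w) _; rewrite leq_pexp2l // /D; nia. Qed.

Lemma program_answer w (V := value_bound w) (Mx := nidx k1 (iN w)) :
  exists t d, mexec w (Bd V Mx) (program eM e) data0 t (answer k1 k2 w) d /\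
    t <= (cost V eM + (cost V e + 1)) * U w V Mx.
Proof.
set X := (size w).+2 ^ dM.+1.
have W2 : 1 < (size w).+2 by [].
have XW : (size w).+2 <= X by rewrite /X expnS leq_pmulr // expn_gt0.
have X2 : 1 < X by apply: leq_trans XW.
have MX : nidx k1 (iN w) <= X by apply: leq_trans (nidx_le w) _; rewrite leq_pexp2l.
have eV d : X ^ d <= V = (d <= (dM + dg [:: 1] e).+1).
  by rewrite /V /value_bound /D expnM leq_exp2l.
have := @program_run w X V Mx eM e X2 (leq_trans (leqnSn _) XW).
rewrite ev_size ev_main eqb0 negbK; apply=> //.
- by rewrite -{1}(expn1 X) eV.
- by rewrite eV; lia.
- by rewrite eV; lia.
Qed.

Lemma time_bound : exists c d, forall w t,
  t <= (cost (value_bound w) eM + (cost (value_bound w) e + 1)) *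
       U w (value_bound w) (nidx k1 (iN w)) -> t <= c * size w ^ d + c.
Proof.
have [k hk] : polyb (fun V => (cost V eM + (cost V e + 1)) *
    (10 * (V * (V + 2) + (V + 1) + V + 10))).
  apply: polyb_mul; first exact: polyb_add (polyb_cost _) (polyb_add (polyb_cost _) (polyb_cst _)).
  repeat first [apply: polyb_add | apply: polyb_mul | exact: polyb_id | exact: polyb_cst].
(* The factor comes from s + 3 <= 3 (s + 1) for a word of length s + 1; the additive constant covers
   the empty word. *)
exists (3 ^ (D.+1 * k)), (D.+1 * k) => w t ht.
set V := value_bound w in ht.
have D1 : 0 < D by rewrite /D.
have wV : (size w).+2 <= V by rewrite -{1}(expn1 (size w).+2) leq_pexp2l.
have hU := U_le wV (nidx_value w).
apply: leq_trans ht _; apply: leq_trans (leq_mul (leqnn _) hU) _.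
apply: leq_trans (hk V) _.
have V2 : V + 2 <= (size w).+2 ^ D.+1.
  have : 2 <= V by apply: leq_trans wV.
  move=> ?; rewrite expnS; apply: (@leq_trans (2 * V)); first by lia.
  exact: leq_mul.
apply: leq_trans (exp_mono k V2) _; rewrite -expnM.
move: (D.+1 * k) => m; case: (size w) => [|s].
  by apply: leq_trans (exp_mono m (isT : 2 <= 3)) _; exact: leq_addl.
have : s.+3 <= 3 * s.+1 by lia.
by move/(exp_mono m); rewrite expnMn; lia.
Qed.

Lemma size_encs_le s b : all (fun x => x < b) s -> size (encs s) <= size s * b.
Proof.
elim: s => //= x s IH /andP[hx /IH h]; rewrite /encs /= size_cat -/(encs s) size_rcons.
by rewrite size_nseq; lia.
Qed.

(** Color names are below 2 n, so a graph takes at most (n + 1) + n^2 + 2 n^2 <= 4 n^2 letters. This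
    polynomial bound is what makes logarithms of the word length O(log n). *)
Lemma size_instance (G H : cgraph) alpha beta nm (n := maxn (nb_vertices G) (nb_vertices H)) :
  color_naming G H nm -> 2 <= n ->
  size (@enc_instance k1 k2 nm G H alpha beta) <= (8 + 2 * (k1 + k2)) * n ^ 2.
Proof.
move=> [_ hn] n2.
have gn : nb_vertices G <= n by apply: leq_maxl.
have hN : nb_vertices H <= n by apply: leq_maxr.
have col K : {subset colors K <= colors G ++ colors H} -> nb_vertices K <= n ->
    size (enc_graph nm K) <= 4 * n ^ 2.
  move=> sub le; rewrite enc_graph_encs 2!size_cat size_encs1 size_adj.
  have : size (encs (map nm (colors K))) <= n * (n + n).
    apply: leq_trans (size_encs_le (b := n + n) _) _; last first.
      by rewrite size_colors leq_mul2r le orbT.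
    rewrite all_map; apply/allP => c /sub /hn /= h; apply: leq_trans h _.
    by rewrite leq_add.
  have : nb_vertices K * nb_vertices K <= n * n by apply: leq_mul.
  by rewrite -mulnn; nia.
have ass K (a : assignment (var k1 k2) K) : nb_vertices K <= n ->
    size (enc_assignment a) <= (k1 + k2) * n ^ 2.
  move=> le; rewrite enc_assignment_encs.
  apply: leq_trans (size_encs_le (b := n.+1) _) _; last first.
    by rewrite size_rawcs leq_mul2l -mulnn; apply/orP; right; nia.
  have h v : rawc a v < n.+1.
    rewrite ltnS /rawc; case: (a v) => // u; exact: leq_trans (ltn_ord _) le.
  by rewrite all_cat !all_map; apply/andP; split; apply/allP => i _ /=; exact: h.
rewrite /enc_instance 3!size_cat.
have h3 := ass _ alpha gn; have h4 := ass _ beta hN.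
have h1 : size (enc_graph nm G) <= 4 * n ^ 2.
  by apply: col => // c hc; rewrite mem_cat hc.
have h2 : size (enc_graph nm H) <= 4 * n ^ 2.
  by apply: col => // c hc; rewrite mem_cat hc orbT.
by lia.
Qed.

(** If k1 = 0, the first summand vanishes, and the second takes over because k2 is then positive. *)
Lemma space_bound_ge n : 1 <= k1 + k2 -> n ^ k1 * trunc_log 2 n <= space_bound k1 k2 n.
Proof.
move=> hk; rewrite /space_bound; case: k1 hk => [|k] hk.
  by rewrite add0n in hk; rewrite expn0 mul1n !mul0n add0n leq_pmull // expn_gt0 hk.
apply: leq_trans (leq_addr _ _); rewrite leq_mul2r; apply/orP; right.
by rewrite leq_pmull // muln_gt0 addn1.
Qed.

(** Each tape holds O(n^k1) entries of O(log n) bits. For n >= 2 the logarithm is at least 1 and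
    absorbs the additive constants. *)
Lemma space_estimate (G H : cgraph) alpha beta nm (n := maxn (nb_vertices G) (nb_vertices H))
   (w := @enc_instance k1 k2 nm G H alpha beta) :
  color_naming G H nm -> 1 <= k1 + k2 -> 2 <= n ->
  forall m, \sum_(i < m) (Bd (value_bound w) (nidx k1 (iN w)) i).+1 <=
    m * (2 * 3 ^ k1 * (2 * ((2 * (k1 + k2) + 12) * D) + 2) + (2 * ((2 * (k1 + k2) + 12) * D)) + 5)
    * space_bound k1 k2 n.
Proof.
move=> cn hk n2 m; set a := (2 * (k1 + k2) + 12) * D.
set V := value_bound w; set Mx := nidx k1 (iN w); set lg := trunc_log 2 n.
have lg1 : 0 < lg by rewrite /lg trunc_log_gt0.
(* Since 2 <= n, the coefficient of n^2 is at most n raised to that coefficient. *)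
have wn : (size w).+2 <= n ^ (2 * (k1 + k2) + 12).
  have := size_instance alpha beta cn n2; rewrite -/n -/w => h.
  have q : 8 + 2 * (k1 + k2) + 1 <= n ^ (8 + 2 * (k1 + k2) + 1).
    exact: ltnW (ltn_expl _ n2).
  have n22 : 2 <= n ^ 2 by rewrite -mulnn; nia.
  apply: (@leq_trans (n ^ (8 + 2 * (k1 + k2) + 1) * n ^ 2)).
    by apply: leq_trans (leq_mul q (leqnn (n ^ 2))); lia.
  by rewrite -expnD leq_pexp2l; lia.
have Vn : V <= n ^ a by rewrite /V /value_bound /a expnM; apply: exp_mono.
have lV : Lb V <= 2 * a * lg + 1.
  rewrite /Lb addn1 ltnS.
  have : V <= 2 ^ (2 * a * lg).
    (* Here n < 2^(lg + 1), and lg + 1 <= 2 lg because lg is positive. *)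
    apply: leq_trans Vn _; apply: (@leq_trans ((2 ^ lg.+1) ^ a)).
      by apply: exp_mono; apply: ltnW; apply: trunc_log_ltn.
    by rewrite -expnM leq_pexp2l //; nia.
  by move/(leq_trunc_log 2); rewrite trunc_expnK.
(* The base N + 1 is at most 2 n + 1, hence at most 3 n. *)
have Mn : Mx <= 2 * 3 ^ k1 * n ^ k1.
  rewrite /Mx /nidx /ntup -mulnA leq_mul2l /= -expnMn; apply: exp_mono.
  rewrite /base N_ok; have := leq_maxl (nb_vertices G) (nb_vertices H).
  by have := leq_maxr (nb_vertices G) (nb_vertices H); rewrite -/n; lia.
have nk : 0 < n ^ k1 by rewrite expn_gt0; lia.
apply: (@leq_trans (\sum_(i < m) (Mx * (Lb V).+1 + Lb V + 4))).
  by apply: leq_sum => i _; rewrite /Bd; case: odd; lia.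
rewrite sum_nat_const card_ord -mulnA leq_mul2l; apply/orP; right.
apply: leq_trans (leq_mul (leqnn _) (space_bound_ge n hk)); rewrite -/lg.
set p := n ^ k1 in Mn nk *.
apply: (@leq_trans (2 * 3 ^ k1 * p * (2 * a * lg + 2) + (2 * a * lg + 1) + 4)).
  rewrite !leq_add //; apply: leq_mul => //; lia.
have pl : 1 <= p * lg by rewrite muln_gt0 nk.
have h1 : 2 * 3 ^ k1 * p * (2 * a * lg + 2) <= 2 * 3 ^ k1 * (2 * a + 2) * (p * lg).
  by move: (2 * 3 ^ k1) => q; nia.
have h2 : 2 * a * lg + 5 <= (2 * a + 5) * (p * lg) by nia.
rewrite mulnDl mulnDl; move: h1 h2; rewrite mulnDl; lia.
Qed.

End Resources.

Theorem theorem27 (k1 k2 : nat) (hk : 1 <= k1 + k2) :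
  exists (M : DTM letter) (C c d : nat),
  forall (G H : cgraph)
         (alpha : assignment (var k1 k2) G) (beta : assignment (var k1 k2) H)
         (nm : nat -> nat),
    configuration alpha beta ->
    color_naming G H nm ->
    let w := enc_instance nm alpha beta in
    let n := maxn (nb_vertices G) (nb_vertices H) in
    exists T : nat,
      [/\ halted (run M w T),
          cstate (run M w T) = accept M <-> C_equiv alpha beta,
          T <= c * size w ^ d + c
        & 2 <= n -> space_used M w T <= C * space_bound k1 k2 n].
Proof.
have [c [d hcd]] := time_bound k1 k2.
exists (machine (program (expr_size k1) (expr_main k1 k2))).
(* The space constant is left open; [space_estimate], taken at the number of tapes, determines
   it. *)
eexists; exists c, d => G H alpha beta nm conf cn w n.
have [t [d' [ex le]]] := program_answer k1 k2 w.
have [r1 r2 r3] := machine_run ex; exists t; split=> //.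
- exact: (iff_trans r2 (answerP conf cn hk)).
- exact: hcd.
- by move=> n2; apply: leq_trans r3 _; exact: space_estimate.
Qed.
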